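(* Let $A_{10}$ be the alternating group on $10$ letters. The fundamental group $\pi_1(\mathcal{A}_3(A_{10}))$ is not a free group. More precisely, it is isomorphic to a free product of the free group on $25200$ generators and a non-free group whose abelianization is $\mathbb{Z}^{42}$.
   Context: For a finite group $G$ and a prime $p$, $\mathcal{A}_p(G)$ is the poset of non-trivial elementary abelian $p$-subgroups of $G$ ordered by inclusion. The fundamental group of a finite poset is that of the geometric realization of its order complex, whose simplices are the non-empty chains of the poset. *)

(* Defs.v *)
From HB Require Import structures.
From mathcomp Require Import all_boot all_order all_algebra.
From mathcomp Require Import all_fingroup all_solvable generic_quotient.
From mathcomp Require Import all_classical all_reals topology normedtype.
From mathcomp Require Import homotopy lra.

Set Implicit Arguments.
Unset Strict Implicit.
Unset Printing Implicit Defensive.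

Import Order.TTheory GRing.Theory Num.Theory.
Import numFieldNormedType.Exports.

Local Open Scope classical_set_scope.
Local Open Scope ring_scope.
Local Open Scope quotient_scope.

(** A set with operations satisfying the group laws up to an equivalence
    relation that is compatible with the product. *)
Record setoid_group := SetoidGroup {
  sg_sort :> choiceType;
  sg_eqv : sg_sort -> sg_sort -> Prop;
  sg_mul : sg_sort -> sg_sort -> sg_sort;
  sg_one : sg_sort;
  sg_inv : sg_sort -> sg_sort;
  sg_refl : forall a, sg_eqv a a;
  sg_sym : forall a b, sg_eqv a b -> sg_eqv b a;
  sg_trans : forall a b c, sg_eqv a b -> sg_eqv b c -> sg_eqv a c;
  sg_mul_eqv : forall a a' b b',
    sg_eqv a a' -> sg_eqv b b' -> sg_eqv (sg_mul a b) (sg_mul a' b');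
  sg_mulA : forall a b c,
    sg_eqv (sg_mul a (sg_mul b c)) (sg_mul (sg_mul a b) c);
  sg_mul1 : forall a, sg_eqv (sg_mul sg_one a) a;
  sg_mulr1 : forall a, sg_eqv (sg_mul a sg_one) a;
  sg_mulV : forall a, sg_eqv (sg_mul (sg_inv a) a) sg_one;
  sg_mulrV : forall a, sg_eqv (sg_mul a (sg_inv a)) sg_one
}.

Section QuotientGroup.
Variable S : setoid_group.

Definition sg_eqvb (a b : S) : bool := `[< sg_eqv a b >].

Lemma sg_eqvb_refl : reflexive sg_eqvb.
Proof. by move=> a; apply/asboolP/sg_refl. Qed.

Lemma sg_eqvb_sym : symmetric sg_eqvb.
Proof. by move=> a b; apply/asboolP/asboolP; exact: sg_sym. Qed.

Lemma sg_eqvb_trans : transitive sg_eqvb.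
Proof.
move=> b a c /asboolP ab /asboolP bc; apply/asboolP; exact: sg_trans ab bc.
Qed.

Definition sg_equiv : equiv_rel S :=
  EquivRel sg_eqvb sg_eqvb_refl sg_eqvb_sym sg_eqvb_trans.

Definition sg_quot : Type := {eq_quot sg_equiv}.
HB.instance Definition _ := Choice.on sg_quot.
HB.instance Definition _ := EqQuotient.on sg_quot.

Lemma sg_piP (a b : S) : \pi_sg_quot a = \pi_sg_quot b <-> sg_eqv a b.
Proof.
split=> [/eqP|ab]; first by rewrite (@eqmodE S sg_equiv) => /asboolP.
by apply/eqP; rewrite (@eqmodE S sg_equiv); apply/asboolP.
Qed.

Lemma sg_repr_pi (a : S) : sg_eqv (repr (\pi_sg_quot a)) a.
Proof. by apply/sg_piP; rewrite reprK. Qed.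

Definition quot_mul (u v : sg_quot) : sg_quot :=
  \pi_sg_quot (sg_mul (repr u) (repr v)).
Definition quot_one : sg_quot := \pi_sg_quot (sg_one S).
Definition quot_inv (u : sg_quot) : sg_quot := \pi_sg_quot (sg_inv (repr u)).

Lemma quot_mulE (a b : S) :
  quot_mul (\pi_sg_quot a) (\pi_sg_quot b) = \pi_sg_quot (sg_mul a b).
Proof. by apply/sg_piP/sg_mul_eqv; exact: sg_repr_pi. Qed.

Lemma quot_invE (a : S) : quot_mul (quot_inv (\pi_sg_quot a)) (\pi_sg_quot a) =
  quot_one /\ quot_mul (\pi_sg_quot a) (quot_inv (\pi_sg_quot a)) = quot_one.
Proof.
have ra := sg_sym (sg_repr_pi a).
by split; rewrite quot_mulE; apply/sg_piP;
  [apply: sg_trans (sg_mulV (repr (\pi_sg_quot a)))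
  |apply: sg_trans (sg_mulrV (repr (\pi_sg_quot a)))];
  apply: sg_mul_eqv => //; exact: sg_refl.
Qed.

Lemma quot_mulA : associative quot_mul.
Proof.
elim/quotW=> a; elim/quotW=> b; elim/quotW=> c.
rewrite (quot_mulE a b) (quot_mulE b c) !quot_mulE.
exact/sg_piP/sg_mulA.
Qed.

Lemma quot_mul1 : left_id quot_one quot_mul.
Proof. by elim/quotW=> a; rewrite quot_mulE; exact/sg_piP/sg_mul1. Qed.

Lemma quot_mulr1 : right_id quot_one quot_mul.
Proof. by elim/quotW=> a; rewrite quot_mulE; exact/sg_piP/sg_mulr1. Qed.

Lemma quot_mulV : left_inverse quot_one quot_inv quot_mul.
Proof. by elim/quotW=> a; case: (quot_invE a). Qed.

Lemma quot_mulrV : right_inverse quot_one quot_inv quot_mul.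
Proof. by elim/quotW=> a; case: (quot_invE a). Qed.

HB.instance Definition _ := isGroup.Build sg_quot
  quot_mulA quot_mul1 quot_mulr1 quot_mulV quot_mulrV.

Definition quotient_group : groupType := sg_quot.

End QuotientGroup.

Definition isomorphic (G H : groupType) : Prop :=
  exists f : {multiplicative G -> H}, bijective f.

(** The congruence on the free monoid of words generated by [r]. *)
Inductive word_eqv (A : Type) (r : seq A -> seq A -> Prop) :
    seq A -> seq A -> Prop :=
| word_refl u : word_eqv r u u
| word_sym u v : word_eqv r u v -> word_eqv r v u
| word_trans u v w : word_eqv r u v -> word_eqv r v w -> word_eqv r u w
| word_step a u v b : r u v -> word_eqv r (a ++ u ++ b) (a ++ v ++ b).

Section WordGroup.
Variables (A : choiceType) (r : seq A -> seq A -> Prop) (inv : A -> A).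
Hypothesis invl : forall a, word_eqv r [:: inv a; a] [::].
Hypothesis invr : forall a, word_eqv r [:: a; inv a] [::].

Lemma word_ctx a u v b : word_eqv r u v -> word_eqv r (a ++ u ++ b) (a ++ v ++ b).
Proof.
elim=> {u v} [u|u v _|u v w _ uv _ vw|c u v d uv].
- exact: word_refl.
- exact: word_sym.
- exact: word_trans uv vw.
- have := word_step (a ++ c) (d ++ b) uv.
  by rewrite -!catA.
Qed.

Lemma word_cat u u' v v' :
  word_eqv r u u' -> word_eqv r v v' -> word_eqv r (u ++ v) (u' ++ v').
Proof.
move=> uu' vv'; apply: (@word_trans _ _ _ (u' ++ v)).
  exact: (@word_ctx [::] _ _ v uu').
by have := @word_ctx u' _ _ [::] vv'; rewrite !cats0.
Qed.

Definition word_inv (u : seq A) : seq A := rev (map inv u).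

Lemma word_invl u : word_eqv r (word_inv u ++ u) [::].
Proof.
elim: u => [|a u IHu]; first exact: word_refl.
rewrite /word_inv /= rev_cons -cats1 -catA /=; apply: word_trans IHu.
by have := @word_ctx (word_inv u) _ _ u (invl a).
Qed.

Lemma word_invr u : word_eqv r (u ++ word_inv u) [::].
Proof.
elim: u => [|a u IHu]; first exact: word_refl.
rewrite /word_inv /= rev_cons -cats1 -cat1s.
rewrite [u ++ _]catA; apply: word_trans (invr a).
exact: (@word_ctx [:: a] _ _ [:: inv a] IHu).
Qed.

Definition word_setoid : setoid_group.
Proof.
refine (@SetoidGroup (seq A) (word_eqv r) cat [::] word_inv (@word_refl _ r)
  (@word_sym _ r) (@word_trans _ r) word_cat _ _ _ word_invl word_invr).
- by move=> u v w; rewrite catA; exact: word_refl.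
- by move=> u; exact: word_refl.
- by move=> u; rewrite cats0; exact: word_refl.
Defined.

End WordGroup.

(** The letter [(x, true)] stands for the generator [x] and [(x, false)] for
    its inverse. *)
Inductive free_rel (X : Type) : seq (X * bool) -> seq (X * bool) -> Prop :=
| free_cancel x b : free_rel [:: (x, b); (x, ~~ b)] [::].

Section FreeGroup.
Variable X : choiceType.

Definition letter_inv (a : X * bool) : X * bool := (a.1, ~~ a.2).

Lemma free_invr a : word_eqv (@free_rel X) [:: a; letter_inv a] [::].
Proof. by case: a => x b; exact: (word_step [::] [::] (free_cancel x b)). Qed.

Lemma free_invl a : word_eqv (@free_rel X) [:: letter_inv a; a] [::].
Proof.
by case: a => x b; have := free_invr (x, ~~ b); rewrite /letter_inv /= negbK.
Qed.

Definition free_group : groupType :=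
  quotient_group (word_setoid free_invl free_invr).

End FreeGroup.

(** By classical choice, every type of generators is a [choiceType]. *)
Definition is_free (G : groupType) : Prop :=
  exists X : choiceType, isomorphic G (free_group X).

(** The relations that identify a word with letters in G and H with its
    reductions in the free product: multiply adjacent letters of the same
    factor, delete identities. *)
Inductive prod_rel (G H : groupType) : seq (G + H) -> seq (G + H) -> Prop :=
| prod_mull x y : prod_rel [:: inl x; inl y] [:: inl (x * y)%g]
| prod_mulr x y : prod_rel [:: inr x; inr y] [:: inr (x * y)%g]
| prod_onel : prod_rel [:: inl 1%g] [::]
| prod_oner : prod_rel [:: inr 1%g] [::].

Section FreeProduct.
Variables G H : groupType.

Definition sum_inv (a : G + H) : G + H :=
  match a with inl x => inl x^-1%g | inr y => inr y^-1%g end.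

Let step u v (uv : @prod_rel G H u v) : word_eqv (@prod_rel G H) u v.
Proof. by have := word_step [::] [::] uv; rewrite !cat0s !cats0. Qed.

Lemma prod_invr a : word_eqv (@prod_rel G H) [:: a; sum_inv a] [::].
Proof.
case: a => x /=.
  by apply: word_trans (step (prod_mull _ _ _)) _; rewrite mulgV; exact/step/prod_onel.
by apply: word_trans (step (prod_mulr _ _ _)) _; rewrite mulgV; exact/step/prod_oner.
Qed.

Lemma prod_invl a : word_eqv (@prod_rel G H) [:: sum_inv a; a] [::].
Proof.
case: a => x /=.
  by apply: word_trans (step (prod_mull _ _ _)) _; rewrite mulVg; exact/step/prod_onel.
by apply: word_trans (step (prod_mulr _ _ _)) _; rewrite mulVg; exact/step/prod_oner.
Qed.

Definition free_product : groupType :=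
  quotient_group (word_setoid prod_invl prod_invr).

End FreeProduct.

(** The derived subgroup of the library exists for finite groups only. *)
Inductive commutator_subgroup (G : groupType) : G -> Prop :=
| commutator_gen x y : commutator_subgroup [~ x, y]%g
| commutator_one : commutator_subgroup 1%g
| commutator_mul x y : commutator_subgroup x -> commutator_subgroup y ->
    commutator_subgroup (x * y)%g
| commutator_inv x : commutator_subgroup x -> commutator_subgroup x^-1%g.

Section Abelianization.
Local Open Scope group_scope.
Variable G : groupType.
Implicit Types x y z : G.

Definition same_coset x y : Prop := commutator_subgroup (x^-1 * y).

Lemma commutator_conj x z :
  commutator_subgroup x -> commutator_subgroup (x ^ z).
Proof.
elim=> [a b||a b _ Ca _ Cb|a _ Ca].
- by rewrite conjRg; exact: commutator_gen.
- by rewrite conj1g; exact: commutator_one.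
- by rewrite conjMg; exact: commutator_mul.
- by rewrite conjVg; exact: commutator_inv.
Qed.

Definition abelianization_setoid : setoid_group.
Proof.
refine (@SetoidGroup G same_coset (fun x y => x * y) 1 (fun x => x^-1)
  _ _ _ _ _ _ _ _ _); rewrite /same_coset.
- by move=> x; rewrite mulVg; exact: commutator_one.
- by move=> x y /commutator_inv; rewrite invgM invgK.
- move=> x y z xy /(commutator_mul xy).
  by rewrite mulgA mulgK.
- move=> x x' y y' xx' yy'.
  have := commutator_mul (commutator_conj y xx') yy'.
  by rewrite /conjg invgM !mulgA mulgK.
- by move=> x y z; rewrite (mulgA x) mulVg; exact: commutator_one.
- by move=> x; rewrite mul1g mulVg; exact: commutator_one.
- by move=> x; rewrite mulg1 mulVg; exact: commutator_one.
- by move=> x; rewrite mulVg mulg1 invg1; exact: commutator_one.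
- by move=> x; rewrite mulgV mulg1 invg1; exact: commutator_one.
Defined.

Definition abelianization : groupType := quotient_group abelianization_setoid.

End Abelianization.

Section UnitInterval.
Variable R : realType.

Definition unit_interval : Type := set_type (`[0, 1]%classic : set R).
HB.instance Definition _ := Topological.on unit_interval.

Lemma clamp_subproof (r : R) :
  Num.min 1 (Num.max 0 r) \in (`[0, 1]%classic : set R).
Proof.
by rewrite inE /= in_itv /= le_min ler01 le_max lexx ge_min lexx.
Qed.

Definition clamp (r : R) : unit_interval :=
  SigSub (clamp_subproof r).

Lemma unit_interval_bound (t : unit_interval) : 0 <= set_val t <= 1.
Proof. by have := set_valP t; rewrite /= in_itv. Qed.

Lemma clampK (r : R) : 0 <= r <= 1 -> set_val (clamp r) = r.
Proof.
by case/andP=> r0 r1; rewrite set_valE /= (max_idPr r0) (min_idPr r1).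
Qed.

Lemma clamp_val (t : unit_interval) : clamp (set_val t) = t.
Proof. by apply: val_inj; apply: clampK; exact: unit_interval_bound. Qed.

Lemma unit_interval_neq : clamp 0 != clamp 1.
Proof.
apply/eqP=> /(congr1 set_val); rewrite !clampK ?lexx ?ler01 //.
by move=> /esym/eqP; rewrite oner_eq0.
Qed.

HB.instance Definition _ :=
  isBiPointed.Build unit_interval unit_interval_neq.

Lemma set_val_continuous : continuous (set_val : unit_interval -> R).
Proof. exact: initial_continuous. Qed.

Lemma continuous_clamp (X : topologicalType) (f : X -> R) :
  continuous f -> continuous (fun x => clamp (f x)).
Proof.
move=> cf; apply: continuous_comp_initial => x.
apply: (@continuous_min R X (fun=> 1) (fun x => Num.max 0 (f x))).
  exact: cst_continuous.
by apply: (@continuous_max R X (fun=> 0) f); [exact: cst_continuous|exact: cf].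
Qed.

End UnitInterval.

Section Pasting.
Variables (R : realType) (X T : topologicalType).

Lemma continuous_paste (h : X -> R) (c : R) (f g : X -> T) :
  continuous h -> continuous f -> continuous g ->
  (forall x, h x = c -> f x = g x) ->
  continuous (fun x => if h x <= c then f x else g x).
Proof.
move=> ch cf cg fg x U.
case: (ltgtP (h x) c) => [hc|hc|/fg fgx] xU.
- have hU : \forall y \near x, h y < c by exact: (cvgr_lt _ (ch x)).
  have fU : \forall y \near x, U (f y) by exact: cf.
  by apply: filterS2 fU hU => y fy hy; rewrite /= (ltW hy).
- have hU : \forall y \near x, c < h y by exact: (cvgr_gt _ (ch x)).
  have gU : \forall y \near x, U (g y) by exact: cg.
  by apply: filterS2 gU hU => y gy hy; rewrite /= leNgt hy.
- have fU : \forall y \near x, U (f y) by exact: cf.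
  have gU : \forall y \near x, U (g y) by apply: cg; rewrite -fgx.
  by apply: filterS2 fU gU => y fy gy /=; case: ifP.
Qed.

Lemma contD (f g : X -> R) :
  continuous f -> continuous g -> continuous (fun x => f x + g x).
Proof. by move=> cf cg x; exact: (cvgD (cf x) (cg x)). Qed.

Lemma contB (f g : X -> R) :
  continuous f -> continuous g -> continuous (fun x => f x - g x).
Proof. by move=> cf cg x; exact: (cvgB (cf x) (cg x)). Qed.

Lemma contM (f g : X -> R) :
  continuous f -> continuous g -> continuous (fun x => f x * g x).
Proof. by move=> cf cg x; exact: (cvgM (cf x) (cg x)). Qed.

Lemma contC (c : R) : continuous (fun _ : X => c).
Proof. by move=> x; exact: cvg_cst. Qed.

End Pasting.

Section FundamentalGroup.
Variables (R : realType) (T : topologicalType) (x0 : T).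

Local Notation I := (unit_interval R).
Local Notation loop := {path I from x0 to x0 in T}.

(** Homotopy relative to the endpoints; [t] is the path parameter in
    [H (t, s)] and [s] the homotopy parameter. *)
Definition path_homotopic (p q : loop) : Prop :=
  exists H : I * I -> T, [/\ continuous H,
    forall t, H (t, zero) = p t, forall t, H (t, one) = q t,
    forall s, H (zero, s) = x0 & forall s, H (one, s) = x0].

Let val0 : set_val (zero : I) = 0.
Proof. by rewrite clampK // lexx ler01. Qed.

Let val1 : set_val (one : I) = 1.
Proof. by rewrite clampK // lexx ler01. Qed.

Let v1 (z : I * I) : R := set_val z.1.
Let v2 (z : I * I) : R := set_val z.2.

Let cv1 : continuous v1.
Proof.
by move=> z; apply: continuous_comp; [exact: cvg_fst|exact: set_val_continuous].
Qed.

Let cv2 : continuous v2.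
Proof.
by move=> z; apply: continuous_comp; [exact: cvg_snd|exact: set_val_continuous].
Qed.

Let cpath (p : loop) (X : topologicalType) (f : X -> R) :
  continuous f -> continuous (fun x => p (clamp (f x))).
Proof.
move=> cf z; apply: (@continuous_comp X I T (fun x => clamp (f x)) p).
  exact: continuous_clamp.
exact: cts_fun.
Qed.

Let cpair (H : I * I -> T) (X : topologicalType) (f g : X -> R) :
  continuous H -> continuous f -> continuous g ->
  continuous (fun x => H (clamp (f x), clamp (g x))).
Proof.
move=> cH cf cg z; apply: (@continuous_comp X (I * I)%type T
  (fun x => (clamp (f x), clamp (g x))) H); last exact: cH.
exact: (cvg_pair (@continuous_clamp _ _ _ cf z) (@continuous_clamp _ _ _ cg z)).
Qed.

Let clamp_le0 (r : R) : r <= 0 -> clamp r = zero.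
Proof.
by move=> r0; apply: val_inj; rewrite /= (max_idPl r0) maxxx.
Qed.

Let clamp_ge1 (r : R) : 1 <= r -> clamp r = one.
Proof.
move=> r1; apply: val_inj => /=.
rewrite (max_idPr (le_trans ler01 r1)) (max_idPr ler01) minxx.
by rewrite (min_idPl r1).
Qed.

Definition loop_mul_fun (p q : loop) (t : I) : T :=
  if set_val t <= 2^-1 then p (clamp (2 * set_val t))
  else q (clamp (2 * set_val t - 1)).

Definition loop_inv_fun (p : loop) (t : I) : T := p (clamp (1 - set_val t)).

Lemma loop_mul_continuous p q : continuous (loop_mul_fun p q).
Proof.
have cv := @set_val_continuous R.
have c2 := contM (@contC R I 2) cv.
apply: continuous_paste => //; [exact: cpath|exact: cpath (contB c2 (@contC R I 1))|].
move=> t ->; rewrite divff ?pnatr_eq0 // subrr clamp_ge1 // clamp_le0 //.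
by rewrite path_one path_zero.
Qed.

Lemma loop_mul0 p q : loop_mul_fun p q zero = x0.
Proof.
rewrite /loop_mul_fun val0 invr_ge0 ler0n mulr0 clamp_le0 //.
by rewrite path_zero.
Qed.

Lemma loop_mul1 p q : loop_mul_fun p q one = x0.
Proof.
rewrite /loop_mul_fun val1 leNgt invf_lt1 ?ltr1n ?ltr0n //=.
by rewrite mulr1 clamp_ge1 ?path_one // lerBrDr.
Qed.

Definition loop_mul (p q : loop) : loop :=
  mk_path (@loop_mul_continuous p q) (loop_mul0 p q) (loop_mul1 p q).

Lemma loop_inv_continuous p : continuous (loop_inv_fun p).
Proof.
exact: cpath (contB (@contC R I 1) (@set_val_continuous R)).
Qed.

Lemma loop_inv0 p : loop_inv_fun p zero = x0.
Proof. by rewrite /loop_inv_fun val0 subr0 clamp_ge1 // path_one. Qed.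

Lemma loop_inv1 p : loop_inv_fun p one = x0.
Proof. by rewrite /loop_inv_fun val1 subrr clamp_le0 // path_zero. Qed.

Definition loop_inv (p : loop) : loop :=
  mk_path (@loop_inv_continuous p) (loop_inv0 p) (loop_inv1 p).

Definition loop_one : loop := cst x0 : I -> T.

Lemma path_homotopic_refl p : path_homotopic p p.
Proof.
exists (fun z => p z.1); split=> [||||] //=.
- by move=> z; apply: (@continuous_comp _ _ _ fst p); [exact: cvg_fst|exact: cts_fun].
- by move=> s; rewrite path_zero.
- by move=> s; rewrite path_one.
Qed.

Lemma path_homotopic_reparam (p q q' : loop) (f g : R -> R) :
  continuous f -> continuous g -> f 0 = g 0 -> f 1 = g 1 ->
  (forall t, q t = p (clamp (f (set_val t)))) ->
  (forall t, q' t = p (clamp (g (set_val t)))) ->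
  path_homotopic q q'.
Proof.
move=> cf cg f0 f1 qf qg.
pose h (z : I * I) := (1 - v2 z) * f (v1 z) + v2 z * g (v1 z).
have ch : continuous h.
  have cfv : continuous (fun z => f (v1 z)).
    by move=> z; apply: continuous_comp; [exact: cv1|exact: cf].
  have cgv : continuous (fun z => g (v1 z)).
    by move=> z; apply: continuous_comp; [exact: cv1|exact: cg].
  apply: contD; last exact: contM.
  by apply: contM => //; apply: contB => //; exact: contC.
exists (fun z => p (clamp (h z))); split.
- exact: cpath.
- by move=> t; rewrite /h /v1 /v2 /= val0 subr0 mul1r mul0r addr0 qf.
- by move=> t; rewrite /h /v1 /v2 /= val1 subrr mul1r mul0r add0r qg.
- move=> s; rewrite /h /v1 /v2 /= val0 f0 -mulrDl subrK mul1r.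
  by rewrite -val0 -qg path_zero.
- move=> s; rewrite /h /v1 /v2 /= val1 f1 -mulrDl subrK mul1r.
  by rewrite -val1 -qg path_one.
Qed.

Lemma path_homotopic_sym p q : path_homotopic p q -> path_homotopic q p.
Proof.
case=> H [cH Hp Hq H0 H1].
exists (fun z => H (clamp (v1 z), clamp (1 - v2 z))); split.
- by apply: cpair => //; apply: contB => //; exact: contC.
- by move=> t; rewrite /v1 /v2 /= val0 subr0 clamp_val clamp_ge1.
- by move=> t; rewrite /v1 /v2 /= val1 subrr clamp_val clamp_le0.
- by move=> s; rewrite /v1 /= clamp_val.
- by move=> s; rewrite /v1 /= clamp_val.
Qed.

Lemma path_homotopic_trans p q r :
  path_homotopic p q -> path_homotopic q r -> path_homotopic p r.
Proof.
case=> H [cH Hp Hq H0 H1] [K [cK Kq Kr K0 K1]].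
have c2 := contM (@contC R (I * I)%type 2) cv2.
exists (fun z => if v2 z <= 2^-1 then H (clamp (v1 z), clamp (2 * v2 z))
                 else K (clamp (v1 z), clamp (2 * v2 z - 1))); split.
- apply: continuous_paste => //; [exact: cpair| |].
    by apply: cpair => //; apply: contB => //; exact: contC.
  move=> z ->; rewrite divff ?pnatr_eq0 // subrr clamp_val.
  by rewrite clamp_ge1 // clamp_le0 // Hq Kq.
- move=> t; rewrite /v1 /v2 /= val0 invr_ge0 ler0n mulr0 clamp_val.
  by rewrite clamp_le0.
- move=> t; rewrite /v1 /v2 /= val1 leNgt invf_lt1 ?ltr1n ?ltr0n //=.
  by rewrite clamp_val mulr1 clamp_ge1 // lerBrDr.
- by move=> s; rewrite /v1 /= !clamp_val H0 K0 if_same.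
- by move=> s; rewrite /v1 /= !clamp_val H1 K1 if_same.
Qed.

Lemma loop_mul_homotopic p p' q q' : path_homotopic p p' ->
  path_homotopic q q' -> path_homotopic (loop_mul p q) (loop_mul p' q').
Proof.
case=> H [cH Hp Hp' H0 H1] [K [cK Kq Kq' K0 K1]].
have c2 := contM (@contC R (I * I)%type 2) cv1.
exists (fun z => if v1 z <= 2^-1 then H (clamp (2 * v1 z), clamp (v2 z))
                 else K (clamp (2 * v1 z - 1), clamp (v2 z))); split.
- apply: continuous_paste => //; [exact: cpair| |].
    by apply: cpair => //; apply: contB => //; exact: contC.
  move=> z ->; rewrite divff ?pnatr_eq0 // subrr clamp_val.
  by rewrite clamp_ge1 // clamp_le0 // H1 K0.
- by move=> t; rewrite /v1 /v2 /= clamp_val Hp Kq.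
- by move=> t; rewrite /v1 /v2 /= clamp_val Hp' Kq'.
- move=> s; rewrite /v1 /v2 /= val0 invr_ge0 ler0n mulr0 clamp_val.
  by rewrite clamp_le0.
- move=> s; rewrite /v1 /v2 /= val1 leNgt invf_lt1 ?ltr1n ?ltr0n //=.
  by rewrite clamp_val mulr1 clamp_ge1 // lerBrDr.
Qed.

Local Ltac minmax :=
  rewrite ?maxEle ?minEle; do ?case: ifPn; rewrite -?ltNge => *; lra.

Let id_cont : continuous (fun r : R => r).
Proof. by move=> r; exact: cvg_id. Qed.

Let max_cont (f g : R -> R) :
  continuous f -> continuous g -> continuous (fun r => Num.max (f r) (g r)).
Proof. by move=> cf cg r; exact: (@continuous_max R R f g r (cf r) (cg r)). Qed.

Let min_cont (f g : R -> R) :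
  continuous f -> continuous g -> continuous (fun r => Num.min (f r) (g r)).
Proof. by move=> cf cg r; exact: (@continuous_min R R f g r (cf r) (cg r)). Qed.

Let lin_cont (a b : R) : continuous (fun r => a * r + b).
Proof.
by apply: contD; [apply: contM => //; exact: contC|exact: contC].
Qed.

Lemma loop_mulA p q r : path_homotopic
  (loop_mul p (loop_mul q r)) (loop_mul (loop_mul p q) r).
Proof.
pose f (t : R) :=
  Num.max (2^-1 * t + 0) (Num.max (1 * t + - 4^-1) (2 * t + - 1)).
apply: (@path_homotopic_reparam (loop_mul (loop_mul p q) r) _ _ f id).
- by do !apply: max_cont; exact: lin_cont.
- exact: id_cont.
- by rewrite /f /=; minmax.
- by rewrite /f /=; minmax.
- move=> t; have /andP[s0 s1] := unit_interval_bound t.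
  rewrite /= /mk_path /loop_mul_fun /=; set s := set_val t in s0 s1 *.
  have fs : f s = if s <= 2^-1 then 2^-1 * s else
                  if s <= 3 / 4 then s - 4^-1 else 2 * s - 1.
    by rewrite /f; minmax.
  rewrite (clampK (r := f s)); last first.
    by rewrite fs; apply/andP; split; minmax.
  rewrite fs; case: (leP s 2^-1) => s2.
    have -> : 2^-1 * s <= 2^-1 by lra.
    rewrite /mk_path /loop_mul_fun.
    rewrite (clampK (r := 2 * (2^-1 * s))); last by apply/andP; split; lra.
    have -> : 2 * (2^-1 * s) <= 2^-1 by lra.
    by congr (p (clamp _)); lra.
  rewrite /mk_path /loop_mul_fun.
  rewrite (clampK (r := 2 * s - 1)); last by apply/andP; split; lra.
  case: (leP s (3 / 4)) => s3.
    have -> : 2 * s - 1 <= 2^-1 by lra.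
    have -> : s - 4^-1 <= 2^-1 by lra.
    rewrite (clampK (r := 2 * (s - 4^-1))); last by apply/andP; split; lra.
    have /lt_geF -> : 2^-1 < 2 * (s - 4^-1) by lra.
    by congr (q (clamp _)); lra.
  have /lt_geF -> : 2^-1 < 2 * s - 1 by lra.
  by [].
- by move=> t; rewrite clamp_val.
Qed.

Lemma loop_mul1p p : path_homotopic (loop_mul loop_one p) p.
Proof.
pose f (t : R) := Num.max (0 * t + 0) (2 * t + - 1).
apply: (@path_homotopic_reparam p _ _ f id).
- by do !apply: max_cont; exact: lin_cont.
- exact: id_cont.
- by rewrite /f /=; minmax.
- by rewrite /f /=; minmax.
- move=> t; have /andP[s0 s1] := unit_interval_bound t.
  rewrite /= /mk_path /loop_mul_fun /=; set s := set_val t in s0 s1 *.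
  case: (leP s 2^-1) => s2.
    have fs : f s <= 0 by rewrite /f; minmax.
    by rewrite (clamp_le0 fs) path_zero.
  by congr (p (clamp _)); rewrite /f; minmax.
- by move=> t; rewrite clamp_val.
Qed.

Lemma loop_mulp1 p : path_homotopic (loop_mul p loop_one) p.
Proof.
pose f (t : R) := Num.min (0 * t + 1) (2 * t + 0).
apply: (@path_homotopic_reparam p _ _ f id).
- by do !apply: min_cont; exact: lin_cont.
- exact: id_cont.
- by rewrite /f /=; minmax.
- by rewrite /f /=; minmax.
- move=> t; have /andP[s0 s1] := unit_interval_bound t.
  rewrite /= /mk_path /loop_mul_fun /=; set s := set_val t in s0 s1 *.
  case: (leP s 2^-1) => s2.
    by congr (p (clamp _)); rewrite /f; minmax.
  have fs : 1 <= f s by rewrite /f; minmax.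
  by rewrite (clamp_ge1 fs) path_one.
- by move=> t; rewrite clamp_val.
Qed.

Lemma loop_mulpV p : path_homotopic (loop_mul p (loop_inv p)) loop_one.
Proof.
pose f (t : R) := Num.min (2 * t + 0) (- 2 * t + 2).
apply: (@path_homotopic_reparam p _ _ f (fun=> 0)).
- by do !apply: min_cont; exact: lin_cont.
- exact: contC.
- by rewrite /f /=; minmax.
- by rewrite /f /=; minmax.
- move=> t; have /andP[s0 s1] := unit_interval_bound t.
  rewrite /= /mk_path /loop_mul_fun /=; set s := set_val t in s0 s1 *.
  case: (leP s 2^-1) => s2.
    by congr (p (clamp _)); rewrite /f; minmax.
  rewrite /mk_path /loop_inv_fun (clampK (r := 2 * s - 1)); last by apply/andP; split; lra.
  by congr (p (clamp _)); rewrite /f; minmax.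
- by move=> t; rewrite clamp_le0 // path_zero.
Qed.

Lemma loop_mulVp p : path_homotopic (loop_mul (loop_inv p) p) loop_one.
Proof.
pose f (t : R) := Num.max (- 2 * t + 1) (2 * t + - 1).
apply: (@path_homotopic_reparam p _ _ f (fun=> 1)).
- by do !apply: max_cont; exact: lin_cont.
- exact: contC.
- by rewrite /f /=; minmax.
- by rewrite /f /=; minmax.
- move=> t; have /andP[s0 s1] := unit_interval_bound t.
  rewrite /= /mk_path /loop_mul_fun /=; set s := set_val t in s0 s1 *.
  case: (leP s 2^-1) => s2.
    rewrite /mk_path /loop_inv_fun (clampK (r := 2 * s)); last by apply/andP; split; lra.
    by congr (p (clamp _)); rewrite /f; minmax.
  by congr (p (clamp _)); rewrite /f; minmax.
- by move=> t; rewrite clamp_ge1 // path_one.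
Qed.

Definition loop_setoid : setoid_group := @SetoidGroup loop
  path_homotopic loop_mul loop_one loop_inv
  path_homotopic_refl path_homotopic_sym path_homotopic_trans
  loop_mul_homotopic loop_mulA loop_mul1p loop_mulp1 loop_mulVp loop_mulpV.

Definition fundamental_group : groupType := quotient_group loop_setoid.

End FundamentalGroup.

(** A point of the realization is its family of barycentric coordinates; as
    [V] is finite, the topology induced by R^V is the usual one. *)
Definition geometric_realization (R : realType) (V : finType)
    (K : {set {set V}}) : set {ptws V -> R} :=
  [set a : {ptws V -> R} | [/\ forall v, 0 <= a v, \sum_v a v = 1
     & [set v | a v != 0]%SET \in K]].

Arguments geometric_realization R {V} K.

Definition order_complex (d : Order.disp_t) (P : finPOrderType d) :
    {set {set P}} :=
  [set s : {set P} | (s != finset.set0) &&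
    [forall x in s, forall y in s, (x >=< y)%O]]%SET.

Definition poset_pi1 (R : realType) (d : Order.disp_t) (P : finPOrderType d)
    (x0 : set_type (geometric_realization R (order_complex P))) : groupType :=
  fundamental_group R x0.

Section ElementaryAbelianPoset.
Variables (gT : finGroupType) (p : nat) (G : {group gT}).

Definition elem_abelian_pred : pred {group gT} :=
  [pred E : {group gT} | (E \in 'E_p(G)%g) && (E :!=: 1%g)].

Definition Ap_poset : Type := {E : {group gT} | elem_abelian_pred E}.
HB.instance Definition _ := SubFinite.on Ap_poset.

Definition Ap_le (E F : Ap_poset) : bool := \val E \subset \val F.

Lemma Ap_le_refl : reflexive Ap_le.
Proof. by move=> E; exact: subxx. Qed.

Lemma Ap_le_anti : antisymmetric Ap_le.
Proof.
by move=> E F EF; apply: val_inj; apply/group_inj/eqP; rewrite finset.eqEsubset.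
Qed.

Lemma Ap_le_trans : transitive Ap_le.
Proof. by move=> E F H; exact: fintype.subset_trans. Qed.

HB.instance Definition _ := Order.Le_isPOrder.Build
  (Order.Disp tt tt) Ap_poset Ap_le_refl Ap_le_anti Ap_le_trans.

End ElementaryAbelianPoset.

(* Main.v *)
Require Import Defs.
From Stdlib Require Import BinNums FMapPositive.
From HB Require Import structures.
From mathcomp Require Import all_boot all_order all_algebra.
From mathcomp Require Import all_fingroup all_solvable generic_quotient.
From mathcomp Require Import zify ring.

Set Implicit Arguments.
Unset Strict Implicit.
Unset Printing Implicit Defensive.

Import GRing.Theory.

(* A regular subgroup, one with an orbit of nine points, is maximal in the poset and has four proper
   nontrivial subgroups, all of order 3 and not regular; so each of the 8400 regular subgroups contributes a cone over four points, that is
   three free generators. The other subgroups are described up to homotopy by their orbits of three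
   points, that is, by simplices of the complex [kneser] of families of disjoint triples: a family s
   goes back to the group [torus s] of the rotations of its members.

   Fundamental groups are handled through edge cocycles: pi_1 with the classes of the edges is
   characterized, up to unique isomorphism, by every cocycle being the image of this one up to a
   change of gauge ([universal]). A cocycle gives a covering, and the values of the morphism are the
   holonomies of sections of it along loops. On the poset a universal cocycle is written down in the
   free product of a free group of rank 25200 and the fundamental group N of [kneser].

   The abelianization of N is found by solving the cocycle equations by propagation along triangles.
   N is not free because two of its characters have a nonzero cup product, seen on a torus inside
   [kneser], while characters of a free group always lift to the Heisenberg group. *)

(** * The complex of disjoint triples of ten points *)

(** The comparison of nonregular subgroups with [kneser] rests on two inclusions: E lies in
    [torus (triple_orbits E)], and the orbits of [<<torus s>>] lie in s. Classically they give a
    homotopy equivalence of posets; here they become explicit gauges between cocycles, and no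
    homotopy types are compared. This is what the universal property is for. With values in
    arbitrary groups, it replaces van Kampen's theorem and edge-path presentations, makes
    isomorphisms and changes of base point formal, and can be fed with Z^42 as well as with the
    Heisenberg group. The propagated table is used twice. Since it is derived from the cocycle
    equations alone, it expresses every cocycle normalized on the tree by its values on the seeds,
    so the 42 classes generate. Since it is itself a cocycle, which is checked by computation, they
    are independent. Non-freeness is proved for every group that retracts onto N. This covers N and
    pi_1 at once, without a theorem on subgroups of free groups. *)

Fixpoint all_bits n : seq bitseq :=
  if n is n'.+1 then map (cons true) (all_bits n') ++ map (cons false) (all_bits n')
  else [:: [::]].

(* A subset of the ten points is encoded by its characteristic bit string; [blt] is the order used
   to orient the edges. *)
Definition triples : seq bitseq := [seq s <- all_bits 10 | count id s == 3].

Definition dis (s t : bitseq) : bool := ~~ has (fun p => p.1 && p.2) (zip s t).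

Fixpoint blt (s t : bitseq) : bool :=
  match s, t with
  | b :: s', c :: t' => if b == c then blt s' t' else b
  | _, _ => false
  end.

(** Index into the binary trie of the table; the closing [xH] marks the length, which makes the
    encoding injective. *)
Fixpoint key (s : bitseq) : positive :=
  if s is b :: s' then (if b then xI (key s') else xO (key s')) else xH.

Definition base_bits : bitseq := head [::] triples.
(** Two triples cover at most six of the ten points, so some triple avoids both: the spanning tree
    rooted at [base_bits] has depth two. *)
Definition parent (s : bitseq) : bitseq :=
  head [::] [seq t <- triples | dis t s && dis t base_bits].

Definition later (s : bitseq) : seq bitseq := [seq t <- triples | blt s t && dis s t].

Definition edges : seq (bitseq * bitseq) :=
  flatten [seq [seq (u, v) | v <- later u] | u <- triples].

Definition triangles : seq (bitseq * bitseq * bitseq) :=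
  flatten [seq [seq (e, w) | w <- later e.2 & dis e.1 w] | e <- edges].

(* Positions in [edges] of 42 edges, found by search: together with the edges of a spanning tree
   they determine every cocycle, and their classes form a basis of the first homology. *)
Definition seeds : seq (bitseq * bitseq) := [seq nth ([::], [::]) edges i | i <-
  [:: 2013; 200; 2023; 191; 2016; 2003; 1811; 261; 1186; 1771; 445; 1791; 270; 1256;
   1813; 226; 241; 472; 1793; 2029; 2028; 2022; 230; 2025; 1361; 1181; 1391; 219; 473;
   1218; 276; 1815; 619; 262; 175; 1408; 1257; 1819; 475; 1802; 1740; 1436]].

(** Vectors of Z^42 are lists here, which [vm_compute] can evaluate. *)
Definition vadd (a b : seq int) : seq int := [seq (p.1 + p.2)%R | p <- zip a b].
Definition vsub (a b : seq int) : seq int := [seq (p.1 - p.2)%R | p <- zip a b].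
Definition vnull : seq int := nseq 42 0%R.
Definition vunit (k : nat) : seq int := mkseq (fun i => (i == k)%:R%R) 42.

(** The initial values: zero along the spanning tree, which fixes the gauge, and a unit vector on
    each seed. *)
Definition entries : seq (bitseq * bitseq * seq int) :=
  [seq (base_bits, s, vnull) | s <- triples & dis base_bits s] ++
  [seq ((if blt (parent s) s then (parent s, s) else (s, parent s)), vnull) |
     s <- triples & (s != base_bits) && ~~ dis base_bits s] ++
  [seq (nth ([::], [::]) seeds k, vunit k) | k <- iota 0 42].

Notation table := (PositiveMap.t (seq int)).

Definition look (m : table) (u v : bitseq) : option (seq int) :=
  PositiveMap.find (key (u ++ v)) m.
Definition put (m : table) (u v : bitseq) (x : seq int) : table :=
  PositiveMap.add (key (u ++ v)) x m.

(** A triangle whose three edges are known is left alone; whether its values agree is decided by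
    [check]. *)
Definition propagate (m : table) (t : bitseq * bitseq * bitseq) : table :=
  let: (u, v, w) := t in
  match look m u v, look m v w, look m u w with
  | Some a, Some b, None => put m u w (vadd a b)
  | Some a, None, Some c => put m v w (vsub c a)
  | None, Some b, Some c => put m u v (vsub c b)
  | _, _, _ => m
  end.

Definition table0 : table :=
  foldl (fun m e => put m e.1.1 e.1.2 e.2) (PositiveMap.empty _) entries.

(* Sixteen sweeps over the triangles reach every edge. *)
Definition final : table := iter 16 (fun m => foldl propagate m triangles) table0.

(** The first condition makes the seeds generate; the other two make the table a cocycle with
    independent values on the seeds. *)
Definition check (m : table) : bool :=
  [&& all (fun e => look m e.1 e.2 != None) edges,
      all (fun t => let: (u, v, w) := t in
        match look m u v, look m v w, look m u w with
        | Some a, Some b, Some c => vadd a b == c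
        | _, _, _ => false end) triangles
    & all (fun e => look m e.1.1 e.1.2 == Some e.2) entries].

Lemma check_final : check final.
Proof. vm_compute. reflexivity. Qed.

Lemma mem_all_bits n s : (s \in all_bits n) = (size s == n).
Proof.
elim: n s => [|n IHn] [|b s] //=; rewrite mem_cat.
  by apply/negbTE; rewrite negb_or; apply/andP; split; apply/mapP => -[].
rewrite eqSS -IHn; case: b.
  rewrite (mem_map (f := cons true)) => [|? ? []] //.
  by case: (boolP (s \in _)) => //= _; apply/mapP => -[].
rewrite [X in _ || X](mem_map (f := cons false)) => [|? ? []] //.
by case: (boolP (s \in _)) => [_|_]; rewrite ?orbT ?orbF //; apply/mapP => -[].
Qed.

Lemma mem_triples s : (s \in triples) = (count id s == 3) && (size s == 10).
Proof. by rewrite mem_filter mem_all_bits. Qed.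

Lemma blt_total s t : size s = size t -> s != t -> blt s t || blt t s.
Proof.
elim: s t => [|b s IHs] [|c t] //= [st]; rewrite eqseq_cons (eq_sym c).
by case: (b == c) / eqP => [_ /(IHs _ st)|] //; case: b; case: c.
Qed.

Lemma blt_asym s t : blt s t -> ~~ blt t s.
Proof.
elim: s t => [|b s IHs] [|c t] //=; rewrite (eq_sym c).
by case: (b == c) / eqP => [_|]; [exact: IHs|case: b; case: c].
Qed.

Lemma blt_irr s : blt s s = false.
Proof. by elim: s => //= b s; rewrite eqxx. Qed.

Lemma blt_trans s t r : blt s t -> blt t r -> blt s r.
Proof.
elim: s t r => [|b s IHs] [|c t] [|d r] //=.
by case: b; case: c; case: d => //=; exact: IHs.
Qed.

Lemma key_inj : injective key.
Proof. by elim=> [|[] s IHs] [|[] t] //= [/IHs ->]. Qed.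

Lemma dis_sym s t : dis s t = dis t s.
Proof.
rewrite /dis; congr (~~ _); elim: s t => [|b s IHs] [|c t] //=.
by rewrite IHs andbC.
Qed.

(** A key encodes the concatenation of two strings; the known length of the first one allows it to
    be split again. *)
Lemma look_put m u v u' v' x : size u = 10 -> size u' = 10 ->
  look (put m u' v' x) u v = if (u == u') && (v == v') then Some x else look m u v.
Proof.
move=> su su'; rewrite /look /put; case: eqP => [->|uu'] /=.
  case: eqP => [->|vv']; first by rewrite PositiveMap.gss.
  rewrite PositiveMap.gso // => /key_inj/eqP.
  by rewrite eqseq_cat // eqxx => /eqP.
rewrite PositiveMap.gso // => /key_inj/eqP.
by rewrite eqseq_cat ?su ?su' // => /andP[/eqP].
Qed.

(** * Triples as subsets of the ten points and as bit strings *)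

Section Kneser.

(** The clique complex of the Kneser graph on the triples of ten points. *)
Definition kneser : {set {set {set 'I_10}}} :=
  [set s | [&& s != set0, [forall S in s, #|(S : {set 'I_10})| == 3] & trivIset s]].

Lemma mem_kneser (s : {set {set 'I_10}}) : reflect
  [/\ s != set0, forall S, S \in s -> #|S| = 3 &
      forall S T, S \in s -> T \in s -> S != T -> [disjoint S & T]] (s \in kneser).
Proof.
rewrite inE; apply: (iffP and3P) => -[s0 s3 st]; split=> //.
- by move=> S /(forall_inP s3)/eqP.
- by move/trivIsetP: st.
- by apply/forall_inP => S /s3/eqP.
- exact/trivIsetP.
Qed.

Lemma kneser_sub (s t : {set {set 'I_10}}) : s \in kneser -> t != set0 -> t \subset s ->
  t \in kneser.
Proof.
case/mem_kneser=> _ s3 st t0 /subsetP ts; apply/mem_kneser; split=> // [S /ts/s3|S T /ts Ss /ts] //.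
exact: st.
Qed.

Lemma kneser1 (S : {set 'I_10}) : ([set S] \in kneser) = (#|S| == 3).
Proof.
apply/mem_kneser/eqP => [[_ c3 _]|S3]; first by apply: c3; rewrite inE.
split=> [|T|T U]; rewrite ?inE; first by apply/set0Pn; exists S; rewrite inE.
  by move/eqP->.
by move=> /eqP-> /eqP->; rewrite eqxx.
Qed.

Lemma kneser3P (S T U : {set 'I_10}) : [set S; T; U] \in kneser ->
  [/\ #|S| = 3, #|T| = 3, #|U| = 3 &
    [/\ S != T -> [disjoint S & T], T != U -> [disjoint T & U] & S != U -> [disjoint S & U]]].
Proof.
case/mem_kneser=> _ c d; split; [apply: c|apply: c|apply: c|split; apply: d];
  by rewrite !inE eqxx ?orbT.
Qed.

Lemma kneser3 (S T U : {set 'I_10}) : #|S| = 3 -> #|T| = 3 -> #|U| = 3 ->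
  [disjoint S & T] -> [disjoint T & U] -> [disjoint S & U] -> [set S; T; U] \in kneser.
Proof.
move=> S3 T3 U3 ST TU SU; apply/mem_kneser; split.
- by apply/set0Pn; exists S; rewrite !inE eqxx.
- by move=> X; rewrite !inE => /orP[/orP[]|] /eqP->.
by move=> X Y; rewrite !inE => /orP[/orP[]|] /eqP-> /orP[/orP[]|] /eqP->;
  rewrite ?eqxx // disjoint_sym.
Qed.

Lemma kneser2 (S T : {set 'I_10}) : #|S| = 3 -> #|T| = 3 -> [disjoint S & T] ->
  [set S; T] \in kneser.
Proof.
move=> S3 T3 ST; apply/mem_kneser; split.
- by apply/set0Pn; exists S; rewrite !inE eqxx.
- by move=> X; rewrite !inE => /orP[] /eqP->.
by move=> X Y; rewrite !inE => /orP[] /eqP-> /orP[] /eqP->; rewrite ?eqxx // disjoint_sym.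
Qed.

Definition bset (s : bitseq) : {set 'I_10} := [set i : 'I_10 | nth false s i].
Definition bits (S : {set 'I_10}) : bitseq := [seq i \in S | i <- enum 'I_10].

Lemma size_bits S : size (bits S) = 10.
Proof. by rewrite size_map size_enum_ord. Qed.

Lemma nth_bits S (i : 'I_10) : nth false (bits S) i = (i \in S).
Proof.
by rewrite (nth_map i) ?size_enum_ord // nth_ord_enum.
Qed.

Lemma bitsK : cancel bits bset.
Proof. by move=> S; apply/setP => i; rewrite inE nth_bits. Qed.

Lemma bsetK s : size s = 10 -> bits (bset s) = s.
Proof.
move=> s10; apply: (@eq_from_nth _ false); first by rewrite size_bits.
by rewrite size_bits => i i10; rewrite (nth_bits _ (Ordinal i10)) inE.
Qed.

Lemma count_bits S : count id (bits S) = #|S|.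
Proof. by rewrite count_map cardE enumT -size_filter; congr size; exact: eq_filter. Qed.

Lemma bits_triples S : (bits S \in triples) = (#|S| == 3).
Proof. by rewrite mem_triples size_bits count_bits eqxx andbT. Qed.

Lemma size_triples s : s \in triples -> size s = 10.
Proof. by rewrite mem_triples => /andP[_ /eqP]. Qed.

Lemma card_bset s : s \in triples -> #|bset s| = 3.
Proof. by move=> st; apply/eqP; rewrite -bits_triples bsetK // size_triples. Qed.

Lemma dis_bits S T : dis (bits S) (bits T) = [disjoint S & T].
Proof.
rewrite /dis; apply/negP/pred0P => [ST i|ST].
  apply/negbTE/negP => /= /andP[iS iT]; apply: ST.
  apply/(has_nthP (false, false)); exists i; first by rewrite size_zip !size_bits minnn.
  by rewrite nth_zip ?size_bits // !nth_bits iS iT.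
case/(has_nthP (false, false)) => i; rewrite size_zip !size_bits minnn => i10.
rewrite nth_zip ?size_bits //= !(nth_bits _ (Ordinal i10)).
by have /= := ST (Ordinal i10) => ->.
Qed.

Lemma dis_bset s t : s \in triples -> t \in triples -> dis s t = [disjoint bset s & bset t].
Proof. by move=> st tt; rewrite -dis_bits !bsetK ?size_triples. Qed.

Lemma dis_neq s t : s \in triples -> dis s t -> s != t.
Proof.
move=> st; apply: contraTneq => <-; rewrite dis_bset // -setI_eq0 setIid.
by rewrite -cards_eq0 card_bset.
Qed.

Lemma mem_later u v : (v \in later u) = [&& blt u v, dis u v & v \in triples].
Proof. by rewrite mem_filter andbA. Qed.

Lemma mem_edges u v : ((u, v) \in edges) = [&& u \in triples, v \in triples, blt u v & dis u v].
Proof.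
apply/flatten_mapP/and4P => [[x xt /mapP[y]]|[ut vt uv duv]].
  by rewrite mem_later => /and3P[h1 h2 h3] [-> ->].
by exists u => //; apply: map_f; rewrite mem_later uv duv.
Qed.

Lemma mem_triangles u v w : ((u, v, w) \in triangles) =
  [&& (u, v) \in edges, (v, w) \in edges & dis u w].
Proof.
apply/flatten_mapP/and3P => [[[x y] xy /mapP[z]]|[uv vw uw]].
  rewrite mem_filter mem_later /= => /andP[h1 /and3P[h2 h3 h4]] [-> -> ->].
  by split=> //; rewrite mem_edges h2 h3 h4; move: xy; rewrite mem_edges => /and4P[_ ->].
exists (u, v) => //; apply: map_f; rewrite mem_filter /= uw mem_later.
by move: vw; rewrite mem_edges => /and4P[_ -> -> ->].
Qed.

Section Antisymmetric.
Variables (M : zmodType) (F : bitseq -> bitseq -> M).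
Hypothesis Falt : forall u, F u u = 0%R.
Hypothesis Fanti : forall u v, F v u = (- F u v)%R.
Hypothesis Ftri : forall u v w, (u, v, w) \in triangles -> (F u v + F v w = F u w)%R.

(** For an antisymmetric [F] the equation is invariant under permutations of the vertices, and each
    triangle is listed once, with increasing vertices. *)
Lemma triangle_cocycle u v w : u \in triples -> v \in triples -> w \in triples ->
  dis u v -> dis v w -> dis u w -> (F u v + F v w = F u w)%R.
Proof.
pose C u v w := (F u v + F v w = F u w)%R.
have C12 a b c : C a b c -> C b a c by rewrite /C => <-; rewrite (Fanti a b) addKr.
have C23 a b c : C a b c -> C a c b by rewrite /C => <-; rewrite (Fanti b c) addrK.
have C0 a b c : a \in triples -> b \in triples -> c \in triples ->
    dis a b -> dis b c -> dis a c -> blt a b -> blt b c -> C a b c.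
  move=> at_ bt ct ab bc ac lab lbc; apply: Ftri.
  by rewrite mem_triangles !mem_edges at_ bt ct ab bc ac lab lbc.
move=> ut vt wt uv vw uw; rewrite -/(C u v w).
have sz a b : a \in triples -> b \in triples -> size a = size b.
  by move=> /size_triples-> /size_triples->.
have [vu wv wu] : [/\ dis v u, dis w v & dis w u] by rewrite !(dis_sym w) (dis_sym v).
case/orP: (blt_total (sz _ _ ut vt) (dis_neq ut uv)) => luv;
case/orP: (blt_total (sz _ _ vt wt) (dis_neq vt vw)) => lvw;
case/orP: (blt_total (sz _ _ ut wt) (dis_neq ut uw)) => luw.
- exact: C0.
- exact: C0.
- by apply: (C23 _ _ _); exact: C0.
- by apply: (C23 _ _ _); apply: (C12 _ _ _); exact: C0.
- by apply: (C12 _ _ _); exact: C0.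
- by apply: (C12 _ _ _); apply: (C23 _ _ _); exact: C0.
- by apply: (C12 _ _ _); apply: (C23 _ _ _); apply: (C12 _ _ _); exact: C0.
- by apply: (C12 _ _ _); apply: (C23 _ _ _); apply: (C12 _ _ _); exact: C0.
Qed.

Lemma kneser_cocycle (S T U : {set 'I_10}) : [set S; T; U] \in kneser ->
  (F (bits S) (bits T) + F (bits T) (bits U) = F (bits S) (bits U))%R.
Proof.
case/kneser3P => S3 T3 U3 [ST TU SU].
case: (eqVneq S T) => [->|nST]; first by rewrite Falt add0r.
case: (eqVneq T U) => [->|nTU]; first by rewrite Falt addr0.
case: (eqVneq S U) => [->|nSU]; first by rewrite Falt Fanti addNr.
by apply: triangle_cocycle; rewrite ?bits_triples ?S3 ?T3 ?U3 // dis_bits; auto.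
Qed.

End Antisymmetric.

End Kneser.

Lemma size_vadd a b : size a = 42 -> size b = 42 -> size (vadd a b) = 42.
Proof. by move=> sa sb; rewrite size_map size_zip sa sb. Qed.

Lemma size_vsub a b : size a = 42 -> size b = 42 -> size (vsub a b) = 42.
Proof. by move=> sa sb; rewrite size_map size_zip sa sb. Qed.

Lemma nth_vadd a b k : size a = 42 -> size b = 42 -> k < 42 ->
  ((vadd a b)`_k = a`_k + b`_k)%R.
Proof.
move=> sa sb k42; rewrite (nth_map (0, 0)%R) ?size_zip ?sa ?sb //.
by rewrite nth_zip ?sa ?sb.
Qed.

Lemma nth_vsub a b k : size a = 42 -> size b = 42 -> k < 42 ->
  ((vsub a b)`_k = a`_k - b`_k)%R.
Proof.
move=> sa sb k42; rewrite (nth_map (0, 0)%R) ?size_zip ?sa ?sb //.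
by rewrite nth_zip ?sa ?sb.
Qed.

Lemma root_triple : base_bits \in triples. Proof. by vm_compute. Qed.

Lemma size_seeds : size seeds = 42. Proof. by rewrite size_map. Qed.

Lemma seeds_edges k : k < 42 -> nth ([::], [::]) seeds k \in edges.
Proof.
have /allP h : all (mem edges) seeds by vm_compute.
by move=> k42; apply/h/mem_nth; rewrite size_seeds.
Qed.

Lemma parentP s : s \in triples ->
  [/\ parent s \in triples, dis (parent s) s & dis (parent s) base_bits].
Proof.
have /allP h : all (fun s => [&& parent s \in triples, dis (parent s) s & dis (parent s) base_bits])
  triples by vm_compute.
by move/h/and3P.
Qed.

Definition rootset : {set 'I_10} := bset base_bits.
Definition parentset (S : {set 'I_10}) : {set 'I_10} := bset (parent (bits S)).
Definition seed1 (k : 'I_42) : {set 'I_10} := bset (nth ([::], [::]) seeds k).1.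
Definition seed2 (k : 'I_42) : {set 'I_10} := bset (nth ([::], [::]) seeds k).2.

(** * Soundness of the propagation for an arbitrary normalized cocycle *)

Section Propagation.
Variables (M : zmodType) (h : {set 'I_10} -> {set 'I_10} -> M).
Hypothesis hcocycle : forall S T U, [set S; T; U] \in kneser -> (h S T + h T U = h S U)%R.
Hypothesis hroot : forall S : {set 'I_10}, #|S| = 3 -> [disjoint rootset & S] -> h rootset S = 0%R.
Hypothesis hparent : forall S : {set 'I_10}, #|S| = 3 -> S != rootset -> ~~ [disjoint rootset & S] ->
  h (parentset S) S = 0%R.

Definition eval_seeds (x : seq int) : M := (\sum_(k < 42) h (seed1 k) (seed2 k) *~ x`_k)%R.

Lemma eval_vadd a b : size a = 42 -> size b = 42 ->
  eval_seeds (vadd a b) = (eval_seeds a + eval_seeds b)%R.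
Proof.
move=> sa sb; rewrite /eval_seeds -big_split /=; apply: eq_bigr => k _.
by rewrite nth_vadd // mulrzDr.
Qed.

Lemma eval_vsub a b : size a = 42 -> size b = 42 ->
  eval_seeds (vsub a b) = (eval_seeds a - eval_seeds b)%R.
Proof.
move=> sa sb; rewrite /eval_seeds -sumrB /=; apply: eq_bigr => k _.
by rewrite nth_vsub // mulrzBr.
Qed.

Lemma eval_vnull : eval_seeds vnull = 0%R.
Proof.
by rewrite /eval_seeds big1 // => k _; rewrite /vnull nth_nseq ltn_ord mulr0z.
Qed.

Lemma eval_vunit (k : 'I_42) : eval_seeds (vunit k) = h (seed1 k) (seed2 k).
Proof.
rewrite /eval_seeds (bigD1 k) //= nth_mkseq ?ltn_ord // eqxx mulr1z big1 ?addr0 // => i ik.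
by rewrite nth_mkseq ?ltn_ord // -val_eqE in ik *; rewrite (negbTE ik) mulr0z.
Qed.

(** Each entry is read as a formula for [h] on an edge in terms of its values on the seeds.
    Propagation preserves this for every [h], since it uses nothing but the cocycle equation. *)
Definition sound (m : table) := forall u v x, u \in triples -> v \in triples ->
  look m u v = Some x -> size x = 42 /\ h (bset u) (bset v) = eval_seeds x.

Lemma sound_put m u v x : sound m -> u \in triples -> v \in triples -> size x = 42 ->
  h (bset u) (bset v) = eval_seeds x -> sound (put m u v x).
Proof.
move=> sm ut vt sx hx u' v' x' u't v't; rewrite look_put ?size_triples //.
by case: ifP => [/andP[/eqP-> /eqP->] [<-]|_]; [|exact: sm].
Qed.

Lemma h0 (S : {set 'I_10}) : #|S| = 3 -> h S S = 0%R.
Proof.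
move=> S3; have := @hcocycle S S S; rewrite !setUid kneser1 S3 eqxx => /(_ isT).
by move=> e; apply: (addrI (h S S)); rewrite addr0.
Qed.

Lemma hN (S T : {set 'I_10}) : #|S| = 3 -> #|T| = 3 -> [disjoint S & T] -> h T S = (- h S T)%R.
Proof.
move=> S3 T3 ST; have := @hcocycle S T S; rewrite setUC setUA setUid => /(_ (kneser2 S3 T3 ST)).
by rewrite h0 // => e; apply: (addrI (h S T)); rewrite e subrr.
Qed.

Lemma sound_propagate m t : t \in triangles -> sound m -> sound (propagate m t).
Proof.
case: t => [[u v] w]; rewrite mem_triangles !mem_edges.
move=> /and3P[/and4P[ut vt _ uv] /and4P[_ wt _ vw] uw] sm /=.
have e : (h (bset u) (bset v) + h (bset v) (bset w) = h (bset u) (bset w))%R.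
  by apply: hcocycle; apply: kneser3; rewrite ?card_bset // -dis_bset.
case uvE: (look m u v) => [a|]; case vwE: (look m v w) => [b|];
  case uwE: (look m u w) => [c|] //.
- have [sa ha] := sm _ _ _ ut vt uvE; have [sb hb] := sm _ _ _ vt wt vwE.
  by apply: sound_put; rewrite ?size_vadd ?eval_vadd // -ha -hb.
- have [sa ha] := sm _ _ _ ut vt uvE; have [sc hc] := sm _ _ _ ut wt uwE.
  by apply: sound_put; rewrite ?size_vsub ?eval_vsub // -ha -hc -e addrC addKr.
- have [sb hb] := sm _ _ _ vt wt vwE; have [sc hc] := sm _ _ _ ut wt uwE.
  by apply: sound_put; rewrite ?size_vsub ?eval_vsub // -hb -hc -e addrK.
Qed.

Lemma sound_entries : {in entries, forall e, [/\ e.1.1 \in triples, e.1.2 \in triples,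
  size e.2 = 42 & h (bset e.1.1) (bset e.1.2) = eval_seeds e.2]}.
Proof.
move=> e; rewrite /entries 2!mem_cat => /or3P[] /mapP[s].
- rewrite mem_filter => /andP[rs st] -> /=; rewrite root_triple st; split=> //.
  by rewrite eval_vnull hroot ?card_bset // -dis_bset ?root_triple.
- rewrite mem_filter => /andP[/andP[sr rs] st] -> /=.
  have [pt ps _] := parentP st.
  have hp : h (bset (parent s)) (bset s) = 0%R.
    have := hparent (card_bset st); rewrite /parentset bsetK ?size_triples //; apply.
      apply: contra sr => /eqP/(congr1 bits); rewrite /rootset !bsetK ?size_triples ?root_triple //.
      by move=> ->.
    by rewrite /rootset -dis_bset ?root_triple.
  rewrite eval_vnull; case: ifP => _ /=; split=> //.
  by rewrite hN ?hp ?oppr0 ?card_bset // -dis_bset.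
- rewrite mem_iota => k42 ->; have := seeds_edges k42.
  have sx : size (vunit s) = 42 by exact: size_mkseq.
  have : eval_seeds (vunit s) = h (seed1 (Ordinal k42)) (seed2 (Ordinal k42)).
    exact: eval_vunit (Ordinal k42).
  rewrite /seed1 /seed2; move: (vunit s) sx => x sx.
  rewrite [nat_of_ord _]/=; case: (nth _ _ _) => [u v].
  by rewrite mem_edges => ex /and4P[ut vt _ _].
Qed.

Lemma sound_foldl s m : {subset s <= triangles} -> sound m -> sound (foldl propagate m s).
Proof.
elim: s m => // t s IHs m ts sm; apply: IHs => [t' t's|].
  by apply: ts; rewrite inE t's orbT.
by apply: sound_propagate => //; apply: ts; exact: mem_head.
Qed.

Lemma sound_puts (s : seq (bitseq * bitseq * seq int)) m : {subset s <= entries} -> sound m ->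
  sound (foldl (fun m e => put m e.1.1 e.1.2 e.2) m s).
Proof.
elim: s m => // e s IHs m es sm; apply: IHs => [e' e's|].
  by apply: es; rewrite inE e's orbT.
have [|h1 h2 h3 h4] := sound_entries (x := e); first by apply: es; exact: mem_head.
exact: sound_put.
Qed.

Lemma sound_final : sound final.
Proof.
have s0 : sound table0.
  by apply: sound_puts => // u v x _ _; rewrite /look PositiveMap.gempty.
(* The number of sweeps is generalized: soundness holds after any number of them, without evaluating
   the table. *)
rewrite /final; elim: (X in iter X) => [|n IHn]; first exact: s0.
by rewrite iterS; apply: sound_foldl.
Qed.

End Propagation.

Lemma check_finalE : [/\ {in edges, forall e, look final e.1 e.2 != None},
   {in triangles, forall t, exists a b c, [/\ look final t.1.1 t.1.2 = Some a,
      look final t.1.2 t.2 = Some b, look final t.1.1 t.2 = Some c & vadd a b = c]} &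
   {in entries, forall e, look final e.1.1 e.1.2 = Some e.2}].
Proof.
(* Generalizing [final] keeps the table from being unfolded. *)
have := check_final; move: final => m /and3P[/allP h1 /allP h2 /allP h3]; split=> //.
  move=> [[u v] w] /h2 /=; case: look => // a; case: look => // b; case: look => // c /eqP abc.
  by exists a, b, c.
by move=> e /h3/eqP.
Qed.

Definition value (u v : bitseq) : seq int := odflt vnull (look final u v).

Definition coeff (k : nat) (u v : bitseq) : int :=
  if blt u v then ((value u v)`_k)%R
  else if blt v u then (- (value v u)`_k)%R else 0%R.

(* The cocycle of the edge classes in the first homology, in the basis of the seeds. *)
Definition ucocycle (S T : {set 'I_10}) : 'rV[int]_42 :=
  (\row_(k < 42) coeff k (bits S) (bits T))%R.

(** Soundness is applied to the zero cocycle, for the sake of the length that it records. *)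
Lemma size_value u v : (u, v) \in edges -> size (value u v) = 42.
Proof.
move=> uv; have [he _ _] := check_finalE; have := he _ uv; rewrite /value /=.
case E: look => [x|] // _; move: uv; rewrite mem_edges => /and4P[ut vt _ _].
by have [] := @sound_final int (fun _ _ => 0%R) (fun _ _ _ _ => addr0 _)
  (fun _ _ _ => erefl) (fun _ _ _ _ => erefl) _ _ _ ut vt E.
Qed.

Lemma coeff_alt k u : coeff k u u = 0%R.
Proof. by rewrite /coeff blt_irr. Qed.

Lemma coeff_anti k u v : coeff k v u = (- coeff k u v)%R.
Proof.
rewrite /coeff; case: ifP => [vu|vu].
  by rewrite (negbTE (blt_asym vu)) opprK.
by case: ifP; rewrite ?oppr0.
Qed.

Lemma coeff_triangle k u v w : k < 42 -> (u, v, w) \in triangles ->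
  (coeff k u v + coeff k v w = coeff k u w)%R.
Proof.
move=> k42 t; have [_ /(_ _ t)[a [b [c [/= ea eb ec abc]]]] _] := check_finalE.
move: t; rewrite mem_triangles => /and3P[uv vw uw].
have sa : size a = 42 by rewrite -(size_value uv) /value ea.
have sb : size b = 42 by rewrite -(size_value vw) /value eb.
move: uv vw; rewrite !mem_edges => /and4P[_ _ luv _] /and4P[_ _ lvw _].
rewrite /coeff luv lvw (blt_trans luv lvw) /value ea eb ec /=.
by rewrite -nth_vadd // abc.
Qed.

Lemma ucocycle_cocycle S T U : [set S; T; U] \in kneser ->
  (ucocycle S T + ucocycle T U = ucocycle S U)%R.
Proof.
move=> STU; apply/rowP => k; rewrite !mxE.
apply: kneser_cocycle STU => [u|u v|u v w].
- exact: coeff_alt.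
- exact: coeff_anti.
- exact: coeff_triangle.
Qed.

Lemma entries_edges : {subset [seq e.1 | e <- entries] <= edges}.
Proof.
have /allP : all (mem edges) [seq e.1 | e <- entries] by vm_compute.
by [].
Qed.

Lemma entry_coeff e k : e \in entries -> coeff k e.1.1 e.1.2 = (e.2`_k)%R.
Proof.
move=> ee; have [_ _ /(_ _ ee) he] := check_finalE.
have := entries_edges (map_f fst ee); case: e ee he => [[u v] x] _ /= he.
by rewrite mem_edges => /and4P[_ _ luv _]; rewrite /coeff luv /value he.
Qed.

Lemma ucocycle_root (S : {set 'I_10}) : #|S| = 3 -> [disjoint rootset & S] -> ucocycle rootset S = 0%R.
Proof.
move=> S3 rS; have St : bits S \in triples by rewrite bits_triples S3.
apply/rowP => k; rewrite !mxE /rootset bsetK ?size_triples ?root_triple //.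
rewrite (@entry_coeff (base_bits, bits S, vnull)) ?nth_nseq ?if_same //.
rewrite /entries mem_cat; apply/orP; left; apply: (map_f (fun s => (base_bits, s, vnull))).
by rewrite mem_filter St andbT dis_bset ?root_triple // bitsK.
Qed.

Lemma ucocycle_parent (S : {set 'I_10}) : #|S| = 3 -> S != rootset -> ~~ [disjoint rootset & S] ->
  ucocycle (parentset S) S = 0%R.
Proof.
move=> S3 Sr rS; have St : bits S \in triples by rewrite bits_triples S3.
have [pt _ _] := parentP St.
apply/rowP => k; rewrite !mxE /parentset bsetK ?size_triples //.
pose f s := ((if blt (parent s) s then (parent s, s) else (s, parent s)), vnull).
have fe : f (bits S) \in entries.
  rewrite /entries 2!mem_cat; apply/orP; right; apply/orP; left; apply: map_f.
  rewrite mem_filter St andbT; apply/andP; split.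
    by apply: contra Sr => /eqP e; rewrite /rootset -e bitsK.
  by rewrite dis_bset ?root_triple // bitsK.
have := entry_coeff k fe; rewrite /f nth_nseq if_same.
case: ifP => _ //= e; rewrite coeff_anti e oppr0.
by [].
Qed.

Lemma ucocycle_seed k : ucocycle (seed1 k) (seed2 k) = delta_mx 0%R k.
Proof.
have := seeds_edges (ltn_ord k); rewrite /seed1 /seed2.
case E: (nth _ _ _) => [u v]; rewrite mem_edges => /and4P[ut vt _ _] /=.
apply/rowP => i; rewrite !mxE !bsetK ?size_triples //.
rewrite (@entry_coeff (u, v, vunit k)) ?nth_mkseq ?ltn_ord ?eqxx //=.
rewrite /entries 2!mem_cat; apply/orP; right; apply/orP; right; rewrite -E.
by apply: (map_f (fun k => (nth ([::], [::]) seeds k, vunit k))); rewrite mem_iota ltn_ord.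
Qed.

(** The table is sound for [h], and its entries are the coordinates of [ucocycle], which is
    therefore universal among the normalized cocycles with abelian values. *)
Lemma cocycle_expand (M : zmodType) (h : {set 'I_10} -> {set 'I_10} -> M) :
  (forall S T U, [set S; T; U] \in kneser -> h S T + h T U = h S U)%R ->
  (forall S : {set 'I_10}, #|S| = 3 -> [disjoint rootset & S] -> h rootset S = 0%R) ->
  (forall S : {set 'I_10}, #|S| = 3 -> S != rootset -> ~~ [disjoint rootset & S] ->
    h (parentset S) S = 0%R) ->
  forall S T, [set S; T] \in kneser ->
  (h S T = \sum_(k < 42) h (seed1 k) (seed2 k) *~ ucocycle S T 0 k)%R.
Proof.
move=> hc hr hp S T; case/mem_kneser=> _ c3 dST.
have S3 : #|S| = 3 by apply: c3; rewrite !inE eqxx.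
have T3 : #|T| = 3 by apply: c3; rewrite !inE eqxx orbT.
case: (eqVneq S T) => [<-|nST].
  rewrite (h0 hc) // big1 // => k _; by rewrite mxE coeff_alt mulr0z.
have {}dST : [disjoint S & T] by apply: dST; rewrite ?inE ?eqxx ?orbT.
have St : bits S \in triples by rewrite bits_triples S3.
have Tt : bits T \in triples by rewrite bits_triples T3.
have main u v : (u, v) \in edges ->
    (h (bset u) (bset v) = \sum_(k < 42) h (seed1 k) (seed2 k) *~ coeff k u v)%R.
  move=> uv; have [he _ _] := check_finalE; have := he _ uv => /=.
  case E: look => [x|] // _; move: uv; rewrite mem_edges => /and4P[ut vt luv _].
  have [_ ->] := sound_final hc hr hp ut vt E.
  by apply: eq_bigr => k _; rewrite /coeff luv /value E.
have st : size (bits S) = size (bits T) by rewrite !size_bits.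
have nst : bits S != bits T by apply: contra nST => /eqP/(can_inj bitsK)->.
case/orP: (blt_total st nst) => l.
  rewrite -[in LHS](bitsK S) -[in LHS](bitsK T) main ?mem_edges ?St ?Tt ?l ?dis_bits //.
  by apply: eq_bigr => k _; rewrite mxE.
rewrite (hN hc T3 S3) 1?disjoint_sym // -[in LHS](bitsK S) -[in LHS](bitsK T).
rewrite main ?mem_edges ?St ?Tt ?l ?dis_bits 1?disjoint_sym // -sumrN.
by apply: eq_bigr => k _; rewrite mxE (coeff_anti k (bits T)) mulrNz.
Qed.

(* The triples {1,2,x}, {3,8,y}, {5,6,z} with distinct x, y, z in {0,4,7,9} span a torus. *)
Definition tvert (p q x : nat) : bitseq := mkseq (fun i => i \in [:: p; q; x]) 10.
Definition tsingle (i : nat) : nat := nth 0 [:: 0; 4; 7; 9] i.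

Definition distinct3 : seq (nat * nat * nat) :=
  [seq t <- [seq (xy, z) | xy <- [seq (x, y) | x <- iota 0 4, y <- iota 0 4], z <- iota 0 4] |
    uniq [:: t.1.1; t.1.2; t.2]].

(* The cup product of the coordinates 3 and 2, which is nonzero on a single triangle of the torus. *)
Definition cup (t : nat * nat * nat) : int :=
  let: (x, y, z) := t in
  (coeff 3 (tvert 1 2 (tsingle x)) (tvert 3 8 (tsingle y)) *
   coeff 2 (tvert 3 8 (tsingle y)) (tvert 5 6 (tsingle z)))%R.

Lemma cup_values : all (fun t => cup t == (t == (1, 3, 0))%:R%R) distinct3.
Proof. vm_compute. reflexivity. Qed.

Lemma torus_simplices : all (fun t => let: (x, y, z) := t in
  let u := tvert 1 2 (tsingle x) in let v := tvert 3 8 (tsingle y) in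
  let w := tvert 5 6 (tsingle z) in
  [&& u \in triples, v \in triples, w \in triples, dis u v, dis v w & dis u w]) distinct3.
Proof. vm_compute. reflexivity. Qed.

(* The 24 triangles form the chessboard complex of a 3 x 4 board, which is an orientable surface: a
   2-cocycle with value 1 on one triangle and 0 on the others is not a coboundary. *)
Lemma torus_parity (p q r : nat -> nat -> int) :
  (forall x y z, (x, y, z) \in distinct3 ->
    p x y + q y z + ((x, y, z) == (1, 3, 0))%:R = r x z)%R -> False.
Proof.
move=> E.
have := (E 0 1 2 isT, E 0 1 3 isT, E 0 2 1 isT, E 0 2 3 isT, E 0 3 1 isT, E 0 3 2 isT).
have := (E 1 0 2 isT, E 1 0 3 isT, E 1 2 0 isT, E 1 2 3 isT, E 1 3 0 isT, E 1 3 2 isT).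
have := (E 2 0 1 isT, E 2 0 3 isT, E 2 1 0 isT, E 2 1 3 isT, E 2 3 0 isT, E 2 3 1 isT).
have := (E 3 0 1 isT, E 3 0 2 isT, E 3 1 0 isT, E 3 1 2 isT, E 3 2 0 isT, E 3 2 1 isT).
move=> {E} /= [[[[[]]]]] ? ? ? ? ? ? [[[[[]]]]] ? ? ? ? ? ? [[[[[]]]]] ? ? ? ? ? ? [[[[[]]]]].
(* Weight each equation by the sign of the permutation of the four columns that extends (x, y, z).
   Every edge lies in two triangles of opposite signs, so [p], [q] and [r] cancel and the single
   nonzero value remains. *)
lia.
Qed.

(** Such a [k] would make the cup product a coboundary; on the torus, its values on the three kinds
    of edges are the [p], [q], [r] of [torus_parity]. *)
Lemma cup_product_nonzero (i j : 'I_42) (k : {set 'I_10} -> {set 'I_10} -> int) :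
  i = 3 :> nat -> j = 2 :> nat ->
  (forall S T U, [set S; T; U] \in kneser ->
    k S T + k T U + ucocycle S T 0 i * ucocycle T U 0 j = k S U)%R -> False.
Proof.
move=> i3 j2 kE.
pose A x := bset (tvert 1 2 (tsingle x)); pose B x := bset (tvert 3 8 (tsingle x)).
pose C x := bset (tvert 5 6 (tsingle x)).
apply: (@torus_parity (fun x y => k (A x) (B y)) (fun x y => k (B x) (C y))
  (fun x y => k (A x) (C y))) => x y z xyz.
have /allP/(_ _ xyz)/eqP <- := cup_values.
have /allP/(_ _ xyz)/= := torus_simplices => /and3P[ut vt /and4P[wt uv vw uw]].
rewrite -(kE (A x) (B y) (C z)); last by apply: kneser3; rewrite ?card_bset // -dis_bset.
by rewrite !mxE !bsetK ?size_triples // i3 j2.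
Qed.

(** * Elementary abelian 3-subgroups of degree 10 *)

Section Rotations.
Local Open Scope group_scope.
Variables (T : finType) (S : {set T}).
Hypothesis S3 : #|S| = 3.
Implicit Types (x y : {perm T}) (i j : T).

Lemma mem_card3 a b c d : a \in S -> b \in S -> c \in S -> d \in S ->
  a != b -> a != c -> b != c -> [|| d == a, d == b | d == c].
Proof.
move=> aS bS cS dS ab ac bc.
have sub : [set a; b; c] \subset S by rewrite !subUset !sub1set aS bS.
have : [set a; b; c] = S.
  apply/eqP; rewrite eqEcard sub S3 -setUA !cardsU1 cards1 !inE.
  by rewrite (negbTE ab) (negbTE ac) (negbTE bc).
by move/setP/(_ d); rewrite dS !inE -orbA => ->.
Qed.

Lemma perm_expg3 x i : (x ^+ 3) i = x (x (x i)).
Proof. by rewrite !expgS expg0 mulg1 !permM. Qed.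

Lemma perm3E x i : x ^+ 3 = 1 -> x (x (x i)) = i.
Proof. by move=> x3; rewrite -perm_expg3 x3 perm1. Qed.

Lemma rotation_mem x i : x @: S = S -> i \in S -> x i \in S.
Proof. by move=> xS iS; rewrite -xS imset_f. Qed.

Lemma rotation_neq x i : x ^+ 3 = 1 -> x i != i -> x (x i) != i.
Proof.
move=> x3 xi; apply/eqP => e; have := perm3E i x3; rewrite e => xii.
by rewrite xii eqxx in xi.
Qed.

(** If [x] fixed one point of [S] and moved another, it would swap the two points other than the
    fixed one, against [x ^+ 3 = 1]. *)
Lemma rotation_fix x i j : x ^+ 3 = 1 -> x @: S = S -> i \in S -> j \in S ->
  x i = i -> x j = j.
Proof.
move=> x3 xS iS jS xi; apply/eqP; apply: contraT => xj.
have ij : i != j by apply: contraNneq xj => <-; rewrite xi.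
have ixj : i != x j by rewrite -{1}xi (inj_eq perm_inj).
have xjS := rotation_mem xS jS; have xxjS := rotation_mem xS xjS.
have jxj : j != x j by rewrite eq_sym.
have /or3P[] := mem_card3 iS jS xjS xxjS ij ixj jxj.
- by rewrite -{1}xi (inj_eq perm_inj) eq_sym (negbTE ixj).
- by rewrite (negbTE (rotation_neq x3 xj)).
- by rewrite (inj_eq perm_inj) (negbTE xj).
Qed.

(** Both permutations act on [S] through its group of rotations, which is cyclic of order 3. *)
Lemma rotation_commute x y i : x ^+ 3 = 1 -> x @: S = S -> y ^+ 3 = 1 -> y @: S = S ->
  i \in S -> x (y i) = y (x i).
Proof.
move=> x3 xS y3 yS iS; have xiS := rotation_mem xS iS; have yiS := rotation_mem yS iS.
have [xi|xi] := eqVneq (x i) i; first by rewrite xi (rotation_fix x3 xS iS yiS xi).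
have [yi|yi] := eqVneq (y i) i; first by rewrite yi (rotation_fix y3 yS iS xiS yi).
have xxiS := rotation_mem xS xiS.
have ixi : i != x i by rewrite eq_sym.
have ixxi : i != x (x i) by rewrite eq_sym rotation_neq.
have xixxi : x i != x (x i) by rewrite (inj_eq perm_inj).
have yyiS := rotation_mem yS yiS.
(* On [S], [y] is [x] or its inverse, according to the image of [i]. *)
have /or3P[e|/eqP yx|/eqP yxx] := mem_card3 iS xiS xxiS yiS ixi ixxi xixxi.
- by rewrite e in yi.
- rewrite yx; have := mem_card3 iS xiS xxiS yyiS ixi ixxi xixxi.
  rewrite (negbTE (rotation_neq y3 yi)) /= yx => /orP[/eqP e|/eqP-> //].
  by move: xi; rewrite -(inj_eq (@perm_inj _ y)) e yx eqxx.
rewrite yxx perm3E //; have := mem_card3 iS xiS xxiS yyiS ixi ixxi xixxi.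
rewrite (negbTE (rotation_neq y3 yi)) /= => /orP[/eqP yy|/eqP e].
  by rewrite -yy perm3E.
by move: yi; rewrite -(inj_eq (@perm_inj _ y)) e yxx eqxx.
Qed.

End Rotations.

Section Tori.
Local Open Scope group_scope.
Implicit Types (x y : {perm 'I_10}) (S : {set 'I_10}) (s : {set {set 'I_10}}).

(** For a simplex [s], the product of the rotation groups of its members. Conditions in place of
    generators avoid choosing a cyclic order on each triple. *)
Definition torus s : {set {perm 'I_10}} :=
  [set x : {perm 'I_10} | [&& x ^+ 3 == 1, perm_on (cover s) x & [forall S in s, x @: S == S]]].

Lemma torusP s x : reflect [/\ x ^+ 3 = 1, perm_on (cover s) x & forall S, S \in s -> x @: S = S]
  (x \in torus s).
Proof.
rewrite inE; apply: (iffP and3P) => -[/eqP x3 xs].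
  by move/forall_inP => h; split=> // S /h/eqP.
by move=> h; split=> //; apply/forall_inP => S /h/eqP.
Qed.

Lemma torus_commute s x y : s \in kneser -> x \in torus s -> y \in torus s -> commute x y.
Proof.
move=> ks /torusP[x3 xs xS] /torusP[y3 ys yS]; apply/permP => i; rewrite !permM.
have [/bigcupP[S Ss iS]|ni] := boolP (i \in cover s).
  have S3 : #|S| = 3 by case/mem_kneser: ks => _ c _; exact: c.
  by rewrite (rotation_commute S3 _ _ _ _ iS) ?xS ?yS.
by rewrite (out_perm xs ni) (out_perm ys ni) (out_perm xs ni).
Qed.

Lemma torus_group_set s : s \in kneser -> group_set (torus s).
Proof.
move=> ks; apply/group_setP; split=> [|x y xs ys].
  by apply/torusP; split=> [||S _]; rewrite ?expg1n ?perm_on1 // imset_perm1.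
have cxy := torus_commute ks xs ys.
move/torusP: xs => [x3 xs xS]; move/torusP: ys => [y3 ys yS]; apply/torusP; split.
- by rewrite expgMn // x3 y3 mulg1.
- exact: perm_onM.
- move=> S Ss; rewrite -[RHS](yS S Ss) -{2}(xS S Ss) -imset_comp.
  by apply: eq_imset => i; rewrite /= permM.
Qed.

(** [torus s] need not be a group for an arbitrary family; [<<torus s>>] always is, and coincides
    with it on simplices. *)
Lemma torus_abelem s : s \in kneser -> 3.-abelem <<torus s>>.
Proof.
move=> ks; rewrite (gen_set_id (torus_group_set ks)).
have -> : torus s = group (torus_group_set ks) by [].
apply/abelemP => //; split=> [|x /torusP[]] //.
by apply/centsP => x xs y ys; exact: torus_commute xs ys.
Qed.

Lemma odd_perm3 x : x ^+ 3 = 1 -> ~~ x.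
Proof.
move=> x3; have : odd_perm (x ^+ 3) = false by rewrite x3 odd_perm1.
by rewrite !expgS expg0 mulg1 !odd_permM addbA addbb /= => ->.
Qed.

(** A three-cycle on [S]; it makes the torus of a simplex nontrivial, hence a point of the poset. *)
Lemma torus_rotation s S : s \in kneser -> S \in s ->
  exists2 x, x \in torus s & x != 1.
Proof.
case/mem_kneser => _ c dS Ss; have S3 := c S Ss.
have [a aS] : exists a, a \in S by apply/set0Pn; rewrite -card_gt0 S3.
have : #|S :\ a| == 2 by move: S3; rewrite (cardsD1 a) aS add1n => -[->].
case/cards2P => b [c' [bc Sbc]].
have bS : b \in S by have : b \in S :\ a by [rewrite Sbc !inE eqxx]; rewrite inE => /andP[].
have cS : c' \in S.
  by have : c' \in S :\ a by [rewrite Sbc !inE eqxx orbT]; rewrite inE => /andP[].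
have ba : b != a by have : b \in S :\ a by [rewrite Sbc !inE eqxx]; rewrite !inE => /andP[].
have ca : c' != a.
  by have : c' \in S :\ a by [rewrite Sbc !inE eqxx orbT]; rewrite !inE => /andP[].
pose x := tperm a b * tperm a c'.
have [ab ac cb] : [/\ a != b, a != c' & c' != b].
  by split; rewrite eq_sym.
have xa : x a = b by rewrite permM tpermL tpermD.
have xb : x b = c' by rewrite permM tpermR tpermL.
have xc : x c' = a by rewrite permM (tpermD ac bc) tpermR.
have xo i : i != a -> i != b -> i != c' -> x i = i.
  by rewrite !(eq_sym i) => ai bi ci; rewrite permM (tpermD ai bi) (tpermD ai ci).
have xS i : i \notin S -> x i = i.
  by move=> niS; apply: xo; apply: contraNneq niS => ->.
exists x; last by apply/eqP => x1; move: xa; rewrite x1 perm1 => e; rewrite e eqxx in ba.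
apply/torusP; split.
- apply/permP => i; rewrite perm_expg3 perm1.
  have [->|ia] := eqVneq i a; first by rewrite xa xb xc.
  have [->|ib] := eqVneq i b; first by rewrite xb xc xa.
  have [->|ic] := eqVneq i c'; first by rewrite xc xa xb.
  by rewrite !(xo i).
- apply/subsetP => i; rewrite inE; apply: contraR => ni; apply/eqP/xS.
  by apply: contra ni => iS; apply/bigcupP; exists S.
move=> U Us; have [->|SU] := eqVneq U S.
  apply/eqP; rewrite eqEcard card_imset ?leqnn ?andbT; last exact: perm_inj.
  apply/subsetP => _ /imsetP[i iS ->].
  have /or3P[] := mem_card3 S3 aS bS cS iS ab ac bc.
  + by move/eqP->; rewrite xa.
  + by move/eqP->; rewrite xb.
  + by move/eqP->; rewrite xc.
rewrite -[RHS]imset_id; apply: eq_in_imset => i iU /=; apply: xS.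
by have /disjointFr := dS _ _ Us Ss SU => /(_ i iU) ->.
Qed.

(** The members of [t] outside [s] are disjoint from those of [s], so [torus s] fixes them
    pointwise. *)
Lemma torus_sub s t : t \in kneser -> s \subset t -> torus s \subset torus t.
Proof.
case/mem_kneser => _ c dS /subsetP st; apply/subsetP => x /torusP[x3 xs xS]; apply/torusP; split=> //.
  by apply: subset_trans xs _; apply/bigcupsP => S /st; exact: bigcup_sup.
move=> S St; have [Ss|nSs] := boolP (S \in s); first exact: xS.
rewrite -[RHS]imset_id; apply: eq_in_imset => i iS /=; apply: (out_perm xs).
apply/bigcupP => -[U Us iU]; have SU : S != U by apply: contraNneq nSs => ->.
by have /disjointFr := dS _ _ St (st _ Us) SU => /(_ i iS); rewrite iU.
Qed.

End Tori.

(** * Orbits of elementary abelian 3-subgroups *)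

Section Orbits.
Local Open Scope group_scope.
Implicit Types (E F : {group {perm 'I_10}}) (i j : 'I_10).

Definition regular E : bool := [exists i, #|orbit 'P E i| == 9].

Definition triple_orbits E : {set {set 'I_10}} :=
  [set orbit 'P E i | i : 'I_10 & #|orbit 'P E i| == 3].

Lemma mem_orbitP E i j : reflect (exists2 x, x \in E & x i = j) (j \in orbit 'P E i).
Proof. by apply: (iffP orbitP) => -[x xE <-]; exists x. Qed.

Lemma orbit_self E i : i \in orbit 'P E i.
Proof. exact: orbit_refl. Qed.

(** Orbit lengths are powers of 3, and 27 exceeds the degree. *)
Lemma card_orbit3 E i : 3.-abelem E ->
  [|| #|orbit 'P E i| == 1%N, #|orbit 'P E i| == 3 | #|orbit 'P E i| == 9].
Proof.
move=> Eab; have oE := dvdn_orbit 'P E i.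
have /p_natP[k ok] : 3.-nat #|orbit 'P E i| by apply: pnat_dvd oE (abelem_pgroup Eab).
have : #|orbit 'P E i| <= 10 by rewrite -[X in _ <= X]card_ord max_card.
rewrite ok; case: k {ok} => [|[|[|k]]] // h; exfalso.
by have := leq_trans (leq_pexp2l (isT : 0 < 3) (isT : 3 <= k.+3)) h.
Qed.

Lemma orbit_subG E F i : E \subset F -> orbit 'P E i \subset orbit 'P F i.
Proof. by move=> /subsetP EF; apply/subsetP => j /mem_orbitP[x /EF xF <-]; apply/mem_orbitP; exists x. Qed.

Lemma orbit_imset E i x : x \in E -> x @: orbit 'P E i = orbit 'P E i.
Proof.
move=> xE; apply/eqP; rewrite eqEcard card_imset ?leqnn ?andbT; last exact: perm_inj.
apply/subsetP => _ /imsetP[j /mem_orbitP[y yE <-] ->].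
by apply/mem_orbitP; exists (y * x); rewrite ?groupM // permM.
Qed.

Lemma triple_orbitsP E S : reflect (exists2 i, #|orbit 'P E i| = 3 & S = orbit 'P E i)
  (S \in triple_orbits E).
Proof.
apply: (iffP imsetP) => -[i]; first by rewrite inE => /eqP; exists i.
by exists i; rewrite ?inE //; apply/eqP.
Qed.

End Orbits.

Section RegularSubgroups.
Local Open Scope group_scope.
Implicit Types (E F : {group {perm 'I_10}}) (i j : 'I_10) (s : {set {set 'I_10}}).

(** In an abelian group an element fixing one point of an orbit fixes the whole orbit; the single
    point outside is then fixed too. *)
Lemma orbit9_free E i x j : 3.-abelem E -> #|orbit 'P E i| = 9 ->
  x \in E -> j \in orbit 'P E i -> x j = j -> x = 1.
Proof.
case/(abelemP (isT : prime 3)) => cE _ O9 xE jO xj; apply/permP => k; rewrite perm1.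
have jE : orbit 'P E j = orbit 'P E i by exact/orbit_eqP.
have [kO|kO] := boolP (k \in orbit 'P E i).
  move: kO; rewrite -jE => /mem_orbitP[y yE <-].
  by rewrite -permM (centsP cE y yE x xE) permM xj.
have C1 : #|~: orbit 'P E i| == 1%N by rewrite cardsCs setCK card_ord O9.
have [z zC] := cards1P C1.
have kz : k = z by apply/set1P; rewrite -zC inE.
have xkO : x k \notin orbit 'P E i.
  by apply: contra kO => xk; rewrite -(mem_imset _ _ (@perm_inj _ x)) orbit_imset.
by have /set1P -> : x k \in [set z] by rewrite -zC inE.
Qed.

Lemma orbit9_card E i : 3.-abelem E -> #|orbit 'P E i| = 9 -> #|E| = 9.
Proof.
move=> Eab O9; have := card_orbit_stab 'P%act E i; rewrite O9.
have -> : 'C_E[i | 'P] = 1.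
  apply/trivgP/subsetP => x; rewrite in_setI => /andP[xE /astab1P xi].
  by rewrite (orbit9_free Eab O9 xE (orbit_self E i) xi) group1.
by rewrite cards1 muln1 => <-.
Qed.

Lemma orbit9_eq E i j : #|orbit 'P E i| = 9 -> #|orbit 'P E j| = 9 ->
  orbit 'P E i = orbit 'P E j.
Proof.
move=> i9 j9; apply/eqP; rewrite orbit_eq_mem; apply: contraT => nij.
have dij : [disjoint orbit 'P E i & orbit 'P E j].
  apply/pred0P => k /=; apply/negbTE/andP => -[ki kj]; case/negP: nij.
  by rewrite -(orbit_eqP kj) (orbit_eqP ki) orbit_self.
have : #|orbit 'P E i :|: orbit 'P E j| <= 10 by rewrite -[X in _ <= X]card_ord max_card.
by rewrite cardsU disjoint_setI0 // cards0 i9 j9.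
Qed.

Lemma regular_card E : 3.-abelem E -> regular E -> #|E| = 9.
Proof. by move=> Eab /existsP[i /eqP]; exact: orbit9_card. Qed.

Lemma regular_sup E F : 3.-abelem F -> E \subset F -> regular E -> regular F.
Proof.
move=> Fab EF /existsP[i /eqP i9]; apply/existsP; exists i.
have := subset_leq_card (orbit_subG i EF); rewrite i9.
by case/or3P: (card_orbit3 i Fab) => /eqP ->.
Qed.

(** Regularity passes to [F] and forces both orders to be 9. *)
Lemma regular_maximal E F : 3.-abelem E -> 3.-abelem F -> regular E -> E \subset F -> F = E.
Proof.
move=> Eab Fab rE EF; apply/esym/group_inj/eqP; rewrite eqEcard EF.
by rewrite (regular_card Eab rE) (regular_card Fab) // (regular_sup Fab EF).
Qed.

(** An orbit of three points could only grow to one of nine, which is excluded in [F]. *)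
Lemma triple_orbits_sub E F : 3.-abelem F -> ~~ regular F -> E \subset F ->
  triple_orbits E \subset triple_orbits F.
Proof.
move=> Fab rF EF; apply/subsetP => S /triple_orbitsP[i i3 ->]; apply/triple_orbitsP.
have sub := orbit_subG i EF; have := subset_leq_card sub; rewrite i3.
case/or3P: (card_orbit3 i Fab) => /eqP oF; rewrite ?oF // => _.
  by exists i => //; apply/eqP; rewrite eqEcard sub i3 oF.
by case/negP: rF; apply/existsP; exists i; rewrite oF.
Qed.

Lemma triple_orbits_kneser E : 3.-abelem E -> E :!=: 1 -> ~~ regular E ->
  triple_orbits E \in kneser.
Proof.
move=> Eab E1 rE; apply/mem_kneser; split.
- have [x xE x1] : exists2 x, x \in E & x != 1.
    by case/trivgPn: E1 => x xE x1; exists x.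
  have [i xi] : exists i, x i != i.
    apply/existsP; apply: contraR x1; rewrite negb_exists => /forallP h.
    by apply/eqP/permP => i; rewrite perm1; apply/eqP/negbNE.
  apply/set0Pn; exists (orbit 'P E i); apply/triple_orbitsP; exists i => //.
  case/or3P: (card_orbit3 i Eab) => /eqP // oi.
    have /eqP/cards1P[z zE] := oi.
    have : x i \in orbit 'P E i by apply/mem_orbitP; exists x.
    have := orbit_self E i; rewrite zE !inE => /eqP iz /eqP xz.
    by rewrite xz -iz eqxx in xi.
  by case/negP: rE; apply/existsP; exists i; rewrite oi.
- by move=> S /triple_orbitsP[i i3 ->].
move=> S U /triple_orbitsP[i i3 ->] /triple_orbitsP[j j3 ->] ij.
apply/pred0P => k /=; apply/negbTE/andP => -[ki kj]; case/eqP: ij.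
by rewrite -(orbit_eqP ki) (orbit_eqP kj).
Qed.

(** Together with [triple_orbits_torus]: both composites of the two monotone maps between nonregular
    subgroups and simplices are comparable to the identity. *)
Lemma sub_torus E : 3.-abelem E -> ~~ regular E -> E \subset torus (triple_orbits E).
Proof.
move=> Eab rE; apply/subsetP => x xE; apply/torusP; split.
- by case/(abelemP (isT : prime 3)): Eab => _; apply.
- apply/subsetP => i; rewrite inE => xi; apply/bigcupP; exists (orbit 'P E i); last exact: orbit_self.
  apply/triple_orbitsP; exists i => //.
  case/or3P: (card_orbit3 i Eab) => /eqP // oi.
    have /eqP/cards1P[z zE] := oi.
    have : x i \in orbit 'P E i by apply/mem_orbitP; exists x.
    have := orbit_self E i; rewrite zE !inE => /eqP iz /eqP xz.
    by rewrite xz -iz eqxx in xi.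
  by case/negP: rE; apply/existsP; exists i; rewrite oi.
by move=> S /triple_orbitsP[i _ ->]; exact: orbit_imset.
Qed.

Lemma torus_orbit s i : s \in kneser ->
  (exists2 S, S \in s & (i \in S) && (orbit 'P <<torus s>> i \subset S)) \/
  orbit 'P <<torus s>> i \subset [set i].
Proof.
move=> ks; rewrite (gen_set_id (torus_group_set ks)).
have oP j : j \in orbit 'P (torus s) i -> exists2 x, x \in torus s & x i = j.
  by move=> /imsetP[x xs ->]; exists x.
have [/bigcupP[S Ss iS]|ni] := boolP (i \in cover s).
  left; exists S => //; rewrite iS; apply/subsetP => j /oP[x /torusP[_ _ xS] <-].
  by rewrite -(xS S Ss) imset_f.
by right; apply/subsetP => j /oP[x /torusP[_ xs _] <-]; rewrite (out_perm xs ni) inE.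
Qed.

Lemma torus_not_regular s : s \in kneser -> ~~ regular <<torus s>>%G.
Proof.
move=> ks; apply/existsPn => i; apply/eqP => i9.
case: (torus_orbit i ks) => [[S Ss /andP[_ /subset_leq_card]]|/subset_leq_card].
  by rewrite i9; case/mem_kneser: ks => _ c _; rewrite c.
by rewrite i9 cards1.
Qed.

Lemma triple_orbits_torus s : s \in kneser -> triple_orbits <<torus s>>%G \subset s.
Proof.
move=> ks; apply/subsetP => S /triple_orbitsP[i i3 ->].
case: (torus_orbit i ks) => [[U Us /andP[_ sub]]|/subset_leq_card]; last by rewrite i3 cards1.
have -> // : orbit 'P <<torus s>> i = U; apply/eqP; rewrite eqEcard sub i3.
by case/mem_kneser: ks => _ c _; rewrite c.
Qed.

Lemma torus_neq1 s : s \in kneser -> <<torus s>> != 1.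
Proof.
move=> ks; have [/set0Pn[S Ss] _ _] := mem_kneser _ ks.
have [x xs x1] := torus_rotation ks Ss.
by apply/trivgPn; exists x => //; exact: mem_gen.
Qed.

End RegularSubgroups.

(** * The number of regular subgroups *)

Section Labelings.
Local Open Scope group_scope.
Local Notation D := ('Z_3 * 'Z_3)%type.
Implicit Types (E F : {group {perm 'I_10}}) (i j : 'I_10) (p q x : {perm 'I_10}) (v w : D).

Lemma expg_Z3 x (a b : 'Z_3) : x ^+ 3 = 1 -> x ^+ (a + b)%R = x ^+ a * x ^+ b.
Proof. by move=> x3; rewrite -expgD -(expg_mod (a + b) x3). Qed.

Definition label p q i : {ffun D -> 'I_10} := [ffun v : D => (p ^+ v.1 * q ^+ v.2) i].

(* Regular subgroups are counted through their frames, a moved point with a basis: [label] identifies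
   the frames with the injections of the nine elements of [D] into the ten points. *)
Definition frames : {set {group {perm 'I_10}} * 'I_10 * {perm 'I_10} * {perm 'I_10}} :=
  [set t : {group {perm 'I_10}} * 'I_10 * {perm 'I_10} * {perm 'I_10} |
    [&& (3.-abelem t.1.1.1 && regular t.1.1.1), #|orbit 'P t.1.1.1 t.1.1.2| == 9%N,
     t.1.2 \in t.1.1.1^# & t.2 \in t.1.1.1 :\: <[t.1.2]>]].

Lemma orbit9_out E i x j : #|orbit 'P E i| = 9 -> x \in E -> j \notin orbit 'P E i -> x j = j.
Proof.
move=> O9 xE kO.
have C1 : #|~: orbit 'P E i| == 1%N by rewrite cardsCs setCK card_ord O9.
have [z zC] := cards1P C1.
have -> : j = z by apply/set1P; rewrite -zC inE.
have kz : j = z by apply/set1P; rewrite -zC inE.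
rewrite -kz; have : x j \in [set z].
  rewrite -zC inE; apply: contra kO => xk.
  by rewrite -(mem_imset _ _ (@perm_inj _ x)) orbit_imset.
by move/set1P->.
Qed.

Section Frame.
Variables (E : {group {perm 'I_10}}) (i : 'I_10) (p q : {perm 'I_10}).
Hypotheses (Eab : 3.-abelem E) (i9 : #|orbit 'P E i| = 9).
Hypotheses (pE : p \in E) (p1 : p != 1) (qE : q \in E) (qp : q \notin <[p]>).

Let E3 x : x \in E -> x ^+ 3 = 1.
Proof. by case/(abelemP (isT : prime 3)): Eab => _; apply. Qed.

Let EC x y : x \in E -> y \in E -> x * y = y * x.
Proof. by case/(abelemP (isT : prime 3)): Eab => /centsP h _ xE yE; exact: h. Qed.

Lemma frame_order : #[p] = 3 /\ #[q] = 3.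
Proof.
split; apply: (nt_prime_order (isT : prime 3)) => //; do ?exact: E3.
by apply: contraNneq qp => ->; exact: group1.
Qed.

Lemma frame_word_inj v w : p ^+ v.1 * q ^+ v.2 = p ^+ w.1 * q ^+ w.2 -> v = w.
Proof.
have [op oq] := frame_order; case: v w => [a b] [c d] /= e.
have TI : <[q]> :&: <[p]> = 1.
  by apply: prime_TIg; rewrite -?orderE ?oq // cycle_subG.
have mem : q ^+ b * (q ^+ d)^-1 = 1.
  apply/set1P; rewrite -set1gE -TI inE groupM ?groupV ?mem_cycle //=.
  have -> : q ^+ b * (q ^+ d)^-1 = (p ^+ a)^-1 * p ^+ c.
    by apply: (mulgI (p ^+ a)); rewrite mulgA e mulgK mulKVg.
  by rewrite groupM ?groupV ?mem_cycle.
have bd : q ^+ b = q ^+ d by apply/eqP; rewrite eq_mulgV1 mem.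
have ac : p ^+ a = p ^+ c by apply: (mulIg (q ^+ b)); rewrite e bd.
have inj (x : {perm 'I_10}) (k l : 'Z_3) : #[x] = 3 -> x ^+ k = x ^+ l -> k = l.
  move=> ox /eqP; rewrite eq_expg_mod_order ox => /eqP kl; apply/val_inj.
  by move: kl; rewrite !modn_small ?(ltn_ord k) ?(ltn_ord l).
by rewrite (inj p a c op ac) (inj q b d oq bd).
Qed.

Lemma frame_wordE v : p ^+ v.1 * q ^+ v.2 \in E.
Proof. by rewrite groupM ?groupX. Qed.

Lemma label_injective : injective (label p q i).
Proof.
move=> v w; rewrite !ffunE => e; apply: frame_word_inj; apply/eqP; rewrite eq_mulgV1; apply/eqP.
apply: (orbit9_free Eab i9 _ (orbit_self E i)); first by rewrite groupM ?groupV ?frame_wordE.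
by rewrite permM e permK.
Qed.

Lemma card_D : #|{: D}| = 9.
Proof. by rewrite card_prod card_ord. Qed.

Lemma label_orbit : [set label p q i v | v : D] = orbit 'P E i.
Proof.
apply/eqP; rewrite eqEcard i9 card_imset ?card_D ?leqnn ?andbT; last exact: label_injective.
apply/subsetP => _ /imsetP[v _ ->]; rewrite ffunE; apply/mem_orbitP.
by exists (p ^+ v.1 * q ^+ v.2); rewrite ?frame_wordE.
Qed.

Lemma frame_generate : [set p ^+ v.1 * q ^+ v.2 | v : D] = E.
Proof.
apply/eqP; rewrite eqEcard (orbit9_card Eab i9) card_imset ?card_D ?leqnn ?andbT; last first.
  by move=> v w; exact: frame_word_inj.
by apply/subsetP => _ /imsetP[v _ ->]; exact: frame_wordE.
Qed.

Lemma label_p v : p (label p q i v) = label p q i (v + (1, 0))%R.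
Proof.
have e1 : (v + (1, 0))%R.1 = (v.1 + 1)%R by [].
have e2 : (v + (1, 0))%R.2 = v.2 by exact: addr0.
rewrite !ffunE e1 e2 (expg_Z3 _ _ (E3 pE)) expg1 -!permM.
by rewrite -[p ^+ v.1 * q ^+ v.2 * p]mulgA (EC (groupX _ qE) pE) mulgA.
Qed.

Lemma label_q v : q (label p q i v) = label p q i (v + (0, 1))%R.
Proof.
have e1 : (v + (0, 1))%R.1 = v.1 by exact: addr0.
have e2 : (v + (0, 1))%R.2 = (v.2 + 1)%R by [].
by rewrite !ffunE e1 e2 (expg_Z3 _ _ (E3 qE)) expg1 -!permM mulgA.
Qed.

Lemma label_0 : label p q i 0%R = i.
Proof. by rewrite ffunE /= !expg0 mulg1 perm1. Qed.

End Frame.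

Definition frame_label (t : {group {perm 'I_10}} * 'I_10 * {perm 'I_10} * {perm 'I_10}) :=
  label t.1.2 t.2 t.1.1.2.

Lemma framesP E i p q : reflect
  [/\ 3.-abelem E /\ #|orbit 'P E i| = 9, p \in E, p != 1, q \in E & q \notin <[p]>]
  ((E, i, p, q) \in frames).
Proof.
rewrite !inE /=; apply: (iffP and4P) => [[/andP[h1 _] /eqP h2 /andP[h3 h4] /andP[h5 h6]]|].
  by split.
case=> -[h1 h2] h3 h4 h5 h6; rewrite h1 h2 h3 h4 h5 h6 eqxx; split=> //.
by apply/existsP; exists i; rewrite h2.
Qed.

(** The labeling determines the frame: the base point has label 0, [p] and [q] act on labels as the
    translations by (1, 0) and (0, 1) and fix the tenth point, and they generate the subgroup. *)
Lemma frame_label_inj : {in frames &, injective frame_label}.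
Proof.
move=> [[[E i] p] q] [[[E' i'] p'] q'].
move=> /framesP[[Eab i9] pE p1 qE qp] /framesP[[Eab' i9'] pE' p1' qE' qp'].
rewrite /frame_label /= => e.
have ii : i = i' by rewrite -(label_0 i p q) e label_0.
have OO : orbit 'P E i = orbit 'P E' i'.
  by rewrite -(label_orbit Eab i9 pE p1 qE qp) -(label_orbit Eab' i9' pE' p1' qE' qp') e.
have eqp (x x' : {perm 'I_10}) : x \in E -> x' \in E' ->
    (forall v, x (label p q i v) = x' (label p' q' i' v)) -> x = x'.
  move=> xE xE' xx; apply/permP => j.
  have [|nj] := boolP (j \in orbit 'P E i); last first.
    by rewrite (orbit9_out i9 xE nj) (orbit9_out i9' xE') // -OO.
  by rewrite -(label_orbit Eab i9 pE p1 qE qp) => /imsetP[v _ ->]; rewrite xx e.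
have pp : p = p'.
  by apply: eqp => // v; rewrite (label_p i Eab pE qE) (label_p i' Eab' pE' qE') e.
have qq : q = q'.
  by apply: eqp => // v; rewrite (label_q i p Eab qE) (label_q i' p' Eab' qE') e.
have EE : E = E'.
  apply/group_inj; rewrite -(frame_generate Eab i9 pE p1 qE qp).
  by rewrite -(frame_generate Eab' i9' pE' p1' qE' qp') pp qq.
by rewrite ii pp qq EE.
Qed.

Section Shift.
Variable f : {ffun D -> 'I_10}.
Hypothesis finj : injective f.

Definition shift_fun (d : D) (j : 'I_10) : 'I_10 :=
  if [pick v | f v == j] is Some v then f (v + d)%R else j.

Lemma shift_fun_f d v : shift_fun d (f v) = f (v + d)%R.
Proof.
by rewrite /shift_fun; case: pickP => [w /eqP/finj ->|/(_ v)]; rewrite ?eqxx.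
Qed.

Lemma shift_fun_out d j : (forall v, f v != j) -> shift_fun d j = j.
Proof. by move=> nj; rewrite /shift_fun; case: pickP => [w|//]; rewrite (negbTE (nj w)). Qed.

Lemma f_or_out j : (exists v, j = f v) \/ forall v, f v != j.
Proof.
have [/existsP[v /eqP <-]|] := boolP [exists v, f v == j]; first by left; exists v.
by rewrite negb_exists => /forallP; right.
Qed.

Lemma shift_funK d : cancel (shift_fun d) (shift_fun (- d)%R).
Proof.
move=> j; have [[v ->]|nj] := f_or_out j; first by rewrite !shift_fun_f addrK.
by rewrite !shift_fun_out.
Qed.

Definition shift d : {perm 'I_10} := perm (can_inj (shift_funK d)).

Lemma shiftE d v : shift d (f v) = f (v + d)%R.
Proof. by rewrite permE shift_fun_f. Qed.

Lemma shift_out d j : (forall v, f v != j) -> shift d j = j.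
Proof. by move=> nj; rewrite permE shift_fun_out. Qed.

Lemma shiftD d e : shift (d + e)%R = shift d * shift e.
Proof.
apply/permP => j; rewrite permM; have [[v ->]|nj] := f_or_out j.
  by rewrite !shiftE addrA.
by rewrite !shift_out.
Qed.

Lemma shift0 : shift 0%R = 1.
Proof.
apply/permP => j; rewrite perm1; have [[v ->]|nj] := f_or_out j; first by rewrite shiftE addr0.
by rewrite shift_out.
Qed.

Lemma shift_expg d k : shift d ^+ k = shift (d *+ k)%R.
Proof.
elim: k => [|k IHk]; first by rewrite expg0 mulr0n shift0.
by rewrite expgS IHk -shiftD mulrS.
Qed.

Lemma shift_group_set : group_set [set shift d | d : D].
Proof.
apply/group_setP; split=> [|_ _ /imsetP[d _ ->] /imsetP[e _ ->]].
  by apply/imsetP; exists 0%R; rewrite ?shift0.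
by rewrite -shiftD; apply: imset_f.
Qed.

Definition shift_group := Group shift_group_set.

Lemma D3 (d : D) : (d *+ 3 = 0)%R.
Proof.
case: d => a b; apply/eqP; rewrite xpair_eqE.
have h (c : 'Z_3) : (c *+ 3 == 0)%R by case: c => [[|[|[|m]]] hm].
by rewrite -[X in X == _]/((a, b) *+ 3).1%R !mulrS !mulr0n /= !addr0 -mulr2n -mulrS h -mulr2n -mulrS h.
Qed.

Lemma shift_abelem : 3.-abelem shift_group.
Proof.
apply/abelemP => //; split=> [|_ /imsetP[d _ ->]]; last by rewrite shift_expg D3 shift0.
apply/centsP => _ /imsetP[d _ ->] _ /imsetP[e _ ->].
by rewrite /commute -!shiftD addrC.
Qed.

Lemma shift_orbit : #|orbit 'P shift_group (f 0%R)| = 9.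
Proof.
have -> : orbit 'P shift_group (f 0%R) = [set f v | v : D].
  apply/setP => j; apply/mem_orbitP/imsetP => [[_ /imsetP[d _ ->] <-]|[v _ ->]].
    by exists d => //; rewrite shiftE add0r.
  by exists (shift v); [apply: imset_f|rewrite shiftE add0r].
by rewrite card_imset ?card_D.
Qed.

Lemma Z3_natmul (a : 'Z_3) : ((1 : 'Z_3) *+ a = a)%R.
Proof. by case: a => [[|[|[|m]]] hm] //; apply/val_inj. Qed.

Lemma pair_natmul (a b : 'Z_3) k : ((a, b) *+ k = (a *+ k, b *+ k) :> D)%R.
Proof. by elim: k => [|k IHk]; rewrite ?mulr0n // !mulrS IHk. Qed.

(** An injection carries the translations of [D] to a regular subgroup, framed by the image of 0 and
    the two basic translations. *)
Lemma label_surj : exists2 t, t \in frames & frame_label t = f.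
Proof.
exists (shift_group, f 0%R, shift (1, 0)%R, shift (0, 1)%R).
  apply/framesP; split; try exact: imset_f.
  - by split; [exact: shift_abelem|exact: shift_orbit].
  - apply/eqP => /permP/(_ (f 0%R)); rewrite shiftE perm1 => /finj/eqP.
    by rewrite add0r.
  - apply/negP => /cycleP[k]; rewrite shift_expg pair_natmul => /permP/(_ (f 0%R)).
    by rewrite !shiftE !add0r => /finj/eqP; rewrite xpair_eqE mul0rn andbF.
apply/ffunP => -[a b]; rewrite ffunE /= !shift_expg -shiftD shiftE add0r !pair_natmul !Z3_natmul !mul0rn.
by congr (f _); apply/eqP; rewrite xpair_eqE /= addr0 add0r !eqxx.
Qed.

End Shift.

Lemma card_frames : #|frames| = 10 ^_ 9.
Proof.
rewrite -(card_in_imset frame_label_inj).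
have -> : frame_label @: frames = [set f : {ffun D -> 'I_10} | injectiveb f].
  apply/setP => f; rewrite inE; apply/imsetP/injectiveP => [[[[[E i] p] q] /framesP]|finj].
    by move=> [[Eab i9] pE p1 qE qp] ->; exact: (label_injective Eab).
  by have [t tf <-] := label_surj finj; exists t.
by rewrite card_inj_ffuns card_ord card_D.
Qed.

Definition regulars : {set {group {perm 'I_10}}} := [set E | 3.-abelem (gval E) && regular E].

(** A regular subgroup moves 9 points, has 8 nontrivial elements [p], and 9 - 3 = 6 elements [q]
    outside the cyclic group of [p]. *)
Lemma card_frames_regulars : #|frames| = (#|regulars| * (9 * (8 * 6)))%N.
Proof.
rewrite -sum1_card.
transitivity (\sum_(E in regulars) \sum_(i | #|orbit 'P E i| == 9%N)
  \sum_(p in E^#) \sum_(q in E :\: <[p]>) 1)%N.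
  rewrite pair_big_dep pair_big_dep pair_big_dep /=; apply: eq_bigl => -[[[E i] p] q].
  by rewrite [LHS]in_set [E \in regulars]in_set /= -!andbA.
rewrite -sum_nat_const; apply: eq_bigr => E; rewrite inE => /andP[Eab rE].
have cE := regular_card Eab rE.
have [i0 /eqP i09] := existsP rE.
have c9 : #|[pred i | #|orbit 'P E i| == 9%N]| = 9.
  rewrite -[RHS]i09; apply: eq_card => i; rewrite !inE; apply/eqP/idP => [i9|io].
    by rewrite (orbit9_eq i09 i9) orbit_self.
  by rewrite (orbit_eqP io).
transitivity (\sum_(i | #|orbit 'P E i| == 9%N) (8 * 6))%N; last by rewrite sum_nat_const c9.
apply: eq_bigr => i _.
have c8 : #|E^#| = 8 by move: cE; rewrite (cardsD1 1) group1 add1n => -[].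
transitivity (\sum_(p in E^#) 6)%N; last by rewrite sum_nat_const c8.
apply: eq_bigr => p; rewrite !inE => /andP[p1 pE].
rewrite sum1_card cardsD (setIidPr _) ?cycle_subG // cE -orderE.
by rewrite (nt_prime_order (isT : prime 3)) //; case/(abelemP (isT : prime 3)): Eab => _; apply.
Qed.

(** This is 10! divided by 432 = 9 * 8 * 6, the order of the affine group AGL(2,3). *)
Lemma card_regulars : #|regulars| = (84 * 100)%N.
Proof.
have := card_frames; rewrite card_frames_regulars !ffactnS ffactn0 /=.
by move: #|regulars| => n; lia.
Qed.

End Labelings.

(** [n] is a variable here and in [legs_index], which keeps the unary numeral 25200 out of the
    arguments. *)
Lemma card_enum_exists (T : finType) (A : {set T}) n a : a \in A -> #|A| = n ->
  exists f : T -> 'I_n, {in A &, injective f} /\ forall i, exists2 t, t \in A & f t = i.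
Proof.
move=> aA cA; subst n; exists (enum_rank_in aA); split=> [|i].
  by apply: can_in_inj (@enum_val _ (mem A)) _; apply: enum_rankK_in.
by exists (enum_val i); [exact: enum_valP|exact: enum_valK_in].
Qed.

(** * The poset, its regular elements and the legs of their cones *)

Section ElementaryAbelianSubgroups.
Local Open Scope group_scope.
Local Notation P := (Ap_poset 3 'Alt_('I_10)%G).
Implicit Types (x y z : P) (s t : {set {set 'I_10}}).

Definition Ap_regular x : bool := regular (\val x).
Definition Ap_orbits x : {set {set 'I_10}} := triple_orbits (\val x).
(* [b] is a default for the [s] that are not simplices. *)
Definition Ap_torus (b : P) s : P := insubd b <<torus s>>%G.

Lemma Ap_pred (E : {group {perm 'I_10}}) : elem_abelian_pred 3 'Alt_('I_10)%G E =
  [&& E \subset 'Alt_('I_10), 3.-abelem E & E :!=: 1].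
Proof. by rewrite /elem_abelian_pred /= inE -andbA. Qed.

Lemma Ap_abelem x : 3.-abelem (\val x).
Proof. by have := valP x; rewrite Ap_pred => /and3P[]. Qed.

Lemma Ap_neq1 x : gval (\val x) != 1.
Proof. by have := valP x; rewrite Ap_pred => /and3P[]. Qed.

(** Permutations of cube 1 are even, so the poset is that of the whole symmetric group. *)
Lemma abelem_Alt (E : {group {perm 'I_10}}) : 3.-abelem E -> E \subset 'Alt_('I_10).
Proof.
case/(abelemP (isT : prime 3)) => _ h; apply/subsetP => x /h x3.
by rewrite Alt_even odd_perm3.
Qed.

Lemma Ap_predE (E : {group {perm 'I_10}}) :
  3.-abelem E -> E :!=: 1 -> elem_abelian_pred 3 'Alt_('I_10)%G E.
Proof. by move=> Eab E1; rewrite Ap_pred Eab E1 abelem_Alt. Qed.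

Lemma Ap_leE x y : (x <= y)%O = (\val x \subset \val y).
Proof. by []. Qed.

Lemma Ap_ltE x y : (x < y)%O = (\val x \proper \val y).
Proof.
rewrite Order.POrderTheory.lt_def Ap_leE andbC properEneq andbC; congr (_ && _).
by rewrite eq_sym.
Qed.

Lemma Ap_orbits_kneser x : ~~ Ap_regular x -> Ap_orbits x \in kneser.
Proof. by apply: triple_orbits_kneser; [exact: Ap_abelem|exact: Ap_neq1]. Qed.

Lemma Ap_orbits_le x y : ~~ Ap_regular y -> (x <= y)%O ->
  ~~ Ap_regular x /\ Ap_orbits x \subset Ap_orbits y.
Proof.
move=> ry xy; split; last exact: triple_orbits_sub (Ap_abelem y) ry xy.
by apply: contra ry => rx; exact: regular_sup (Ap_abelem y) xy rx.
Qed.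

Lemma Ap_torusE b s : s \in kneser -> \val (Ap_torus b s) = <<torus s>>%G.
Proof.
by move=> ks; rewrite insubdK //; apply: Ap_predE; [exact: torus_abelem|exact: torus_neq1].
Qed.

Lemma Ap_torus_regular b s : s \in kneser ->
  ~~ Ap_regular (Ap_torus b s) /\ Ap_orbits (Ap_torus b s) \subset s.
Proof.
move=> ks; rewrite /Ap_regular /Ap_orbits Ap_torusE //.
by split; [exact: torus_not_regular|exact: triple_orbits_torus].
Qed.

Lemma Ap_torus_le b s t : t \in kneser -> s != set0 -> s \subset t -> (Ap_torus b s <= Ap_torus b t)%O.
Proof.
move=> kt s0 st; have ks := kneser_sub kt s0 st.
by rewrite Ap_leE !Ap_torusE //; apply: genS; exact: torus_sub.
Qed.

Lemma le_Ap_torus b x : ~~ Ap_regular x -> (x <= Ap_torus b (Ap_orbits x))%O.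
Proof.
move=> rx; rewrite Ap_leE Ap_torusE ?Ap_orbits_kneser //.
by apply: subset_trans (subset_gen _); apply: sub_torus => //; exact: Ap_abelem.
Qed.

Lemma Ap_regular_max x y : Ap_regular x -> (x <= y)%O -> y = x.
Proof.
by move=> rx xy; apply/val_inj; apply: (regular_maximal (Ap_abelem x) (Ap_abelem y) rx xy).
Qed.

Lemma card_below_regular x z : Ap_regular z -> (x < z)%O -> #|\val x| = 3.
Proof.
rewrite Ap_ltE => /(regular_card (Ap_abelem z)) z9 /proper_card; rewrite z9.
have /p_natP[k ok] := abelem_pgroup (Ap_abelem x).
have := Ap_neq1 x; rewrite -cardG_gt1 ok; case: k {ok} => [|[|k]] // _ h.
by have := leq_ltn_trans (leq_pexp2l (isT : 0 < 3) (isT : 2 <= k.+2)) h.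
Qed.

(** The link of a regular subgroup is discrete, since all points below it have order 3. *)
Lemma Ap_regular_chain x y z : Ap_regular z -> (x <= y)%O -> (y < z)%O -> x = y.
Proof.
move=> rz xy yz; apply/val_inj/group_inj/eqP; rewrite eqEcard -Ap_leE xy.
by rewrite !(card_below_regular rz) // (Order.POrderTheory.le_lt_trans xy yz).
Qed.

Lemma card_lt_regular z : Ap_regular z -> #|[set x : P | (x < z)%O]| = 4.
Proof.
move=> rz; have zab := Ap_abelem z; have z9 := regular_card zab rz.
have z2 : \val z \in 'E_3^2(\val z).
  by rewrite pnElemE // !inE subxx zab z9.
transitivity #|'E_3^1(\val z)|; last exact: card_p1Elem_p2Elem z2.
rewrite -(card_imset _ val_inj); apply: eq_card => E.
apply/imsetP/idP => [[x]|].
  rewrite inE => xz ->; rewrite pnElemE // !inE Ap_abelem (card_below_regular rz xz) eqxx !andbT.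
  by apply: proper_sub; rewrite -Ap_ltE.
rewrite pnElemE // !inE => /andP[/andP[Ez Eab] /eqP E3].
have E1 : E :!=: 1 by rewrite -cardG_gt1 E3.
exists (Sub E (Ap_predE Eab E1)); last by rewrite SubK.
by rewrite inE Ap_ltE SubK properEcard Ez E3 z9.
Qed.

Definition Ap_base z : P := odflt z [pick x | (x < z)%O].

Lemma Ap_base_lt z : Ap_regular z -> (Ap_base z < z)%O.
Proof.
move=> rz; rewrite /Ap_base; case: pickP => [//|h].
by have := card_lt_regular rz; rewrite (_ : [set x | _] = set0) ?cards0 //; apply/setP => x; rewrite !inE h.
Qed.

(** Coning off the four points below [z] gives one free generator for each point but [Ap_base z],
    through which the cone is reached. *)
Definition legs : {set P * P} :=
  [set t : P * P | [&& Ap_regular t.1, (t.2 < t.1)%O & t.2 != Ap_base t.1]].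

Lemma card_Ap_regular : #|[set z : P | Ap_regular z]| = (84 * 100)%N.
Proof.
rewrite -card_regulars -(card_imset _ val_inj); apply: eq_card => E.
apply/imsetP/idP => [[z]|]; rewrite !inE.
  by rewrite /Ap_regular => rz ->; rewrite Ap_abelem.
move=> /andP[Eab rE]; have E1 : E :!=: 1 by rewrite -cardG_gt1 (regular_card Eab rE).
by exists (Sub E (Ap_predE Eab E1)); rewrite ?SubK // inE /Ap_regular SubK.
Qed.

Lemma card_legs : #|legs| = (84 * 100 * 3)%N.
Proof.
rewrite -card_Ap_regular -sum1_card -sum_nat_const.
transitivity (\sum_(z in [set z : P | Ap_regular z]) \sum_(x : P | (x < z)%O && (x != Ap_base z)) 1)%N.
  by rewrite pair_big_dep /=; apply: eq_bigl => -[z x]; rewrite !inE.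
apply: eq_bigr => z; rewrite inE => rz; rewrite sum1_card.
have := card_lt_regular rz; rewrite (cardsD1 (Ap_base z)) inE Ap_base_lt // add1n => -[] c3.
by apply: etrans c3; apply: eq_card => x; rewrite !inE andbC.
Qed.

Lemma legs_index n : #|legs| = n -> exists index : P -> P -> 'I_n,
  (forall x y z w, Ap_regular z -> (x < z)%O -> x != Ap_base z ->
    Ap_regular w -> (y < w)%O -> y != Ap_base w -> index z x = index w y -> z = w /\ x = y) /\
  (forall i, exists z x, [/\ Ap_regular z, (x < z)%O, x != Ap_base z & index z x = i]).
Proof.
move=> nE; have /set0Pn[t tl] : legs != set0 by rewrite -card_gt0 card_legs.
have [f [fI fS]] := card_enum_exists tl nE; exists (fun z x => f (z, x)); split.
  move=> x y z w rz xz xb rw yw yb e.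
  have lz : (z, x) \in legs by rewrite inE /=; apply/and3P.
  have lw : (w, y) \in legs by rewrite inE /=; apply/and3P.
  by have [] := fI _ _ lz lw e.
by move=> i; have [[z x]] := fS i; rewrite inE => /and3P[] /= ? ? ? <-; exists z, x.
Qed.

End ElementaryAbelianSubgroups.

From mathcomp Require Import all_classical all_reals topology normedtype.
From mathcomp Require Import homotopy lra.

Import Order.TTheory GRing.Theory Num.Theory.
Import numFieldNormedType.Exports.

Local Open Scope ring_scope.
Local Open Scope classical_set_scope.
Local Open Scope quotient_scope.

(** * The path groupoid *)

Lemma cont_comp (X Y Z : topologicalType) (f : X -> Y) (g : Y -> Z) :
  continuous f -> continuous g -> continuous (fun x => g (f x)).
Proof. by move=> cf cg x; apply: (@continuous_comp X Y Z f g); [exact: cf|exact: cg]. Qed.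

Lemma cont_pair (X Y Z : topologicalType) (f : X -> Y) (g : X -> Z) :
  continuous f -> continuous g -> continuous (fun x => (f x, g x)).
Proof. by move=> cf cg x; exact: (cvg_pair (cf x) (cg x)). Qed.

Lemma cont_fst (X Y : topologicalType) : continuous (@fst X Y).
Proof. by move=> x; exact: cvg_fst. Qed.

Lemma cont_snd (X Y : topologicalType) : continuous (@snd X Y).
Proof. by move=> x; exact: cvg_snd. Qed.

Lemma cont_id (X : topologicalType) : continuous (fun x : X => x).
Proof. by move=> x; exact: cvg_id. Qed.

Lemma cont_compR (R : realType) (X T : topologicalType) (u : X -> R) (g : R -> T) :
  continuous u -> continuous g -> continuous (fun x => g (u x)).
Proof. exact: cont_comp. Qed.

Lemma cont_compRR (R : realType) (X T : topologicalType) (u v : X -> R) (g : R * R -> T) :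
  continuous u -> continuous v -> continuous g -> continuous (fun x => g (u x, v x)).
Proof. by move=> cu cv; apply: cont_comp; apply: cont_pair. Qed.

Section UnitClamp.
Variable R : realType.

Definition unit_clamp (t : R) : R := Num.min 1 (Num.max 0 t).

Lemma unit_clamp_continuous : continuous unit_clamp.
Proof.
move=> x; apply: (@continuous_min R R (fun=> 1) (fun r => Num.max 0 r)).
  exact: cvg_cst.
by apply: (@continuous_max R R (fun=> 0) (fun r => r)); [exact: cvg_cst|exact: cvg_id].
Qed.

Lemma unit_clamp_le0 t : t <= 0 -> unit_clamp t = 0.
Proof. by rewrite /unit_clamp minEle maxEle; do ?case: ifPn; rewrite -?ltNge => *; lra. Qed.

Lemma unit_clamp_ge1 t : 1 <= t -> unit_clamp t = 1.
Proof. by rewrite /unit_clamp minEle maxEle; do ?case: ifPn; rewrite -?ltNge => *; lra. Qed.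

Lemma unit_clamp_id t : 0 <= t <= 1 -> unit_clamp t = t.
Proof.
by case/andP; rewrite /unit_clamp minEle maxEle; do ?case: ifPn; rewrite -?ltNge => *; lra.
Qed.

Lemma unit_clamp_bound t : 0 <= unit_clamp t <= 1.
Proof.
by rewrite /unit_clamp minEle maxEle; do ?case: ifPn; rewrite -?ltNge => *;
  apply/andP; split; lra.
Qed.

End UnitClamp.

#[local] Hint Resolve cont_fst cont_snd cont_id : core.

Lemma contN (R : realType) (X : topologicalType) (f : X -> R) :
  continuous f -> continuous (fun x => - f x).
Proof. by move=> cf x; exact: (cvgN (cf x)). Qed.

Lemma cont_clamp (R : realType) (X : topologicalType) (f : X -> R) :
  continuous f -> continuous (fun x => unit_clamp (f x)).
Proof. by move=> cf; apply: cont_compR cf _; exact: unit_clamp_continuous. Qed.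

Lemma comp_fst (X Y T : topologicalType) (f : X -> T) :
  continuous f -> continuous (fun u : X * Y => f u.1).
Proof. by move=> cf; apply: (cont_comp _ cf); exact: cont_fst. Qed.

(** Continuity is read off the syntax of the function; the eta-contracted patterns catch functions
    that come without their lambda. *)
Ltac cstep :=
  let y := fresh "y" in
  intro y; match goal with |- @continuous_at _ _ _ ?h =>
  revert y;
  lazymatch h with
  | (fun x => x) => exact: cont_id
  | (fun x => fst x) => exact: cont_fst
  | (fun x => snd x) => exact: cont_snd
  | @fst _ _ => exact: cont_fst
  | @snd _ _ => exact: cont_snd
  | (fun x => @Algebra.add _ (@?a x) (@?b x)) => apply: (@contD _ _ a b)
  | @Algebra.add _ ?a => apply: (@contD _ _ (fun=> a) id)
  | (fun x => @Algebra.opp _ (@?a x)) => apply: (@contN _ _ a)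
  | @Algebra.opp _ => apply: (@contN _ _ id)
  | (fun x => @GRing.mul _ (@?a x) (@?b x)) => apply: (@contM _ _ a b)
  | @GRing.mul _ ?a => apply: (@contM _ _ (fun=> a) id)
  | (fun x => unit_clamp (@?a x)) => apply: (@cont_clamp _ _ a)
  | @unit_clamp _ => exact: unit_clamp_continuous
  | (fun x => ?c) => exact: contC
  | id => exact: cont_id
  | _ => assumption
  end end.
Ltac ctac := repeat cstep.

Section Groupoid.
Variables (R : realType) (T : topologicalType).
Implicit Types (x y z w : T) (f g h : R -> T).

(* Paths are parametrized by the whole line and constant outside [0, 1]. *)
Definition is_path x y f :=
  [/\ continuous f, forall t, t <= 0 -> f t = x & forall t, 1 <= t -> f t = y].

Definition hpath x y f g := exists H : R * R -> T,
  [/\ continuous H, forall t, H (t, 0) = f t, forall t, H (t, 1) = g t,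
    forall t s, t <= 0 -> H (t, s) = x & forall t s, 1 <= t -> H (t, s) = y].

Definition conc f g t := if t <= 2^-1 then f (2 * t) else g (2 * t - 1).
Definition inv_path f t := f (1 - t).
(** The case b < a is allowed and runs [F] backwards, which yields inverses in [conc_inv_l]. *)
Definition subpath (F : R -> T) (a b t : R) := F (a + (b - a) * unit_clamp t).

Lemma conc_path x y z f g : is_path x y f -> is_path y z g -> is_path x z (conc f g).
Proof.
case=> cf f0 f1 [cg g0 g1]; rewrite /conc; split.
- apply: (@continuous_paste R) => //.
  + by apply: (cont_compR _ cf); ctac.
  + by apply: (cont_compR _ cg); ctac.
  + by move=> t ->; rewrite f1 ?g0 //; lra.
- by move=> t t0; rewrite ifT; [apply: f0|]; lra.
- by move=> t t1; rewrite ifF; [apply: g1; lra|apply/negbTE; rewrite -ltNge; lra].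
Qed.

Lemma inv_path_path x y f : is_path x y f -> is_path y x (inv_path f).
Proof.
case=> cf f0 f1; rewrite /inv_path; split.
- by apply: (cont_compR _ cf); ctac.
- by move=> t t0; apply: f1; lra.
- by move=> t t0; apply: f0; lra.
Qed.

Lemma cst_is_path x : is_path x x (fun=> x).
Proof. by split => //; exact: cst_continuous. Qed.

Lemma subpath_path F a b : continuous F -> is_path (F a) (F b) (subpath F a b).
Proof.
move=> cF; rewrite /subpath; split.
- by apply: (cont_compR _ cF); ctac.
- by move=> t t0; rewrite unit_clamp_le0 // mulr0 addr0.
- by move=> t t0; rewrite unit_clamp_ge1 // mulr1 addrC subrK.
Qed.

Lemma hpath_sym x y f g : hpath x y f g -> hpath x y g f.
Proof.
case=> H [cH H0 H1 Hx Hy]; exists (fun u : R * R => H (u.1, 1 - u.2)); split => /=.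
- by apply: (cont_compRR _ _ cH); ctac.
- by move=> t; rewrite subr0.
- by move=> t; rewrite subrr.
- by move=> t s t0; exact: Hx.
- by move=> t s t1; exact: Hy.
Qed.

Lemma hpath_trans x y f g h : hpath x y f g -> hpath x y g h -> hpath x y f h.
Proof.
case=> H [cH H0 H1 Hx Hy] [K [cK K0 K1 Kx Ky]].
exists (fun u : R * R => if u.2 <= 2^-1 then H (u.1, 2 * u.2) else K (u.1, 2 * u.2 - 1)).
split => /=.
- apply: (@continuous_paste R) => //; first exact: cont_snd.
  + by apply: (cont_compRR _ _ cH); ctac.
  + by apply: (cont_compRR _ _ cK); ctac.
  + by move=> u ->; rewrite divff ?pnatr_eq0 // subrr H1 K0.
- by move=> t; rewrite ifT ?mulr0 ?H0 //; lra.
- move=> t; rewrite ifF; last by apply/negbTE; rewrite -ltNge; lra.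
  by rewrite (_ : 2 * 1 - 1 = 1) ?K1 //; lra.
- by move=> t s t0; rewrite Hx // Kx // if_same.
- by move=> t s t0; rewrite Hy // Ky // if_same.
Qed.

Lemma hpath_conc x y z f f' g g' : hpath x y f f' -> hpath y z g g' ->
  hpath x z (conc f g) (conc f' g').
Proof.
case=> H [cH H0 H1 Hx Hy] [K [cK K0 K1 Kx Ky]].
exists (fun u : R * R => if u.1 <= 2^-1 then H (2 * u.1, u.2) else K (2 * u.1 - 1, u.2)).
split => /=.
- apply: (@continuous_paste R) => //; first exact: cont_fst.
  + by apply: (cont_compRR _ _ cH); ctac.
  + by apply: (cont_compRR _ _ cK); ctac.
  + by move=> t ->; rewrite Hy ?Kx //; lra.
- by move=> t; rewrite H0 K0.
- by move=> t; rewrite H1 K1.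
- by move=> t s t0; rewrite ifT ?Hx //; lra.
- by move=> t s t1; rewrite ifF ?Ky //; [lra|apply/negbTE; rewrite -ltNge; lra].
Qed.

(* Two paths of the plane with the same ends are homotopic, hence so are their
   images: this is the source of all homotopies below. *)
Lemma hpath_plane (F : R * R -> T) (p p' q q' : R -> R) a b a' b' :
  continuous F -> continuous p -> continuous p' -> continuous q -> continuous q' ->
  (forall t, t <= 0 -> [/\ p t = a, q t = a, p' t = a' & q' t = a']) ->
  (forall t, 1 <= t -> [/\ p t = b, q t = b, p' t = b' & q' t = b']) ->
  hpath (F (a, a')) (F (b, b')) (fun t => F (p t, p' t)) (fun t => F (q t, q' t)).
Proof.
move=> cF cp cp' cq cq' e0 e1.
exists (fun u : R * R => F ((1 - u.2) * p u.1 + u.2 * q u.1, (1 - u.2) * p' u.1 + u.2 * q' u.1)).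
split => /=.
- have c1 (r : R -> R) : continuous r -> continuous (fun u : R * R => r u.1).
    by move=> cr; apply: cont_comp => //; exact: cont_fst.
  by apply: (cont_compRR _ _ cF); ctac; apply: c1.
- by move=> t; congr (F (_, _)); ring.
- by move=> t; congr (F (_, _)); ring.
- by move=> t s /e0[-> -> -> ->]; congr (F (_, _)); ring.
- by move=> t s /e1[-> -> -> ->]; congr (F (_, _)); ring.
Qed.

Lemma hpath_line (F : R -> T) (p q : R -> R) a b : continuous F ->
  continuous p -> continuous q ->
  (forall t, t <= 0 -> p t = a /\ q t = a) ->
  (forall t, 1 <= t -> p t = b /\ q t = b) ->
  hpath (F a) (F b) (fun t => F (p t)) (fun t => F (q t)).
Proof.
move=> cF cp cq e0 e1.
apply: (@hpath_plane (fun u : R * R => F u.1) p (fun=> 0) q (fun=> 0) a b 0 0) => //.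
- by apply: cont_comp => //; exact: cont_fst.
- exact: contC.
- exact: contC.
- by move=> t /e0[].
- by move=> t /e1[].
Qed.

Lemma hpath_refl x y f : is_path x y f -> hpath x y f f.
Proof.
case=> cf f0 f1; rewrite -(f0 0) // -(f1 1) //.
have {1 2 3 4}-> : f = fun t => f (unit_clamp t).
  apply/funext => t; case: (leP t 0) => t0; first by rewrite unit_clamp_le0 // !f0.
  case: (leP 1 t) => t1; first by rewrite unit_clamp_ge1 // !f1.
  by rewrite unit_clamp_id // !ltW.
rewrite (unit_clamp_le0 (lexx 0)) (unit_clamp_ge1 (lexx 1)).
apply: (@hpath_line f (@unit_clamp R) (@unit_clamp R) 0 1) => //.
- exact: unit_clamp_continuous.
- exact: unit_clamp_continuous.
- by move=> t t0; rewrite unit_clamp_le0.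
- by move=> t t0; rewrite unit_clamp_ge1.
Qed.

(** Both sides are [F] along paths of the line from a to c. Suitable choices of a, b, c give the
    unit, inverse and associativity laws. *)
Lemma subpath_conc (F : R -> T) a b c : continuous F ->
  hpath (F a) (F c) (conc (subpath F a b) (subpath F b c)) (subpath F a c).
Proof.
move=> cF.
have -> : conc (subpath F a b) (subpath F b c) =
  fun t => F (a + (b - a) * unit_clamp (2 * t) + (c - b) * unit_clamp (2 * t - 1)).
  apply/funext => t; rewrite /conc /subpath; case: leP => t2.
    by rewrite [unit_clamp (2 * t - 1)]unit_clamp_le0 ?mulr0 ?addr0 //; lra.
  by rewrite [unit_clamp (2 * t)]unit_clamp_ge1; [congr F; ring|lra].
apply: hpath_line => //.
- by ctac.
- by ctac.
- by move=> t t0; rewrite !unit_clamp_le0 ?mulr0 ?addr0 //; lra.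
- by move=> t t0; rewrite !unit_clamp_ge1 ?mulr1; try lra; split; ring.
Qed.

Lemma subpath_id x y f : is_path x y f -> subpath f 0 1 = f.
Proof.
case=> cf f0 f1; apply/funext => t; rewrite /subpath subr0 add0r mul1r.
case: (leP t 0) => t0; first by rewrite unit_clamp_le0 // !f0.
case: (leP 1 t) => t1; first by rewrite unit_clamp_ge1 // !f1.
by rewrite unit_clamp_id // !ltW.
Qed.

Lemma subpath_cst f a : subpath f a a = fun=> f a.
Proof. by apply/funext => t; rewrite /subpath subrr mul0r addr0. Qed.

Lemma conc_cst_l x y f : is_path x y f -> hpath x y (conc (fun=> x) f) f.
Proof.
move=> pf; have [cf f0 f1] := pf; have := subpath_conc 0 0 1 cf.
by rewrite subpath_cst (subpath_id pf) (f0 0) // (f1 1).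
Qed.

Lemma conc_inv_l x y f : is_path x y f -> hpath y y (conc (inv_path f) f) (fun=> y).
Proof.
move=> pf; have [cf f0 f1] := pf; have := subpath_conc 1 0 1 cf.
rewrite subpath_cst (subpath_id pf) (f1 1) //; congr (hpath _ _ (conc _ _) _).
rewrite -[RHS](subpath_id (inv_path_path pf)).
by apply/funext => t; rewrite /subpath /inv_path; congr f; ring.
Qed.

Lemma concA x y z w f g h : is_path x y f -> is_path y z g -> is_path z w h ->
  hpath x w (conc f (conc g h)) (conc (conc f g) h).
Proof.
move=> pf pg ph.
have [cf f0 f1] := pf; have [cg g0 g1] := pg; have [ch h0 h1] := ph.
(* The three paths are laid end to end on [0, 3]; both bracketings are homotopic to
   [subpath F 0 3]. *)
pose F t := if t <= 1 then f t else if t <= 2 then g (t - 1) else h (t - 2).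
have cF : continuous F.
  apply: (@continuous_paste R _ _ (fun t => t) 1) => //.
    apply: (@continuous_paste R _ _ (fun t => t) 2) => //.
    - by apply: (cont_compR _ cg); ctac.
    - by apply: (cont_compR _ ch); ctac.
    - by move=> t /= ->; rewrite g1 ?h0 //; lra.
  by move=> t /= ->; rewrite f1 // ifT ?g0 //; lra.
have Ff : subpath F 0 1 = f.
  rewrite -[RHS](subpath_id pf); apply/funext => t; rewrite /subpath /F.
  by rewrite ifT //; have := unit_clamp_bound t; lra.
have Fg : subpath F 1 2 = g.
  rewrite -[RHS](subpath_id pg); apply/funext => t; rewrite /subpath /F.
  have /andP[b0 b1] := unit_clamp_bound t.
  case: ifPn => [t0|_]; last by rewrite ifT; [congr g; ring|lra].
  have {t0 b0} -> : unit_clamp t = 0 by lra.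
  by rewrite !mulr0 !addr0 f1 // g0.
have Fh : subpath F 2 3 = h.
  rewrite -[RHS](subpath_id ph); apply/funext => t; rewrite /subpath /F.
  have /andP[b0 b1] := unit_clamp_bound t.
  rewrite ifF; last by apply/negbTE; rewrite -ltNge; lra.
  case: ifPn => [t0|_]; last by congr h; ring.
  have {t0 b0} -> : unit_clamp t = 0 by lra.
  by rewrite !mulr0 !addr0 h0 // g1 //; lra.
have F0 : F 0 = x by rewrite /F ifT ?f0 //; lra.
have F1 : F 1 = y by rewrite /F ifT ?f1 //; lra.
have F2 : F 2 = z.
  rewrite /F ifF; last by apply/negbTE; rewrite -ltNge; lra.
  by rewrite ifT ?g1 //; lra.
have F3 : F 3 = w.
  rewrite /F ifF; last by apply/negbTE; rewrite -ltNge; lra.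
  by rewrite ifF ?h1 //; [lra|apply/negbTE; rewrite -ltNge; lra].
have s01 := subpath_conc 0 1 2 cF; have s02 := subpath_conc 0 2 3 cF.
have s12 := subpath_conc 1 2 3 cF; have s13 := subpath_conc 0 1 3 cF.
rewrite F0 F2 Ff Fg in s01; rewrite F0 F3 Fh in s02.
rewrite F1 F3 Fg Fh in s12; rewrite F0 F3 Ff in s13.
apply: hpath_trans (hpath_conc (hpath_refl pf) s12) _.
apply: hpath_trans s13 _; apply: hpath_sym.
exact: hpath_trans (hpath_conc s01 (hpath_refl ph)) s02.
Qed.

End Groupoid.

(** * Classes of loops and of paths closed up to loops *)

Section LoopClass.
Variables (R : realType) (T : topologicalType) (x0 : T).
Local Notation I := (unit_interval R).
Local Notation loop := {path I from x0 to x0 in T}.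
Local Notation pi1 := (fundamental_group R x0).
Implicit Types f g h : R -> T.

Lemma val_zero : set_val (zero : I) = 0.
Proof. by rewrite clampK // lexx ler01. Qed.

Lemma val_one : set_val (one : I) = 1.
Proof. by rewrite clampK // lexx ler01. Qed.

Lemma clamp_zero (t : R) : t <= 0 -> clamp t = zero.
Proof. by move=> r0; apply: val_inj; rewrite /= (max_idPl r0) maxxx. Qed.

Lemma clamp_one (t : R) : 1 <= t -> clamp t = one.
Proof.
move=> r1; apply: val_inj => /=.
rewrite (max_idPr (le_trans ler01 r1)) (max_idPr ler01) minxx.
by rewrite (min_idPl r1).
Qed.

Section Build.
Variables (f : R -> T) (pf : is_path x0 x0 f).

Lemma loop_of_continuous : continuous (fun t : I => f (set_val t)).
Proof.
by have [cf _ _] := pf; apply: (cont_comp _ cf); exact: set_val_continuous.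
Qed.

Lemma loop_of0 : f (set_val (zero : I)) = x0.
Proof. by have [_ f0 _] := pf; rewrite val_zero f0. Qed.

Lemma loop_of1 : f (set_val (one : I)) = x0.
Proof. by have [_ _ f1] := pf; rewrite val_one f1. Qed.

Definition loop_of : loop := mk_path loop_of_continuous loop_of0 loop_of1.

Lemma loop_ofE t : loop_of t = f (set_val t). Proof. by []. Qed.

End Build.

Definition line_of (p : loop) (t : R) : T := p (clamp t).

Lemma line_of_path p : is_path x0 x0 (line_of p).
Proof.
split.
- apply: (@cont_comp _ _ _ (fun t : R => clamp t) p); last exact: cts_fun.
  by apply: (@continuous_clamp R R (fun t => t)) => x; exact: cvg_id.
- by move=> t t0; rewrite /line_of clamp_zero // path_zero.
- by move=> t t1; rewrite /line_of clamp_one // path_one.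
Qed.

Lemma line_ofK p : loop_of (line_of_path p) = p.
Proof. by apply/path_eqP => t; rewrite loop_ofE /line_of clamp_val. Qed.

Lemma loop_ofP f g (pf : is_path x0 x0 f) (pg : is_path x0 x0 g) :
  path_homotopic (loop_of pf) (loop_of pg) <-> hpath x0 x0 f g.
Proof.
have clv h (t : R) : is_path x0 x0 h -> h (set_val (clamp t)) = h t.
  case=> ch h0 h1; case: (leP t 0) => t0; first by rewrite clamp_zero // val_zero !h0.
  case: (leP 1 t) => t1; first by rewrite clamp_one // val_one !h1.
  by rewrite clampK // !ltW.
split=> [[H [cH H0 H1 Hx Hy]]|[H [cH H0 H1 Hx Hy]]].
  exists (fun u : R * R => H (clamp u.1, clamp u.2)); split => /=.
  - by apply: (cont_comp _ cH); apply: cont_pair; apply: continuous_clamp; ctac.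
  - by move=> t; rewrite (clamp_zero (lexx 0)) H0 loop_ofE clv.
  - by move=> t; rewrite (clamp_one (lexx 1)) H1 loop_ofE clv.
  - by move=> t s t0; rewrite clamp_zero.
  - by move=> t s t1; rewrite clamp_one.
exists (fun u : I * I => H (set_val u.1, set_val u.2)); split => /=.
- apply: (cont_comp _ cH); apply: cont_pair.
    by apply: (cont_comp _ (@set_val_continuous R)); exact: cont_fst.
  by apply: (cont_comp _ (@set_val_continuous R)); exact: cont_snd.
- by move=> t; rewrite val_zero H0.
- by move=> t; rewrite val_one H1.
- by move=> s; rewrite val_zero Hx.
- by move=> s; rewrite val_one Hy.
Qed.

(** Total in [f], with value 1 off the loops, so that terms carry no proof of [is_path]. *)
Definition loop_class f : pi1 :=
  if pselect (is_path x0 x0 f) is left pf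
  then \pi_(sg_quot (loop_setoid R x0)) (loop_of pf : loop_setoid R x0) else 1%g.

Lemma loop_classE f (pf : is_path x0 x0 f) :
  loop_class f = \pi_(sg_quot (loop_setoid R x0)) (loop_of pf : loop_setoid R x0).
Proof.
by rewrite /loop_class; case: pselect => // pf'; rewrite (Prop_irrelevance pf pf').
Qed.

Lemma loop_class_eq f g : is_path x0 x0 f -> is_path x0 x0 g ->
  loop_class f = loop_class g <-> hpath x0 x0 f g.
Proof.
move=> pf pg; rewrite (loop_classE pf) (loop_classE pg) -(loop_ofP pf pg).
exact: (@sg_piP (loop_setoid R x0)).
Qed.

Lemma loop_class_surj (a : pi1) : exists2 f, is_path x0 x0 f & a = loop_class f.
Proof.
exists (line_of (repr (a : sg_quot (loop_setoid R x0)))); first exact: line_of_path.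
by rewrite (loop_classE (line_of_path _)) line_ofK reprK.
Qed.

Lemma loop_class_conc f g : is_path x0 x0 f -> is_path x0 x0 g ->
  loop_class (conc f g) = (loop_class f * loop_class g)%g.
Proof.
move=> pf pg; rewrite (loop_classE pf) (loop_classE pg) (loop_classE (conc_path pf pg)).
apply: etrans (esym (@quot_mulE (loop_setoid R x0) (loop_of pf) (loop_of pg))).
congr (\pi _).
apply/path_eqP => t; rewrite loop_ofE /conc.
transitivity (if set_val t <= 2^-1 then f (set_val (clamp (2 * set_val t)))
  else g (set_val (clamp (2 * set_val t - 1)))); last reflexivity.
have /andP[t0 t1] := unit_interval_bound t.
case: ifP => t2; rewrite clampK //; first by apply/andP; split; lra.
by move/negbT: t2; rewrite -ltNge => t2; apply/andP; split; lra.
Qed.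

Lemma loop_class_cst : loop_class (fun=> x0) = 1%g.
Proof.
have pc := @cst_is_path R T x0.
have := loop_class_conc pc pc; rewrite (_ : conc _ _ = fun=> x0).
  by move=> /(congr1 (fun a => (loop_class (fun=> x0))^-1 * a)%g); rewrite mulVg mulKg.
by apply/funext => t; rewrite /conc if_same.
Qed.

Section BasePaths.
Variables (d : T -> R -> T).
Hypothesis pd : forall y, is_path x0 y (d y).
Hypothesis d0 : d x0 = fun=> x0.

(* The path [f] from [y] to [z], closed up to a loop by the chosen paths from the base point. *)
Definition path_class y z f : pi1 :=
  loop_class (conc (conc (d y) f) (inv_path (d z))).

Lemma path_class_path y z f : is_path y z f ->
  is_path x0 x0 (conc (conc (d y) f) (inv_path (d z))).
Proof. by move=> pf; apply: conc_path (conc_path (pd y) pf) (inv_path_path (pd z)). Qed.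

Lemma path_class_eq y z f g : is_path y z f -> is_path y z g ->
  hpath y z f g -> path_class y z f = path_class y z g.
Proof.
move=> pf pg fg; apply/loop_class_eq; do ?exact: path_class_path.
apply: hpath_conc (hpath_conc (hpath_refl (pd y)) fg) (hpath_refl _).
exact: inv_path_path (pd z).
Qed.

(** Functoriality on the path groupoid: the inverse of [d z] and the [d z] that follows it
    cancel. *)
Lemma path_class_conc y z w f g : is_path y z f -> is_path z w g ->
  path_class y w (conc f g) = (path_class y z f * path_class z w g)%g.
Proof.
move=> pf pg; rewrite -loop_class_conc; do ?exact: path_class_path.
apply/loop_class_eq; first exact: path_class_path (conc_path pf pg).
  by apply: conc_path; exact: path_class_path.
have [py pz pw] := And3 (pd y) (pd z) (pd w).
have [iz iw] := (inv_path_path pz, inv_path_path pw).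
have pP := conc_path py pf.
apply: hpath_sym; apply: hpath_trans (hpath_sym (concA pP iz (conc_path (conc_path pz pg) iw))) _.
have e1 : hpath z x0 (conc (inv_path (d z)) (conc (conc (d z) g) (inv_path (d w))))
  (conc g (inv_path (d w))).
  have gw := conc_path pg iw.
  apply: hpath_trans (hpath_conc (hpath_refl iz) (hpath_sym (concA pz pg iw))) _.
  apply: hpath_trans (concA iz pz gw) _.
  apply: hpath_trans (hpath_conc (conc_inv_l pz) (hpath_refl gw)) _.
  exact: conc_cst_l gw.
apply: hpath_trans (hpath_conc (hpath_refl pP) e1) _.
apply: hpath_trans (concA pP pg iw) _.
apply: hpath_conc (hpath_refl iw).
exact: hpath_sym (concA py pf pg).
Qed.

Lemma path_class_cst y : path_class y y (fun=> y) = 1%g.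
Proof.
have pc := @cst_is_path R T y.
have := path_class_conc pc pc; rewrite (_ : conc _ _ = fun=> y).
  by move=> /(congr1 (fun a => (path_class y y (fun=> y))^-1 * a)%g); rewrite mulVg mulKg.
by apply/funext => t; rewrite /conc if_same.
Qed.

Lemma path_class_loop f : is_path x0 x0 f -> path_class x0 x0 f = loop_class f.
Proof.
move=> pf; have pc := @cst_is_path R T x0.
have ic : inv_path (d x0) = fun=> x0 by rewrite d0; apply/funext.
rewrite /path_class ic d0 (loop_class_conc (conc_path pc pf) pc) (loop_class_conc pc pf).
by rewrite loop_class_cst mul1g mulg1.
Qed.

(** The two halves of the boundary of a rectangle are homotopic in the plane, and [F] carries the
    homotopy over. *)
Lemma path_class_square (F : R * R -> T) a b c e : continuous F ->
  (path_class (F (a, c)) (F (b, c)) (fun t => F (a + (b - a) * unit_clamp t, c)) *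
   path_class (F (b, c)) (F (b, e)) (fun t => F (b, c + (e - c) * unit_clamp t)) =
   path_class (F (a, c)) (F (a, e)) (fun t => F (a, c + (e - c) * unit_clamp t)) *
   path_class (F (a, e)) (F (b, e)) (fun t => F (a + (b - a) * unit_clamp t, e)))%g.
Proof.
move=> cF.
have ph a' b' c' : is_path (F (a', c')) (F (b', c'))
    (fun t => F (a' + (b' - a') * unit_clamp t, c')).
  split; first by apply: (cont_compRR _ _ cF); ctac.
    by move=> t t0; rewrite unit_clamp_le0 // mulr0 addr0.
  by move=> t t1; rewrite unit_clamp_ge1 // mulr1 addrC subrK.
have pv a' b' c' : is_path (F (c', a')) (F (c', b'))
    (fun t => F (c', a' + (b' - a') * unit_clamp t)).
  split; first by apply: (cont_compRR _ _ cF); ctac.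
    by move=> t t0; rewrite unit_clamp_le0 // mulr0 addr0.
  by move=> t t1; rewrite unit_clamp_ge1 // mulr1 addrC subrK.
rewrite -!path_class_conc //; apply: path_class_eq.
- exact: conc_path (ph _ _ _) (pv _ _ _).
- exact: conc_path (pv _ _ _) (ph _ _ _).
pose p t := a + (b - a) * unit_clamp (2 * t).
pose p' t := c + (e - c) * unit_clamp (2 * t - 1).
pose q t := a + (b - a) * unit_clamp (2 * t - 1).
pose q' t := c + (e - c) * unit_clamp (2 * t).
have -> : conc (fun t => F (a + (b - a) * unit_clamp t, c))
    (fun t => F (b, c + (e - c) * unit_clamp t)) = fun t => F (p t, p' t).
  apply/funext => t; rewrite /conc /p /p'; case: leP => t2.
    by rewrite [unit_clamp (2 * t - 1)]unit_clamp_le0 ?mulr0 ?addr0 //; lra.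
  by rewrite [unit_clamp (2 * t)]unit_clamp_ge1 ?mulr1 ?[a + _]addrC ?subrK //; lra.
have -> : conc (fun t => F (a, c + (e - c) * unit_clamp t))
    (fun t => F (a + (b - a) * unit_clamp t, e)) = fun t => F (q t, q' t).
  apply/funext => t; rewrite /conc /q /q'; case: leP => t2.
    by rewrite [unit_clamp (2 * t - 1)]unit_clamp_le0 ?mulr0 ?addr0 //; lra.
  by rewrite [unit_clamp (2 * t)]unit_clamp_ge1 ?mulr1 ?[c + _]addrC ?subrK //; lra.
apply: hpath_plane => //; rewrite /p /p' /q /q'; do ?by ctac.
- by move=> t t0; rewrite !unit_clamp_le0 ?mulr0 ?addr0 //; lra.
- move=> t t0; rewrite !unit_clamp_ge1 ?mulr1; try lra.
  by split; rewrite addrC subrK.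
Qed.

End BasePaths.

End LoopClass.

(** * Edge cocycles *)

Section Cocycles.
Local Open Scope group_scope.
Variables (V : finType) (K : {set {set V}}).

(** Vertices may coincide: degenerate triangles encode h u u = 1 and h v u = (h u v)^-1. *)
Definition cocycle (H : groupType) (h : V -> V -> H) :=
  forall u v w, [set u; v; w]%SET \in K -> h u v * h v w = h u w.

Lemma cocycle11 (H : groupType) (h : V -> V -> H) u :
  cocycle h -> [set u]%SET \in K -> h u u = 1.
Proof.
move=> ch Ku; have := ch u u u; rewrite !finset.setUid => /(_ Ku).
by move=> /(congr1 (fun a => (h u u)^-1 * a)); rewrite mulKg mulVg.
Qed.

Lemma cocycle_inv (H : groupType) (h : V -> V -> H) u v :
  cocycle h -> [set u]%SET \in K -> [set u; v]%SET \in K -> h v u = (h u v)^-1.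
Proof.
move=> ch Ku Kuv; have := ch u v u; rewrite finset.setUC finset.setUA finset.setUid.
move=> /(_ Kuv); rewrite (cocycle11 ch Ku) => e.
by rewrite -[RHS]mulg1 -e mulKg.
Qed.

(* [(G, g)] represents the fundamental group of [K] based at [v0] together with
   the classes of its edges. *)
Definition universal (v0 : V) (G : groupType) (g : V -> V -> G) :=
  [/\ cocycle g,
    forall (H : groupType) (h : V -> V -> H), cocycle h ->
      exists (phi : G -> H) (c : V -> H), {morph phi : x y / x * y} /\
        forall u v, [set u; v]%SET \in K -> h u v = (c u)^-1 * phi (g u v) * c v
  & forall (H : groupType) (phi psi : G -> H) (c : V -> H),
      {morph phi : x y / x * y} -> {morph psi : x y / x * y} -> c v0 = 1 ->
      (forall u v, [set u; v]%SET \in K -> psi (g u v) = (c u)^-1 * phi (g u v) * c v) ->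
      phi =1 psi].

End Cocycles.

(** * Geometric realizations *)

Section Intervals.
Variable R : realType.

(** The supremum of the points reached from [a] is itself reached, and cannot lie before [b]. This
    is the form in which compactness is used below. *)
Lemma interval_induction (Q : R -> R -> Prop) (a b : R) : a <= b ->
  (forall x y z, a <= x -> x <= y -> y <= z -> z <= b -> Q x y -> Q y z -> Q x z) ->
  (forall t, a <= t -> t <= b -> exists2 e, 0 < e & forall x y, t - e < x -> x <= y ->
    y < t + e -> a <= x -> y <= b -> Q x y) ->
  Q a b.
Proof.
move=> ab Qt Ql.
pose S := [set t | a <= t <= b /\ Q a t].
have Sa : S a.
  split; first by rewrite lexx.
  by have [e e0] := Ql a (lexx _) ab; apply; lra.
have Sb : ubound S b by move=> t [/andP[]].
have hS : has_sup S by split; [exists a|exists b].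
pose c := sup S.
have ac : a <= c by apply: ub_le_sup => //; exists b.
have cb : c <= b by apply: ge_sup => //; exists a.
have [e e0 Qe] := Ql c ac cb.
have [s Ss cs] := sup_adherent e0 hS; case: Ss => /andP[as_ sb] Qas.
have sc : s <= c by apply: ub_le_sup; [exists b|split => //; rewrite as_].
have Qy y : s <= y -> y < c + e -> y <= b -> Q a y.
  by move=> sy yc yb; apply: (Qt a s y) => //; apply: Qe => //; rewrite /c; lra.
have [cb'|] := ltP c b; last by move=> bc; apply: Qy; lra.
pose y := Num.min b (c + e / 2).
have [yb ye] : y <= b /\ y <= c + e / 2 by rewrite !ge_min !lexx orbT.
have cy : c < y by rewrite lt_min cb' /=; lra.
have : y <= c.
  by apply: ub_le_sup; [exists b|split; [lra|apply: Qy; lra]].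
lra.
Qed.

Lemma nearR (t : R) (P : R -> Prop) : (\forall s \near t, P s) ->
  exists2 e, 0 < e & forall s, t - e < s -> s < t + e -> P s.
Proof.
move=> /nbhs_ballP[e e0 eP]; exists e => // s s1 s2; apply: eP.
by rewrite /ball /= ltr_norml; lra.
Qed.

Lemma nearRR (z : R * R) (P : R * R -> Prop) : (\forall s \near z, P s) ->
  exists2 e, 0 < e & forall s, z.1 - e < s.1 -> s.1 < z.1 + e ->
    z.2 - e < s.2 -> s.2 < z.2 + e -> P s.
Proof.
move=> [[A B] [/= /nearR[e e0 eA] /nearR[d d0 dB] AB]].
exists (Num.min e d) => [|s]; first by rewrite lt_min e0.
have [me md] : Num.min e d <= e /\ Num.min e d <= d by rewrite !ge_min !lexx orbT.
move=> h1 h2 h3 h4; apply: AB; split => /=; [apply: eA|apply: dB]; lra.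
Qed.

Lemma locally_constant (A : Type) (f : R -> A) (a b : R) : a <= b ->
  (forall t, a <= t <= b -> \forall s \near t, a <= s <= b -> f s = f t) -> f a = f b.
Proof.
move=> ab fl; apply: (@interval_induction (fun x y => f x = f y)) => //.
  by move=> x y z _ _ _ _ -> ->.
move=> t at_ tb; have [|e e0 eP] := nearR (fl t _); first by rewrite at_.
exists e => // x y h1 h2 h3 h4 h5.
by rewrite (eP x) ?(eP y) //; lra.
Qed.

End Intervals.

Section Realization.
Variables (R : realType) (V : finType) (K : {set {set V}}).
Hypothesis Ksub : forall s t : {set V}, s \in K -> t != finset.set0 -> t \subset s -> t \in K.
Local Notation T := (set_type (geometric_realization R K)).

Definition bary (x : T) (v : V) : R := (set_val x : V -> R) v.
Definition supp (x : T) : {set V} := [set v | bary x v != 0]%SET.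

Lemma bary_ge0 x v : 0 <= bary x v.
Proof. by have [h _ _] := set_valP x; exact: h. Qed.

Lemma bary_sum x : \sum_v bary x v = 1.
Proof. by have [_ h _] := set_valP x. Qed.

Lemma supp_in x : supp x \in K.
Proof. by have [_ _ h] := set_valP x. Qed.

Lemma supp_neq0 x : supp x != finset.set0.
Proof.
apply/negP => /eqP s0; have := bary_sum x; rewrite big1 => [|v _].
  by move=> /esym/eqP; rewrite oner_eq0.
by apply/eqP/negbNE; move/setP: s0 => /(_ v); rewrite !inE => ->.
Qed.

Lemma supp_ex x : exists v, v \in supp x.
Proof. by have /set0Pn := supp_neq0 x. Qed.

Definition svertex x : V := xchoose (supp_ex x).

Lemma svertexP x : svertex x \in supp x.
Proof. exact: xchooseP. Qed.

Lemma sub_supp (s : {set V}) x : s != finset.set0 -> s \subset supp x -> s \in K.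
Proof. exact: Ksub (supp_in x). Qed.

Lemma set2_neq0 (u v : V) : [set u; v]%SET != finset.set0.
Proof. by apply/set0Pn; exists u; rewrite !inE eqxx. Qed.

Lemma set3_neq0 (u v w : V) : [set u; v; w]%SET != finset.set0.
Proof. by apply/set0Pn; exists u; rewrite !inE eqxx. Qed.

Lemma bary_inj x y : bary x =1 bary y -> x = y.
Proof. by move=> e; apply: val_inj; apply/funext. Qed.

Lemma bary_continuous v : continuous (fun x : T => bary x v).
Proof.
move=> x; apply: (@continuous_comp _ _ _ (set_val : T -> {ptws V -> R}) (fun a => a v)).
  exact: initial_continuous.
exact: (@proj_continuous V (fun=> R) v).
Qed.

Lemma to_realization (X : topologicalType) (f : X -> T) :
  (forall v, continuous (fun x => bary (f x) v)) -> continuous f.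
Proof.
move=> cf; apply: continuous_comp_initial => x; apply/cvg_sup => v.
move=> U [? /= [[W oW <-]]] /= Wfx /filterS; apply.
by apply: (cf v x); exact: open_nbhs_nbhs.
Qed.

Definition mix (x y : T) (s : R) : {ptws V -> R} :=
  fun v => (1 - s) * bary x v + s * bary y v.

Lemma mix_in x y s : 0 <= s <= 1 -> supp x :|: supp y \in K ->
  mix x y s \in geometric_realization R K.
Proof.
move=> /andP[s0 s1] Kxy; rewrite inE.
have mix1 : \sum_v mix x y s v = 1.
  by rewrite big_split /= -!mulr_sumr !bary_sum !mulr1 subrK.
split=> //.
  by move=> v; rewrite addr_ge0 // mulr_ge0 ?bary_ge0 //; lra.
apply: Ksub Kxy _ _.
  apply/set0Pn; apply: contrapT => h; move: mix1; rewrite big1 => [|v _].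
    by move=> /esym/eqP; rewrite oner_eq0.
  by apply/eqP; apply: contrapT => /negP hv; apply: h; exists v; rewrite inE.
apply/fintype.subsetP => v; rewrite !inE; apply: contraNT.
by rewrite negb_or !negbK /mix => /andP[/eqP-> /eqP->]; rewrite !mulr0 addr0.
Qed.

(* The point dividing the segment from [x] to [y]; it is [x] if the segment does not lie in [K]. *)
Definition mixpt (x y : T) (s : R) : T := insubd x (mix x y s).

Lemma bary_mixpt x y s v : 0 <= s <= 1 -> supp x :|: supp y \in K ->
  bary (mixpt x y s) v = (1 - s) * bary x v + s * bary y v.
Proof. by move=> s01 Kxy; rewrite /bary /mixpt set_valE insubdK //; exact: mix_in. Qed.

Lemma supp_mixpt x y s : supp (mixpt x y s) \subset supp x :|: supp y.
Proof.
rewrite /mixpt /insubd; case: insubP => [z _ zE|_] /=; last exact: finset.subsetUl.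
have cz v : bary z v = mix x y s v by rewrite /bary set_valE zE.
apply/fintype.subsetP => v; rewrite !inE cz; apply: contraNT.
by rewrite negb_or !negbK /mix => /andP[/eqP-> /eqP->]; rewrite !mulr0 addr0.
Qed.

Lemma mixpt_xx x s : 0 <= s <= 1 -> mixpt x x s = x.
Proof.
move=> s01; apply: bary_inj => v.
by rewrite bary_mixpt ?finset.setUid ?supp_in //; ring.
Qed.

Lemma mixpt0 x y : supp x :|: supp y \in K -> mixpt x y 0 = x.
Proof.
by move=> Kxy; apply: bary_inj => v; rewrite bary_mixpt ?lexx ?ler01 //; ring.
Qed.

Lemma mixpt1 x y : supp x :|: supp y \in K -> mixpt x y 1 = y.
Proof.
by move=> Kxy; apply: bary_inj => v; rewrite bary_mixpt ?lexx ?ler01 //; ring.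
Qed.

Lemma mixpt_continuous (X : topologicalType) (f g : X -> T) (s : X -> R) :
  continuous f -> continuous g -> continuous s ->
  (forall x, supp (f x) :|: supp (g x) \in K) ->
  continuous (fun x => mixpt (f x) (g x) (unit_clamp (s x))).
Proof.
move=> cf cg cs Kfg; apply: to_realization => v.
have -> : (fun x => bary (mixpt (f x) (g x) (unit_clamp (s x))) v) =
  fun x => (1 - unit_clamp (s x)) * bary (f x) v + unit_clamp (s x) * bary (g x) v.
  by apply/funext => x; rewrite bary_mixpt ?unit_clamp_bound.
have cfv := cont_comp cf (@bary_continuous v); have cgv := cont_comp cg (@bary_continuous v).
by ctac.
Qed.

(** The straight-line homotopy: at each time the two points lie in a common simplex. *)
Lemma hpath_straight x y (f g : R -> T) : is_path x y f -> is_path x y g ->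
  (forall t, supp (f t) :|: supp (g t) \in K) -> hpath x y f g.
Proof.
move=> [cf f0 f1] [cg g0 g1] Kfg.
exists (fun u : R * R => mixpt (f u.1) (g u.1) (unit_clamp u.2)); split => /=.
- by apply: mixpt_continuous; [exact: comp_fst|exact: comp_fst|exact: cont_snd|].
- by move=> t; rewrite unit_clamp_le0 // mixpt0.
- by move=> t; rewrite unit_clamp_ge1 // mixpt1.
- by move=> t s t0; rewrite f0 // g0 // mixpt_xx ?unit_clamp_bound.
- by move=> t s t0; rewrite f1 // g1 // mixpt_xx ?unit_clamp_bound.
Qed.

Definition seg x y (t : R) : T := mixpt x y (unit_clamp t).

Lemma seg_path x y : supp x :|: supp y \in K -> is_path x y (seg x y).
Proof.
move=> Kxy; split.
- by apply: (@mixpt_continuous R (fun=> x) (fun=> y) (fun t => t)); try exact: cst_continuous;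
    move=> t //; exact: cvg_id.
- by move=> t t0; rewrite /seg unit_clamp_le0 // mixpt0.
- by move=> t t0; rewrite /seg unit_clamp_ge1 // mixpt1.
Qed.

Lemma seg_xx x : seg x x = fun=> x.
Proof. by apply/funext => t; rewrite /seg mixpt_xx ?unit_clamp_bound. Qed.

Variable x0 : T.

Lemma vertex_in (v : V) : [set v]%SET \in K ->
  ((fun u => (u == v)%:R) : {ptws V -> R}) \in geometric_realization R K.
Proof.
move=> Kv; rewrite inE; split.
- by move=> u; exact: ler0n.
- by rewrite (bigD1 v) //= eqxx big1 ?addr0 // => u /negbTE ->.
- rewrite (_ : finset _ = [set v]%SET) //.
  by apply/setP => u; rewrite !inE pnatr_eq0 eqb0 negbK.
Qed.

(* The default [x0] is only taken when [v] is not a vertex of [K]. *)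
Definition vpt (v : V) : T := insubd x0 ((fun u => (u == v)%:R) : {ptws V -> R}).

Lemma supp_vpt v : [set v]%SET \in K -> supp (vpt v) = [set v]%SET.
Proof.
move=> Kv; apply/setP => u; rewrite !inE /bary /vpt set_valE insubdK; last exact: vertex_in.
by rewrite pnatr_eq0 eqb0 negbK.
Qed.

End Realization.

(** * Coverings and holonomy *)

Section Sections.
Local Open Scope group_scope.
Variables (R : realType) (V : finType) (K : {set {set V}}).
Hypothesis Ksub : forall s t : {set V}, s \in K -> t != finset.set0 -> t \subset s -> t \in K.
Local Notation T := (set_type (geometric_realization R K)).
Variables (H : groupType) (h : V -> V -> H).
Hypothesis ch : cocycle K h.

Lemma supp1 (x : T) v : v \in supp x -> [set v]%SET \in K.
Proof.
move=> vx; apply: (sub_supp Ksub) (_ : [set v]%SET \subset supp x).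
  by apply/set0Pn; exists v; rewrite inE.
by rewrite finset.sub1set.
Qed.

Lemma supp2 (x : T) u v : u \in supp x -> v \in supp x -> [set u; v]%SET \in K.
Proof.
move=> ux vx; apply: (sub_supp Ksub (set2_neq0 u v) (x := x)).
by rewrite finset.subUset !finset.sub1set ux.
Qed.

Lemma supp3 (x : T) u v w : u \in supp x -> v \in supp x -> w \in supp x ->
  [set u; v; w]%SET \in K.
Proof.
move=> ux vx wx; apply: (sub_supp Ksub (set3_neq0 u v w) (x := x)).
by rewrite !finset.subUset !finset.sub1set ux vx.
Qed.

(* A section over [D] of the pull-back along [F] of the covering of [K] defined
   by [h]: the covering is trivial over each open star. *)
Definition is_section (X : topologicalType) (F : X -> T) (D : set X) (L : V -> X -> H) :=
  (forall z u v, D z -> u \in supp (F z) -> v \in supp (F z) -> L u z * h u v = L v z) /\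
  (forall z v, D z -> v \in supp (F z) -> \forall z' \near z, D z' -> L v z' = L v z).

Lemma is_section_comp (X Y : topologicalType) (F : X -> T) (D : set X) L
    (p : Y -> X) (E : set Y) :
  continuous p -> (forall y, E y -> D (p y)) -> is_section F D L ->
  is_section (fun y => F (p y)) E (fun v y => L v (p y)).
Proof.
move=> cp pD [L1 L2]; split=> [z u v Ez|z v Ez vz]; first exact: L1 (pD _ Ez).
have := cp z _ (L2 (p z) v (pD _ Ez) vz); rewrite /= !nbhs_simpl /=.
by apply: filterS => z' /= h1 Ez'; apply: h1; exact: pD.
Qed.

Lemma is_section_sub (X : topologicalType) (F : X -> T) (D E : set X) L :
  (forall y, E y -> D y) -> is_section F D L -> is_section F E L.
Proof. by move=> ED; apply: (is_section_comp (p := fun x => x)) => //; exact: cont_id. Qed.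

Lemma near_supp (X : topologicalType) (F : X -> T) z v : continuous F ->
  v \in supp (F z) -> \forall z' \near z, v \in supp (F z').
Proof.
move=> cF; rewrite inE => vz.
have := cont_comp cF (@bary_continuous R V K v) (x := z).
move=> /(_ (~` [set 0]%R)) /=; rewrite nbhs_simpl /=.
have o0 : open (~` [set (0 : R)])%R.
  by rewrite openC; apply: accessible_closed_set1; apply: hausdorff_accessible; exact: Rhausdorff.
move=> /(_ (open_nbhs_nbhs (conj o0 _))) h0.
have : \forall z' \near z, (~` [set 0]%R) (bary (F z') v) by apply: h0; move/eqP: vz.
by apply: filterS => z' /= /eqP; rewrite inE.
Qed.

(* The ratio of two sections does not depend on the vertex. *)
Lemma section_ratio (X : topologicalType) (F : X -> T) (D E : set X) L L' z u v :
  is_section F D L -> is_section F E L' -> D z -> E z ->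
  u \in supp (F z) -> v \in supp (F z) -> L u z * (L' u z)^-1 = L v z * (L' v z)^-1.
Proof.
move=> [L1 _] [L1' _] Dz Ez uz vz.
by rewrite -(L1 z u v) // -(L1' z u v) // invgM !mulgA mulgK.
Qed.

Lemma section_ratio_cst (F : R -> T) (a b : R) L L' u v : continuous F -> (a <= b)%R ->
  is_section F [set t | a <= t <= b]%R L -> is_section F [set t | a <= t <= b]%R L' ->
  u \in supp (F a) -> v \in supp (F b) ->
  L u a * (L' u a)^-1 = L v b * (L' v b)^-1.
Proof.
move=> cF ab sL sL' ua vb.
(* The chosen vertex jumps with [t], but the ratio is the same at all vertices of the support, so
   [f] is locally constant. *)
pose f t := L (svertex (F t)) t * (L' (svertex (F t)) t)^-1.
have aa : (a <= a <= b)%R by rewrite lexx.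
have bb : (a <= b <= b)%R by rewrite lexx ab.
rewrite (section_ratio sL sL' aa aa ua (svertexP _)).
rewrite (section_ratio sL sL' bb bb vb (svertexP _)) -/(f a) -/(f b).
apply: locally_constant => // t tab.
have [_ L2] := sL; have [_ L2'] := sL'.
have h1 := L2 t _ tab (svertexP (F t)); have h2 := L2' t _ tab (svertexP (F t)).
have h3 := near_supp cF (svertexP (F t)).
near=> s => sab; rewrite /f (section_ratio sL sL' sab sab (svertexP _) (v := svertex (F t))).
  have -> : L (svertex (F t)) s = L (svertex (F t)) t by move: sab; near: s.
  by have -> : L' (svertex (F t)) s = L' (svertex (F t)) t by move: sab; near: s.
by near: s.
Unshelve. all: by end_near.
Qed.

Lemma section_transport (F : R -> T) (a b : R) L L' u v : continuous F -> (a <= b)%R ->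
  is_section F [set t | a <= t <= b]%R L -> is_section F [set t | a <= t <= b]%R L' ->
  u \in supp (F a) -> v \in supp (F b) -> (L u a)^-1 * L v b = (L' u a)^-1 * L' v b.
Proof.
move=> cF ab sL sL' ua vb; have e := section_ratio_cst cF ab sL sL' ua vb.
apply: (mulgI (L u a)); rewrite mulKVg mulgA e mulgKV.
by [].
Qed.

(** The overlap is the image of a path, so the two sections differ there by a constant; left
    multiplication of [L'] by it makes them agree. *)
Lemma section_glue (X : topologicalType) (F : X -> T) (D E : set X) L L' (p : R -> X) :
  continuous F -> continuous p -> closed D -> closed E ->
  (forall t, 0 <= t <= 1 -> D (p t) /\ E (p t))%R ->
  (forall z, D z -> E z -> exists2 t, (0 <= t <= 1)%R & z = p t) ->
  is_section F D L -> is_section F E L' -> exists L'', is_section F (D `|` E) L''.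
Proof.
move=> cF cp cD cE pDE DEp sL sL'.
pose v0 := svertex (F (p 0%R)); pose a := L v0 (p 0%R) * (L' v0 (p 0%R))^-1.
have aE z u : D z -> E z -> u \in supp (F z) -> L u z = a * L' u z.
  move=> Dz Ez uz; have [t /andP[t0 t1] zt] := DEp z Dz Ez; subst z.
  have h1 : is_section (fun t => F (p t)) [set s | 0 <= s <= t]%R (fun v t => L v (p t)).
    by apply: is_section_comp sL => // s /= /andP[s0 s1]; apply: (pDE s _).1; lra.
  have h2 : is_section (fun t => F (p t)) [set s | 0 <= s <= t]%R (fun v t => L' v (p t)).
    by apply: is_section_comp sL' => // s /= /andP[s0 s1]; apply: (pDE s _).2; lra.
  have := section_ratio_cst (cont_comp cp cF) t0 h1 h2 (svertexP _) uz.
  by rewrite -/v0 -/a => ->; rewrite mulgKV.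
have [L1 L2] := sL; have [L1' L2'] := sL'.
exists (fun v z => if pselect (D z) then L v z else a * L' v z); split.
  move=> z u v DEz uz vz; case: pselect => Dz; first exact: L1.
  by rewrite -mulgA L1' //; case: DEz.
move=> z v DEz vz; have vnear := near_supp cF vz.
case: pselect => Dz.
  have h1 := L2 z v Dz vz; case: (pselect (E z)) => Ez.
    have h2 := L2' z v Ez vz; near=> z' => DEz'; case: pselect => Dz'; first by move: Dz' {DEz'}; near: z'.
    rewrite (aE z v) //; congr (_ * _).
    have : E z' -> L' v z' = L' v z by move=> {DEz' Dz'}; near: z'.
    by apply; case: DEz'.
  have h2 : \forall z' \near z, (~` E) z' by apply: open_nbhs_nbhs; split => //; rewrite openC.
  near=> z' => DEz'; case: pselect => Dz'; first by move: Dz' {DEz'}; near: z'.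
  have : (~` E) z' by move=> {DEz' Dz'}; near: z'.
  by case: DEz'.
have Ez : E z by case: DEz.
have h1 := L2' z v Ez vz.
have h2 : \forall z' \near z, (~` D) z' by apply: open_nbhs_nbhs; split => //; rewrite openC.
near=> z' => DEz'; case: pselect => Dz'.
  by have : (~` D) z' by move=> {DEz' Dz'}; near: z'.
congr (_ * _); have : E z' -> L' v z' = L' v z by move=> {DEz' Dz'}; near: z'.
by apply; case: DEz'.
Unshelve. all: by end_near.
Qed.

(** Over the open star of [v] the covering is trivialized by [h v]. *)
Lemma section_star (X : topologicalType) (F : X -> T) (D : set X) v :
  (forall z, D z -> v \in supp (F z)) -> exists L, is_section F D L.
Proof.
move=> Dv; exists (fun u _ => h v u); split.
  by move=> z u w Dz uz wz; apply: ch; apply: (@supp3 (F z)) => //; exact: Dv.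
by move=> z w _ _; near=> z' => _.
Unshelve. all: by end_near.
Qed.

Definition rect (a b c d : R) : set (R * R) :=
  [set z | (a <= z.1 <= b)%R /\ (c <= z.2 <= d)%R].

Lemma rect_closed a b c d : closed (rect a b c d).
Proof.
have -> : rect a b c d = ((fst @^-1` `[a, b]) `&` (snd @^-1` `[c, d]))%classic.
  by rewrite eqEsubset; split=> z /=; rewrite /rect /= !in_itv.
apply: closedI.
  by apply: preimage_closed; [move=> z _; exact: cont_fst|exact: itv_closed].
by apply: preimage_closed; [move=> z _; exact: cont_snd|exact: itv_closed].
Qed.

(** Small rectangles are mapped into stars; they are glued to thin horizontal strips, and the strips
    to the square. *)
Lemma section_square (F : R * R -> T) : continuous F ->
  exists L, is_section F (rect 0 1 0 1) L.
Proof.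
move=> cF.
apply: (@interval_induction R (fun c d => exists L, is_section F (rect 0 1 c d) L)) => //.
- move=> x y z x0 xy yz z1 [L sL] [L' sL'].
  have := section_glue (p := fun t => (t, y)) cF _ (@rect_closed 0 1 x y) (@rect_closed 0 1 y z) _ _ sL sL'.
  case.
  + by apply: cont_pair; [exact: cont_id|exact: cst_continuous].
  + by move=> t t01; rewrite /rect /= !lexx xy yz.
  + move=> u [u1 u2] [_ u3]; exists u.1 => //; case: u u1 u2 u3 => u1 u2 /= _ h1 h2.
    by congr pair; lra.
  move=> L'' sL''; exists L''; apply: is_section_sub sL'' => u [u1 u2].
  by case: (leP u.2 y) => uy; [left|right]; split=> //; lra.
move=> y y0 y1.
(* The height [e] shrinks at each gluing, hence its place inside [Q]. *)
pose Q a b := exists2 e : R, (0 < e)%R & forall c d, (y - e < c)%R -> (c <= d)%R -> (d < y + e)%R ->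
  exists L, is_section F (rect a b c d) L.
have [e e0 Qe] : Q 0%R 1%R.
  apply: (@interval_induction R Q) => //.
    move=> a b c a0 ab bc c1 [e e0 eP] [f f0 fP].
    exists (Num.min e f); first by rewrite lt_min e0.
    have [me mf] : (Num.min e f <= e)%R /\ (Num.min e f <= f)%R by rewrite !ge_min !lexx orbT.
    move=> s t h1 st h2.
    have [|||L sL] := eP s t; try lra.
    have [|||L' sL'] := fP s t; try lra.
    pose p (r : R) : R * R := (b, s + (t - s) * r)%R.
    have := section_glue (p := p) cF _ (@rect_closed a b s t) (@rect_closed b c s t) _ _ sL sL'.
    case.
    + by apply: cont_pair; [exact: cst_continuous|ctac].
    + move=> r /andP[r0 r1]; rewrite /rect /p /= !lexx ab bc.
      have [h3 h4] : (s <= s + (t - s) * r)%R /\ (s + (t - s) * r <= t)%R by split; nra.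
      by rewrite h3 h4.
    + move=> [u1 u2] [/= h3 h4] [/= h5 _].
      have {h3 h5} -> : u1 = b by lra.
      (* For a strip of height zero the overlap is a single point and the quotient below makes no
         sense. *)
      case: (ltgtP s t) st => // [st _|st _].
        exists ((u2 - s) / (t - s))%R.
          rewrite divr_ge0 ?ler_pdivrMr; lra.
        by rewrite /p; congr pair; field; lra.
      by exists 0%R; [rewrite lexx ler01|rewrite /p; congr pair; lra].
    move=> L'' sL''; exists L''; apply: is_section_sub sL'' => u [u1 u2].
    by case: (leP u.1 b) => ub; [left|right]; split=> //; lra.
  move=> x x0 x1.
  have [e e0 eP] := nearRR (near_supp cF (svertexP (F (x, y)))).
  exists e => // a b h1 h2 h3 h4 h5; exists e => // c d h6 h7 h8.
  apply: (@section_star _ _ _ (svertex (F (x, y)))) => z [/andP[z1 z2] /andP[z3 z4]].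
  by apply: eP => /=; lra.
by exists e => // c d h1 h2 h3 _ _; exact: Qe.
Qed.

Lemma section_segment (F : R -> T) : continuous F ->
  exists L, is_section F [set t | 0 <= t <= 1]%R L.
Proof.
move=> cF; have [L sL] := section_square (cont_comp (@cont_fst R R) cF).
exists (fun v t => L v (t, 0%R)).
apply: (is_section_comp (F := fun u : R * R => F u.1) (p := fun t : R => (t, 0%R))) sL.
  by apply: cont_pair; [exact: cont_id|exact: cst_continuous].
by move=> t t01; rewrite /rect /= t01 lexx ler01.
Qed.

(** Independent of the chosen section by [section_transport]; continuous paths never reach the
    default 1. *)
Definition holonomy (u v : V) (f : R -> T) : H :=
  if pselect (exists L, is_section f [set t | 0 <= t <= 1]%R L) is left ex
  then let L := projT1 (cid ex) in (L u 0%R)^-1 * L v 1%R else 1.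

Lemma holonomyE (f : R -> T) L u v : continuous f -> u \in supp (f 0%R) -> v \in supp (f 1%R) ->
  is_section f [set t | 0 <= t <= 1]%R L -> holonomy u v f = (L u 0%R)^-1 * L v 1%R.
Proof.
move=> cf u0 v1 sL; rewrite /holonomy; case: pselect => [ex|[]]; last by exists L.
by case: cid => L' /= sL'; exact: section_transport.
Qed.

Lemma is_section_ext (X : topologicalType) (F F' : X -> T) (D : set X) L :
  (forall z, D z -> F z = F' z) -> is_section F D L -> is_section F' D L.
Proof.
move=> FF' [L1 L2]; split=> [z u v Dz|z v Dz]; rewrite -FF' //; [exact: L1|exact: L2].
Qed.

Lemma is_section_line (X : topologicalType) (F : X -> T) (D : set X) L (p : R -> X) (f : R -> T) :
  is_section F D L -> continuous p -> (forall t, 0 <= t <= 1 -> D (p t))%R ->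
  (forall t, 0 <= t <= 1 -> F (p t) = f t)%R ->
  is_section f [set t | 0 <= t <= 1]%R (fun v t => L v (p t)).
Proof.
by move=> sL cp pD Ff; apply: is_section_ext (is_section_comp cp _ sL).
Qed.

Lemma holonomy_path x y (f : R -> T) L u v : is_path x y f -> u \in supp x -> v \in supp y ->
  is_section f [set t | 0 <= t <= 1]%R L -> holonomy u v f = (L u 0%R)^-1 * L v 1%R.
Proof.
by move=> [cf f0 f1] ux vy sL; apply: holonomyE => //; [rewrite f0|rewrite f1].
Qed.

Lemma holonomy_conc x y z (f g : R -> T) u v w : is_path x y f -> is_path y z g ->
  u \in supp x -> v \in supp y -> w \in supp z ->
  holonomy u w (conc f g) = holonomy u v f * holonomy v w g.
Proof.
move=> pf pg ux vy wz; have [cfg fg0 fg1] := conc_path pf pg.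
have [cf f0 f1] := pf; have [cg g0 g1] := pg.
have [L sL] := section_segment cfg.
have sf : is_section f [set t | 0 <= t <= 1]%R (fun v t => L v (2^-1 * t)%R).
  apply: (is_section_line (p := fun t : R => (2^-1 * t)%R)) sL _ _ _; first by ctac.
    by move=> t /= /andP[t0 t1]; apply/andP; split; lra.
  by move=> t /= /andP[t0 t1]; rewrite /conc ifT; [congr f; field|lra].
have sg : is_section g [set t | 0 <= t <= 1]%R (fun v t => L v (2^-1 * t + 2^-1)%R).
  apply: (is_section_line (p := fun t : R => (2^-1 * t + 2^-1)%R)) sL _ _ _; first by ctac.
    by move=> t /= /andP[t0 t1]; apply/andP; split; lra.
  move=> t /= /andP[t0 t1]; rewrite /conc; case: ifPn => t2; last by congr g; field.
  have -> : t = 0%R by lra.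
  by rewrite g0 ?f1 //; lra.
rewrite (holonomy_path (conc_path pf pg) ux wz sL) (holonomy_path pf ux vy sf).
rewrite (holonomy_path pg vy wz sg) !mulr0 !add0r !mulr1.
have -> : (2^-1 + 2^-1 = 1 :> R)%R by lra.
by rewrite -mulgA mulKVg.
Qed.

(** A section over the square of the homotopy restricts to both paths, and is constant along the two
    sides where the homotopy stands still. *)
Lemma holonomy_hpath x y (f g : R -> T) u v : is_path x y f -> is_path x y g ->
  hpath x y f g -> u \in supp x -> v \in supp y -> holonomy u v f = holonomy u v g.
Proof.
move=> pf pg [F [cF F0 F1 Fx Fy]] ux vy.
have [L sL] := section_square cF.
have l0 : (0 <= (0 : R) <= 1)%R by rewrite lexx ler01.
have l1 : (0 <= (1 : R) <= 1)%R by rewrite lexx ler01.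
pose p (r t : R) : R * R := (t, r).
have cp r : continuous (p r) by apply: cont_pair; [exact: cont_id|exact: cst_continuous].
have sf : is_section f [set t | 0 <= t <= 1]%R (fun v t => L v (p 0%R t)).
  by apply: (is_section_line (p := p 0%R)) sL _ _ _ => [|t t01|t _]; [exact: cp|split|exact: F0].
have sg : is_section g [set t | 0 <= t <= 1]%R (fun v t => L v (p 1%R t)).
  by apply: (is_section_line (p := p 1%R)) sL _ _ _ => [|t t01|t _]; [exact: cp|split|exact: F1].
have side (r : R) (z : T) w : (0 <= r <= 1)%R -> (forall s, F (r, s) = z) -> w \in supp z ->
    L w (r, 0%R) = L w (r, 1%R).
  move=> r01 Fz wz; apply: (@locally_constant R H (fun s => L w (r, s))) => // t t01.
  have [] := is_section_line (p := fun s : R => (r, s)) (f := fun=> z) sL _ _ _ => //.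
    by apply: cont_pair; [exact: cst_continuous|exact: cont_id].
  by move=> _; apply.
rewrite (holonomy_path pf ux vy sf) (holonomy_path pg ux vy sg).
have sx := side 0%R x u l0 (fun s => Fx 0%R s (lexx _)) ux.
have sy := side 1%R y v l1 (fun s => Fy 1%R s (lexx _)) vy.
by rewrite -[LHS]/((L u (0%R, 0%R))^-1 * L v (1%R, 0%R)) sx sy.
Qed.

Lemma holonomy_cst x u v : u \in supp x -> v \in supp x -> holonomy u v (fun=> x) = h u v.
Proof.
move=> ux vx; have [L sL] := section_segment (@cst_continuous R T x).
have [L1 _] := sL; rewrite (holonomy_path (@cst_is_path R T x) ux vx sL).
have l1 : (0 <= (1 : R) <= 1)%R by rewrite lexx ler01.
rewrite -(L1 1%R u v) // mulgA -[LHS]/((L u 0%R)^-1 * L u 1%R * h u v).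
have := @section_transport (fun=> x) 0%R 1%R L (fun w _ => h u w) u u (@cst_continuous R T x) ler01 sL.
rewrite mulVg => ->; rewrite ?mul1g //.
split=> [z a b _ ax bx|z a _ _]; first by apply: ch; exact: (@supp3 x).
by near=> z' => _.
Unshelve. all: by end_near.
Qed.

(** The segment stays in one simplex, over which [h u] is a section constant in time. *)
Lemma holonomy_seg x y u v : supp x :|: supp y \in K -> u \in supp x -> v \in supp y ->
  holonomy u v (seg x y) = h u v.
Proof.
move=> Kxy ux vy; have ps := seg_path Ksub Kxy.
have sub t := supp_mixpt x y (unit_clamp t).
have sL : is_section (seg x y) [set t | 0 <= t <= 1]%R (fun w _ => h u w).
  split=> [z a b _ az bz|z a _ _]; last by near=> z' => _.
  apply: ch; apply: Ksub Kxy (set3_neq0 _ _ _) _.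
  have aU := fintype.subsetP (sub z) _ az; have bU := fintype.subsetP (sub z) _ bz.
  by rewrite !finset.subUset !finset.sub1set aU bU finset.in_setU ux.
rewrite (holonomy_path ps ux vy sL) (cocycle11 ch) ?invg1 ?mul1g //.
exact: supp1 ux.
Unshelve. all: by end_near.
Qed.

End Sections.

(** * Edge classes and the universal property of the fundamental group *)

Section EdgeClasses.
Local Open Scope group_scope.
Variables (R : realType) (V : finType) (K : {set {set V}}).
Hypothesis Ksub : forall s t : {set V}, s \in K -> t != finset.set0 -> t \subset s -> t \in K.
Local Notation T := (set_type (geometric_realization R K)).
Variables (x0 : T) (v0 : V).
Hypothesis v0x0 : v0 \in supp x0.
Hypothesis Kconn : forall v, [set v]%SET \in K ->
  connect (fun u v => [set u; v]%SET \in K) v0 v.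
Local Notation pi1 := (fundamental_group R x0).

Lemma supp_vptU (x : T) v : v \in supp x -> supp x :|: supp (vpt x0 v) = supp x.
Proof.
move=> vx; rewrite supp_vpt ?(supp1 Ksub vx) //.
by apply/finset.setUidPl; rewrite finset.sub1set.
Qed.

Lemma supp_vptUK (x : T) v : v \in supp x -> supp x :|: supp (vpt x0 v) \in K.
Proof. by move=> vx; rewrite supp_vptU // supp_in. Qed.

Lemma set2_sub (u v : V) : [set u; v]%SET \in K -> [set u]%SET \in K /\ [set v]%SET \in K.
Proof.
move=> Kuv; split; apply: Ksub Kuv _ _; rewrite ?finset.sub1set ?inE ?eqxx ?orbT //.
  by apply/set0Pn; exists u; rewrite inE.
by apply/set0Pn; exists v; rewrite inE.
Qed.

Lemma supp_vpt2 u v : [set u; v]%SET \in K -> supp (vpt x0 u) :|: supp (vpt x0 v) \in K.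
Proof. by move=> Kuv; have [Ku Kv] := set2_sub Kuv; rewrite !supp_vpt. Qed.

Lemma path_to (y : T) : exists f : R -> T, is_path x0 y f.
Proof.
have p0 := seg_path Ksub (supp_vptUK v0x0).
have pv v : [set v]%SET \in K -> exists f : R -> T, is_path x0 (vpt x0 v) f.
  move=> /Kconn/connectP[p]; elim/last_ind: p v => [|p w IHp] v /=.
    by move=> _ ->; exists (seg x0 (vpt x0 v0)).
  rewrite rcons_path last_rcons => /andP[pp Kuv] ->.
  have [f pf] := IHp _ pp erefl.
  by exists (conc f (seg (vpt x0 (last v0 p)) (vpt x0 w)));
    apply: conc_path pf (seg_path Ksub (supp_vpt2 Kuv)).
have vy := svertexP y; have [f pf] := pv _ (supp1 Ksub vy).
exists (conc f (inv_path (seg y (vpt x0 (svertex y))))).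
exact: conc_path pf (inv_path_path (seg_path Ksub (supp_vptUK vy))).
Qed.

(* The choice at [vpt v0] makes the class of the segment from [x0] to [v0] trivial. *)
Definition base_path (y : T) : R -> T :=
  if pselect (y = vpt x0 v0) is left _ then seg x0 y
  else if pselect (y = x0) is left _ then fun=> x0 else projT1 (cid (path_to y)).

Lemma base_path_path y : is_path x0 y (base_path y).
Proof.
rewrite /base_path; case: pselect => [->|_]; first exact/seg_path/supp_vptUK.
by case: pselect => [->|_]; [exact: cst_is_path|case: cid].
Qed.

Lemma base_path0 : base_path x0 = fun=> x0.
Proof.
rewrite /base_path; case: pselect => [_|_]; first exact: seg_xx.
by case: pselect.
Qed.

Local Notation pclass := (@path_class R T x0 base_path).

Lemma path_class_base : pclass x0 (vpt x0 v0) (seg x0 (vpt x0 v0)) = 1.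
Proof.
have ps := seg_path Ksub (supp_vptUK v0x0).
rewrite /path_class base_path0 /base_path; case: pselect => // _.
have pc := @cst_is_path R T x0.
have pcs := conc_path pc ps; have pi := inv_path_path ps.
rewrite -[RHS]loop_class_cst; apply/loop_class_eq => //; first exact: conc_path pcs pi.
apply: hpath_trans (hpath_conc (conc_cst_l ps) (hpath_refl pi)) _.
have := conc_inv_l pi; rewrite (_ : inv_path (inv_path _) = seg x0 (vpt x0 v0)) //.
by apply/funext => t; rewrite /inv_path opprB addrC subrK.
Qed.

Lemma path_class_straight (x y z : T) (f g e : R -> T) :
  is_path x y f -> is_path y z g -> is_path x z e ->
  (forall t, supp (conc f g t) :|: supp (e t) \in K) ->
  pclass x y f * pclass y z g = pclass x z e.
Proof.
move=> pf pg pe Kfg; rewrite -path_class_conc //; try exact: base_path_path.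
have pfg := conc_path pf pg.
by apply: path_class_eq (hpath_straight Ksub pfg pe Kfg) => //; exact: base_path_path.
Qed.

Lemma path_class_seg (x y z : T) s : s \in K ->
  supp x \subset s -> supp y \subset s -> supp z \subset s ->
  pclass x y (seg x y) * pclass y z (seg y z) = pclass x z (seg x z).
Proof.
move=> Ks xs ys zs.
have sU a b : supp a \subset s -> supp b \subset s -> supp a :|: supp b \in K.
  move=> as_ bs; apply: Ksub Ks _ _; last by rewrite finset.subUset as_.
  have /set0Pn[v va] := supp_neq0 a.
  by apply/set0Pn; exists v; rewrite finset.in_setU va.
have sseg a b t : supp a \subset s -> supp b \subset s -> supp (seg a b t) \subset s.
  move=> as_ bs; apply: fintype.subset_trans (supp_mixpt _ _ _) _.
  by rewrite finset.subUset as_.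
apply: path_class_straight; try by apply: seg_path => //; exact: sU.
by move=> t; apply: sU; [rewrite /conc; case: ifP => _; exact: sseg|exact: sseg].
Qed.

Definition edge_class (u v : V) : pi1 :=
  pclass (vpt x0 u) (vpt x0 v) (seg (vpt x0 u) (vpt x0 v)).

Lemma edge_class_cocycle : cocycle K edge_class.
Proof.
move=> u v w Ks.
have Kx x : x \in [set u; v; w]%SET -> supp (vpt x0 x) \subset [set u; v; w]%SET.
  move=> xs; rewrite supp_vpt ?finset.sub1set //.
  by apply: Ksub Ks _ _; rewrite ?finset.sub1set //; apply/set0Pn; exists x; rewrite inE.
by apply: (path_class_seg Ks); apply: Kx; rewrite !inE eqxx ?orbT.
Qed.

(* The tautological section: follow the loop up to time [t], then go straight to [v]. *)
Definition loop_section (p : R -> T) (v : V) (t : R) : pi1 :=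
  pclass (p 0%R) (p t) (subpath p 0 t) * pclass (p t) (vpt x0 v) (seg (p t) (vpt x0 v)).

Lemma loop_section_edge p t u v : u \in supp (p t) -> v \in supp (p t) ->
  loop_section p u t * edge_class u v = loop_section p v t.
Proof.
move=> ut vt; rewrite /loop_section -mulgA; congr (_ * _).
apply: (path_class_seg (supp_in (p t))) => //.
  by rewrite supp_vpt ?finset.sub1set // (supp1 Ksub ut).
by rewrite supp_vpt ?finset.sub1set // (supp1 Ksub vt).
Qed.

(** While the loop stays in the star of [v], following it and then going straight to [v] is
    homotopic to going straight to [v] at once. *)
Lemma loop_section_near p t v : continuous p -> v \in supp (p t) ->
  \forall s \near t, loop_section p v s = loop_section p v t.
Proof.
move=> cp vt.
have [e e0 eP] := nearR (near_supp cp vt).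
have : \forall s \near t, ball t e s by exact: nbhsx_ballx.
apply: filterS => s; rewrite /ball /= ltr_norml => /andP[s1 s2].
pose rho (r : R) : R := (t + (s - t) * unit_clamp r)%R.
have vrho r : v \in supp (p (rho r)).
  by rewrite /rho; have /andP[b0 b1] := unit_clamp_bound r; apply: eP; nra.
have crho : continuous rho by rewrite /rho; ctac.
(* A square: the first coordinate runs along the loop from [t] to [s], the second contracts to [v],
   and the top side is constant. *)
pose F (u : R * R) := mixpt (p (rho u.1)) (vpt x0 v) (unit_clamp u.2).
have cF : continuous F.
  apply: (mixpt_continuous Ksub); last by move=> u; exact: supp_vptUK.
  - exact: (comp_fst (cont_compR crho cp)).
  - exact: cst_continuous.
  - exact: cont_snd.
have FK r : supp (p (rho r)) :|: supp (vpt x0 v) \in K by exact: supp_vptUK.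
have rho0 : rho 0%R = t by rewrite /rho unit_clamp_le0 // mulr0 addr0.
have rho1 : rho 1%R = s by rewrite /rho unit_clamp_ge1 // mulr1 addrC subrK.
have F0 r : F (r, 0%R) = p (rho r) by rewrite /F /= unit_clamp_le0 // (mixpt0 Ksub).
have F1 r : F (r, 1%R) = vpt x0 v by rewrite /F /= unit_clamp_ge1 // (mixpt1 Ksub).
have cl2 (r : R) : unit_clamp (unit_clamp r) = unit_clamp r.
  by rewrite unit_clamp_id // unit_clamp_bound.
have := path_class_square base_path_path 0%R 1%R 0%R 1%R cF.
rewrite !F0 !F1 rho0 rho1.
have -> : (fun r : R => F (0 + (1 - 0) * unit_clamp r, 0)%R) = subpath p t s.
  apply/funext => r; rewrite F0 /rho add0r subr0 mul1r cl2 /subpath.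
  by [].
have -> : (fun r : R => F (1, 0 + (1 - 0) * unit_clamp r)%R) = seg (p s) (vpt x0 v).
  by apply/funext => r; rewrite /F /= rho1 add0r subr0 mul1r cl2.
have -> : (fun r : R => F (0, 0 + (1 - 0) * unit_clamp r)%R) = seg (p t) (vpt x0 v).
  by apply/funext => r; rewrite /F /= rho0 add0r subr0 mul1r cl2.
have -> : (fun r : R => F (0 + (1 - 0) * unit_clamp r, 1)%R) = fun=> vpt x0 v.
  by apply/funext => r; rewrite F1.
rewrite path_class_cst ?mulg1; last exact: base_path_path.
rewrite /loop_section => <-; rewrite mulgA; congr (_ * _).
rewrite -path_class_conc; try exact: base_path_path; try exact: subpath_path.
apply: path_class_eq; try exact: base_path_path; try exact: subpath_path.
  exact: conc_path (subpath_path 0%R t cp) (subpath_path t s cp).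
by apply: hpath_sym; exact: subpath_conc.
Qed.

(** Pushed forward by [phi] and twisted by [c], the tautological section becomes one for the cocycle
    of [psi]. Its end values give the class of the loop, since [c v0] and the class of the segment
    from [x0] to [v0] are trivial. *)
Lemma loop_holonomy (H : groupType) (phi psi : pi1 -> H) (c : V -> H) (p : R -> T) :
  {morph phi : x y / x * y} -> c v0 = 1 ->
  is_path x0 x0 p ->
  (forall u v, [set u; v]%SET \in K ->
    psi (edge_class u v) = (c u)^-1 * phi (edge_class u v) * c v) ->
  cocycle K (fun u v => psi (edge_class u v)) ->
  holonomy (fun u v => psi (edge_class u v)) v0 v0 p = phi (loop_class x0 p).
Proof.
move=> mphi c0 pp psiE ch; have [cp p0 p1] := pp.
have p00 : p 0%R = x0 by exact: p0.
have p11 : p 1%R = x0 by exact: p1.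
have sL : is_section (fun u v => psi (edge_class u v)) p [set t | 0 <= t <= 1]%R
    (fun v t => phi (loop_section p v t) * c v).
  split=> [t u v _ ut vt|t v _ vt].
    by rewrite psiE ?(supp2 Ksub ut vt) // !mulgA mulgK -mphi loop_section_edge.
  have := loop_section_near cp vt.
  by apply: filterS => s -> _.
rewrite (holonomy_path pp v0x0 v0x0 sL) c0 !mulg1 /loop_section p00 p11 path_class_base !mulg1.
have phi1 : phi 1 = 1.
  by have := mphi 1 1; rewrite mulg1 => /(congr1 (fun a => (phi 1)^-1 * a)); rewrite mulVg mulKg.
rewrite subpath_cst p00 path_class_cst ?phi1 ?invg1 ?mul1g; last exact: base_path_path.
rewrite (subpath_id pp) path_class_loop //.
exact: base_path0.
Qed.

(** For the existence, [phi] is the holonomy of [h] along loops and the gauge at a vertex is the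
    holonomy along its base path. For the uniqueness, [phi] and [psi] both compute the holonomy of
    the cocycle [psi (edge_class u v)]. *)
Theorem fundamental_group_universal : universal K v0 edge_class.
Proof.
split; first exact: edge_class_cocycle.
  move=> H h ch.
  pose rep a := projT1 (cid2 (loop_class_surj (a : pi1))).
  have repP a : is_path x0 x0 (rep a) by rewrite /rep; case: cid2.
  have repE a : loop_class x0 (rep a) = a by rewrite /rep; case: cid2.
  pose phi a := holonomy h v0 v0 (rep a).
  have phiE f : is_path x0 x0 f -> phi (loop_class x0 f) = holonomy h v0 v0 f.
    move=> pf; apply: (holonomy_hpath Ksub ch (x := x0) (y := x0)) => //.
    by apply/loop_class_eq.
  exists phi, (fun v => holonomy h v0 v (base_path (vpt x0 v))); split.
    move=> a b; rewrite -{1}(repE a) -{1}(repE b) -loop_class_conc // phiE; last exact: conc_path.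
    by rewrite (holonomy_conc Ksub ch (repP a) (repP b) (v := v0)).
  move=> u v Kuv; have [Ku Kv] := set2_sub Kuv.
  have uu : u \in supp (vpt x0 u) by rewrite supp_vpt ?inE.
  have vv : v \in supp (vpt x0 v) by rewrite supp_vpt ?inE.
  have [pu pv] := (base_path_path (vpt x0 u), base_path_path (vpt x0 v)).
  have ps := seg_path Ksub (supp_vpt2 Kuv); have pus := conc_path pu ps.
  have pi := inv_path_path pv.
  rewrite /edge_class /path_class phiE; last exact: conc_path pus pi.
  rewrite (holonomy_conc Ksub ch pus pi v0x0 vv v0x0) (holonomy_conc Ksub ch pu ps v0x0 uu vv).
  rewrite (holonomy_seg Ksub ch (supp_vpt2 Kuv) uu vv) -!mulgA mulKg.
  rewrite -(holonomy_conc Ksub ch pi pv vv v0x0 vv).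
  have pc := @cst_is_path R T (vpt x0 v).
  rewrite (holonomy_hpath Ksub ch (conc_path pi pv) pc (conc_inv_l pv) vv vv).
  by rewrite (holonomy_cst Ksub ch vv vv) (cocycle11 ch Kv) mulg1.
move=> H phi psi c mphi mpsi c0 psiE a.
have [p pp ->] := loop_class_surj a.
have ch : cocycle K (fun u v => psi (edge_class u v)).
  by move=> u v w Ks; rewrite -mpsi edge_class_cocycle.
rewrite -(loop_holonomy mphi c0 pp psiE ch).
apply: (loop_holonomy (c := fun=> 1)) => // u v _.
by rewrite invg1 mul1g mulg1.
Qed.

End EdgeClasses.

(** * Free groups, free products and Heisenberg lifts *)

Section Morphisms.
Local Open Scope group_scope.
Variables (G H : groupType) (f : G -> H).
Hypothesis fM : {morph f : x y / x * y}.

Lemma morph_one : f 1 = 1.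
Proof. by apply: (mulgI (f 1)); rewrite -fM !mulg1. Qed.

Lemma morph_inv x : f x^-1 = (f x)^-1.
Proof. by apply: (mulgI (f x)); rewrite -fM !mulgV morph_one. Qed.

End Morphisms.

Lemma isomorphic_of_morph (G H : groupType) (f : G -> H) (g : H -> G) :
  {morph f : x y / (x * y)%g} -> cancel f g -> cancel g f -> isomorphic G H.
Proof.
move=> fM fK gK; pose F := HB.pack_for {multiplicative G -> H} f (isMultiplicative.Build G H f fM).
by exists F; exists g.
Qed.

Section WordGroupLift.
Local Open Scope group_scope.
Variables (A : choiceType) (r : seq A -> seq A -> Prop) (inv : A -> A).
Hypothesis invl : forall a, word_eqv r [:: inv a; a] [::].
Hypothesis invr : forall a, word_eqv r [:: a; inv a] [::].
Local Notation W := (Defs.quotient_group (word_setoid invl invr)).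
Variable H : groupType.

Definition word_class (w : seq A) : W := \pi_(sg_quot (word_setoid invl invr)) w.

Lemma word_class_cat u v : word_class (u ++ v) = word_class u * word_class v.
Proof. exact: (esym (@quot_mulE (word_setoid invl invr) u v)). Qed.

Lemma word_class_nil : word_class [::] = 1.
Proof. by []. Qed.

Lemma word_class_eqv u v : word_eqv r u v -> word_class u = word_class v.
Proof. by move=> uv; apply/(@sg_piP (word_setoid invl invr)). Qed.

Lemma word_class_rel u v : r u v -> word_class u = word_class v.
Proof.
by move=> uv; apply: word_class_eqv; have := word_step [::] [::] uv; rewrite !cats0.
Qed.

Lemma word_class_surj (x : W) : exists w, x = word_class w.
Proof. by exists (repr (x : sg_quot (word_setoid invl invr))); rewrite /word_class reprK. Qed.

Variable f : A -> H.
Definition word_value (w : seq A) : H := foldr (fun a x => f a * x) 1 w.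

Lemma word_value_cat u v : word_value (u ++ v) = word_value u * word_value v.
Proof. by elim: u => [|a u IHu]; rewrite ?mul1g //= IHu mulgA. Qed.

Hypothesis fr : forall u v, r u v -> word_value u = word_value v.

Lemma word_group_lift : exists F : W -> H, {morph F : x y / x * y} /\
  forall w, F (word_class w) = word_value w.
Proof.
have ev u v : word_eqv r u v -> word_value u = word_value v.
  elim=> // {u v} [u v w _ -> _ //|a u v b uv].
  by rewrite !word_value_cat (fr uv).
pose F (x : W) := word_value (repr (x : sg_quot (word_setoid invl invr))).
have FE w : F (word_class w) = word_value w.
  by apply: ev; exact: (@sg_repr_pi (word_setoid invl invr)).
exists F; split=> // x y.
have [u ->] := word_class_surj x; have [v ->] := word_class_surj y.
by rewrite -word_class_cat !FE word_value_cat.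
Qed.

End WordGroupLift.

Section FreeGroupLift.
Local Open Scope group_scope.
Variable X : choiceType.

Definition free_gen (x : X) : free_group X :=
  word_class (@free_invl X) (@free_invr X) [:: (x, true)].

Lemma free_group_lift (H : groupType) (f : X -> H) :
  exists F : free_group X -> H, {morph F : x y / x * y} /\ forall x, F (free_gen x) = f x.
Proof.
pose f' (a : X * bool) := if a.2 then f a.1 else (f a.1)^-1.
have [|F [FM FE]] := @word_group_lift _ _ _ (@free_invl X) (@free_invr X) H f'.
  by move=> _ _ [x []]; rewrite /word_value /f' /= mulg1 ?mulgV ?mulVg.
by exists F; split=> // x; rewrite FE /word_value /f' /= mulg1.
Qed.

Lemma free_group_ext (H : groupType) (F F' : free_group X -> H) :
  {morph F : x y / x * y} -> {morph F' : x y / x * y} ->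
  (forall x, F (free_gen x) = F' (free_gen x)) -> F =1 F'.
Proof.
move=> FM FM' FF' a; have [w ->] := word_class_surj a.
elim: w => [|[x b] w IHw]; first by rewrite word_class_nil !morph_one.
rewrite -cat1s word_class_cat FM FM' IHw; congr (_ * _); case: b; first exact: FF'.
have xV : word_class (@free_invl X) (@free_invr X) [:: (x, false)] = (free_gen x)^-1.
  apply: (mulgI (free_gen x)); rewrite mulgV -word_class_cat.
  by rewrite (@word_class_rel _ _ _ _ _ [:: (x, true); (x, false)] [::]) //; exact: (free_cancel x true).
by rewrite xV !morph_inv // FF'.
Qed.

End FreeGroupLift.

Section FreeProductLift.
Local Open Scope group_scope.
Variables G N : groupType.
Local Notation GN := (free_product G N).

Definition prod_inl (x : G) : GN := word_class (@prod_invl G N) (@prod_invr G N) [:: inl x].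
Definition prod_inr (y : N) : GN := word_class (@prod_invl G N) (@prod_invr G N) [:: inr y].

Lemma prod_inlM : {morph prod_inl : x y / x * y}.
Proof.
move=> x y; rewrite /prod_inl -word_class_cat; apply/esym.
by apply: word_class_rel; exact: prod_mull.
Qed.

Lemma prod_inrM : {morph prod_inr : x y / x * y}.
Proof.
move=> x y; rewrite /prod_inr -word_class_cat; apply/esym.
by apply: word_class_rel; exact: prod_mulr.
Qed.

Lemma free_product_lift (H : groupType) (f : G -> H) (g : N -> H) :
  {morph f : x y / x * y} -> {morph g : x y / x * y} ->
  exists F : GN -> H, [/\ {morph F : x y / x * y}, forall x, F (prod_inl x) = f x
    & forall y, F (prod_inr y) = g y].
Proof.
move=> fM gM; pose fg (a : G + N) := match a with inl x => f x | inr y => g y end.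
have [|F [FM FE]] := @word_group_lift _ _ _ (@prod_invl G N) (@prod_invr G N) H fg.
  move=> _ _ [x y|x y||]; rewrite /word_value /fg /= ?mulg1 ?fM ?gM ?mulgA //; exact: morph_one.
by exists F; split=> // x; rewrite FE /word_value /fg /= mulg1.
Qed.

Lemma free_product_ext (H : groupType) (F F' : GN -> H) :
  {morph F : x y / x * y} -> {morph F' : x y / x * y} ->
  (forall x, F (prod_inl x) = F' (prod_inl x)) ->
  (forall y, F (prod_inr y) = F' (prod_inr y)) -> F =1 F'.
Proof.
move=> FM FM' Fl Fr a; have [w ->] := word_class_surj a.
elim: w => [|x w IHw]; first by rewrite word_class_nil !morph_one.
by rewrite -cat1s word_class_cat FM FM' IHw; congr (_ * _); case: x.
Qed.

End FreeProductLift.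

Section AbelianizationLift.
Local Open Scope group_scope.
Variable G : groupType.

Definition abel (x : G) : abelianization G := \pi_(sg_quot (abelianization_setoid G)) x.

Lemma abelM : {morph abel : x y / x * y}.
Proof. by move=> x y; exact: (esym (@quot_mulE (abelianization_setoid G) x y)). Qed.

Lemma abel_surj a : exists x, a = abel x.
Proof. by exists (repr (a : sg_quot (abelianization_setoid G))); rewrite /abel reprK. Qed.

Lemma abelC (a b : abelianization G) : a * b = b * a.
Proof.
have [x ->] := abel_surj a; have [y ->] := abel_surj b.
rewrite -!abelM; apply/(@sg_piP (abelianization_setoid G)); rewrite /= /same_coset.
have -> : (x * y)^-1 * (y * x) = [~ y, x] by rewrite /commg /conjg invgM !mulgA.
exact: commutator_gen.
Qed.

Lemma abel_lift (H : groupType) (f : G -> H) : {morph f : x y / x * y} ->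
  (forall x y : H, x * y = y * x) ->
  exists F : abelianization G -> H, {morph F : x y / x * y} /\ forall x, F (abel x) = f x.
Proof.
move=> fM HC.
have fc z : commutator_subgroup z -> f z = 1.
  elim=> [x y||x y _ fx _ fy|x _ fx]; rewrite ?morph_one //.
  - by rewrite /commg /conjg !fM !morph_inv // (HC (f x)) mulKg mulVg.
  - by rewrite fM fx fy mulg1.
  - by rewrite morph_inv // fx invg1.
pose F (a : abelianization G) := f (repr (a : sg_quot (abelianization_setoid G))).
have FE x : F (abel x) = f x.
  have := @sg_repr_pi (abelianization_setoid G) x; rewrite /= /same_coset => /fc.
  by rewrite fM morph_inv // => /(congr1 (fun z => f (repr (abel x)) * z)); rewrite mulKVg mulg1.
exists F; split=> // a b.
have [x ->] := abel_surj a; have [y ->] := abel_surj b.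
by rewrite -abelM !FE.
Qed.

End AbelianizationLift.

Section AbelianZmodule.
Local Open Scope group_scope.

(** The alias carries the commutativity proof, so that an additive structure can be declared on it;
    the expansion along the seeds takes place in a [zmodType]. *)
Definition abelian_zmod (A : groupType) (AC : forall x y : A, x * y = y * x) : Type := A.

Variables (A : groupType) (AC : forall x y : A, x * y = y * x).
HB.instance Definition _ := Choice.on (abelian_zmod AC).

Lemma abelian_zmod_addA : associative (fun x y : abelian_zmod AC => (x * y : A)).
Proof. exact: mulgA. Qed.

HB.instance Definition _ := GRing.isZmodule.Build (abelian_zmod AC)
  abelian_zmod_addA AC (@mul1g A) (@mulVg A).

End AbelianZmodule.

(** Integral upper unitriangular matrices of size 3: the corner entry fails to be additive exactly
    by the cup product of the other two. *)
Definition heisenberg : Type := (int * int * int)%type.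
HB.instance Definition _ := Choice.on heisenberg.

Section Heisenberg.
Implicit Types x y z : heisenberg.

Definition heis_mul x y : heisenberg :=
  (x.1.1 + y.1.1, x.1.2 + y.1.2, x.2 + y.2 + x.1.1 * y.1.2).
Definition heis_one : heisenberg := (0, 0, 0).
Definition heis_inv x : heisenberg := (- x.1.1, - x.1.2, x.1.1 * x.1.2 - x.2).

Lemma heis_eq x y : x.1.1 = y.1.1 -> x.1.2 = y.1.2 -> x.2 = y.2 -> x = y.
Proof. by case: x => [[]] a b c; case: y => [[]] d e f /= -> -> ->. Qed.

Lemma heis_mulA : associative heis_mul.
Proof. by move=> x y z; apply: heis_eq; rewrite /heis_mul /=; ring. Qed.

Lemma heis_mul1 : left_id heis_one heis_mul.
Proof. by move=> x; apply: heis_eq; rewrite /heis_mul /=; ring. Qed.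

Lemma heis_mulr1 : right_id heis_one heis_mul.
Proof. by move=> x; apply: heis_eq; rewrite /heis_mul /=; ring. Qed.

Lemma heis_mulV : left_inverse heis_one heis_inv heis_mul.
Proof. by move=> x; apply: heis_eq; rewrite /heis_mul /=; ring. Qed.

Lemma heis_mulrV : right_inverse heis_one heis_inv heis_mul.
Proof. by move=> x; apply: heis_eq; rewrite /heis_mul /=; ring. Qed.

HB.instance Definition _ := isGroup.Build heisenberg
  heis_mulA heis_mul1 heis_mulr1 heis_mulV heis_mulrV.

Lemma heis_mulE x y : (x * y)%g = heis_mul x y. Proof. by []. Qed.

End Heisenberg.

(* In other words, the cup product of two characters of a free group vanishes. *)
Lemma free_heisenberg (G : groupType) (alpha beta : G -> int) : is_free G ->
  (forall x y, alpha (x * y)%g = alpha x + alpha y) ->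
  (forall x y, beta (x * y)%g = beta x + beta y) ->
  exists F : G -> heisenberg, [/\ {morph F : x y / (x * y)%g},
    forall x, (F x).1.1 = alpha x & forall x, (F x).1.2 = beta x].
Proof.
case=> X [f [g fK gK]] aM bM.
have gM : {morph g : x y / (x * y)%g}.
  by move=> x y; rewrite -{1}(gK x) -{1}(gK y) -gmulfM fK.
have [F [FM FE]] := free_group_lift
  (fun x => ((alpha (g (free_gen x)), beta (g (free_gen x)), 0) : heisenberg)).
exists (fun x => F (f x)); split=> [x y|x|x]; first by rewrite gmulfM FM.
  rewrite -{2}(fK x); move: (f x).
  apply: (@free_group_ext X (Algebra.to_multiplicative int) (fun y => (F y).1.1) (fun y => alpha (g y))).
  - by move=> y z; rewrite FM.
  - by move=> y z; rewrite gM aM.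
  - by move=> y; rewrite FE.
rewrite -{2}(fK x); move: (f x).
apply: (@free_group_ext X (Algebra.to_multiplicative int) (fun y => (F y).1.2) (fun y => beta (g y))).
- by move=> y z; rewrite FM.
- by move=> y z; rewrite gM bM.
- by move=> y; rewrite FE.
Qed.

Local Close Scope quotient_scope.
Local Close Scope classical_set_scope.

(** * The fundamental group of the complex of triples *)

Lemma mulVg_eq1 (G : groupType) (x y : G) : (x^-1 * y = 1 -> y = x)%g.
Proof. by move=> e; rewrite -[y](mulKVg x) e mulg1. Qed.

Section Normalize.
Local Open Scope group_scope.
Variables (G : groupType) (g : {set 'I_10} -> {set 'I_10} -> G).
Hypothesis gU : universal kneser rootset g.

(* The class of the path from the root to [S] in the spanning tree. *)
Definition tree_path (S : {set 'I_10}) : G :=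
  if S == rootset then 1 else
  if [disjoint rootset & S] then g rootset S
  else g rootset (parentset S) * g (parentset S) S.

(** The gauge in which the cocycle is trivial on the spanning tree. *)
Definition tree_gauge S T : G := tree_path S * g S T * (tree_path T)^-1.

Lemma card_rootset : #|rootset| = 3.
Proof. exact: card_bset root_triple. Qed.

Lemma parentsetP (S : {set 'I_10}) : #|S| = 3 ->
  [/\ #|parentset S| = 3, [disjoint parentset S & S] & [disjoint rootset & parentset S]].
Proof.
move=> S3; have St : bits S \in triples by rewrite bits_triples S3.
have [pt ps pr] := parentP St; rewrite /parentset card_bset //; split=> //.
  by move: ps; rewrite dis_bset // bitsK.
by rewrite -dis_bset ?root_triple // dis_sym.
Qed.

Lemma neq_of_disjoint (S T : {set 'I_10}) : #|T| = 3 -> [disjoint S & T] -> T != S.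
Proof.
move=> T3; apply: contraTneq => <-; rewrite -setI_eq0 finset.setIid -cards_eq0 T3.
by [].
Qed.

Lemma tree_path_root : tree_path rootset = 1.
Proof. by rewrite /tree_path eqxx. Qed.

Lemma tree_path_disjoint (S : {set 'I_10}) : #|S| = 3 -> [disjoint rootset & S] ->
  tree_path S = g rootset S.
Proof. by move=> S3 rS; rewrite /tree_path rS (negbTE (neq_of_disjoint S3 rS)). Qed.

Lemma tree_path_parent (S : {set 'I_10}) : S != rootset -> ~~ [disjoint rootset & S] ->
  tree_path S = g rootset (parentset S) * g (parentset S) S.
Proof. by move=> /negbTE Sr /negbTE rS; rewrite /tree_path rS Sr. Qed.

Lemma tree_gauge_cocycle : cocycle kneser tree_gauge.
Proof.
have [cg _ _] := gU; move=> S T U STU.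
by rewrite /tree_gauge !mulgA mulgKV -(mulgA (tree_path S)) cg.
Qed.

Lemma tree_gauge_root (S : {set 'I_10}) : #|S| = 3 -> [disjoint rootset & S] ->
  tree_gauge rootset S = 1.
Proof.
by move=> S3 rS; rewrite /tree_gauge tree_path_root (tree_path_disjoint S3 rS) mul1g mulgV.
Qed.

Lemma tree_gauge_parent (S : {set 'I_10}) : #|S| = 3 -> S != rootset ->
  ~~ [disjoint rootset & S] -> tree_gauge (parentset S) S = 1.
Proof.
move=> S3 Sr rS; have [p3 pS rp] := parentsetP S3.
by rewrite /tree_gauge (tree_path_disjoint p3 rp) (tree_path_parent Sr rS) mulgV.
Qed.

Lemma kneser_mem2 (S T : {set 'I_10}) : [set S; T]%SET \in kneser -> #|S| = 3 /\ #|T| = 3.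
Proof. by case/mem_kneser=> _ c _; split; apply: c; rewrite !inE eqxx ?orbT. Qed.

(** As [h] is trivial on the tree, the gauge [c] is determined by [phi] and its value at the root;
    conjugation by this value absorbs the gauge altogether. *)
Lemma tree_gauge_lift (H : groupType) (h : {set 'I_10} -> {set 'I_10} -> H) :
  cocycle kneser h ->
  (forall S : {set 'I_10}, #|S| = 3 -> [disjoint rootset & S] -> h rootset S = 1) ->
  (forall S : {set 'I_10}, #|S| = 3 -> S != rootset -> ~~ [disjoint rootset & S] ->
    h (parentset S) S = 1) ->
  exists phi : G -> H, {morph phi : x y / x * y} /\
    forall S T, [set S; T]%SET \in kneser -> h S T = phi (tree_gauge S T).
Proof.
move=> ch hr hp; have [_ E _] := gU; have [phi [c [phiM phiE]]] := E H h ch.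
have cE (S : {set 'I_10}) : #|S| = 3 -> c S = (phi (tree_path S))^-1 * c rootset.
  have cd (S' : {set 'I_10}) : #|S'| = 3 -> [disjoint rootset & S'] ->
      c S' = (phi (g rootset S'))^-1 * c rootset.
    move=> S3 rS; have := phiE rootset S' (kneser2 card_rootset S3 rS); rewrite hr //.
    by rewrite -mulgA => /esym/mulVg_eq1 e; rewrite -[LHS](mulKg (phi (g rootset S'))) e.
  move=> S3; case: (eqVneq S rootset) => [->|Sr].
    by rewrite tree_path_root morph_one // invg1 mul1g.
  have [rS|rS] := boolP [disjoint rootset & S].
    by rewrite tree_path_disjoint // cd.
  have [p3 pS rp] := parentsetP S3.
  have := phiE _ _ (kneser2 p3 S3 pS); rewrite hp // -mulgA => /esym/mulVg_eq1.
  rewrite (cd _ p3 rp) (tree_path_parent Sr rS) phiM => e.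
  by rewrite invgM -mulgA -e mulKg.
exists (fun x => (c rootset)^-1 * phi x * c rootset); split=> [x y|S T ST].
  by rewrite phiM !mulgA mulgK.
have [S3 T3] := kneser_mem2 ST.
rewrite (phiE S T ST) (cE S S3) (cE T T3) invgM invgK /tree_gauge !phiM (morph_inv phiM).
by rewrite !mulgA.
Qed.

(** On the original cocycle the two morphisms differ by a gauge built from [tree_path], which is 1
    at the root. *)
Lemma tree_gauge_ext (H : groupType) (phi psi : G -> H) :
  {morph phi : x y / x * y} -> {morph psi : x y / x * y} ->
  (forall S T, [set S; T]%SET \in kneser -> phi (tree_gauge S T) = psi (tree_gauge S T)) ->
  phi =1 psi.
Proof.
move=> phiM psiM e; have [_ _ U] := gU.
apply: (U H phi psi (fun S => (phi (tree_path S))^-1 * psi (tree_path S))) => //.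
  by rewrite tree_path_root (morph_one phiM) (morph_one psiM) mulVg.
move=> S T ST; have := e S T ST; rewrite /tree_gauge !phiM !psiM (morph_inv phiM) (morph_inv psiM).
move=> /(congr1 (fun x => (psi (tree_path S))^-1 * x * psi (tree_path T))).
by rewrite !mulgA mulgKV mulVg mul1g => <- /=; rewrite invgM invgK.
Qed.

End Normalize.

Section Abelianized.
Variables (G : groupType) (g : {set 'I_10} -> {set 'I_10} -> G).
Hypothesis gU : universal kneser rootset g.
Local Notation Z42 := (Algebra.to_multiplicative 'rV[int]_42).
Local Notation k := (tree_gauge g).

Lemma ucocycle_lift : exists phi : G -> 'rV[int]_42,
  (forall x y, phi (x * y)%g = phi x + phi y) /\
  forall S T, [set S; T]%SET \in kneser -> ucocycle S T = phi (k S T).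
Proof.
have [||| phi [phiM phiE]] := @tree_gauge_lift G g gU Z42 ucocycle.
- exact: ucocycle_cocycle.
- exact: ucocycle_root.
- exact: ucocycle_parent.
by exists phi.
Qed.

(** [psi] maps the standard basis to the classes of the seeds: [cocycle_expand] gives that [psi]
    after [F] is the identity, [ucocycle_seed] that [F] after [psi] is. *)
Lemma abelianization_kneser : isomorphic (abelianization G) Z42.
Proof.
have [phi [phiM phiE]] := ucocycle_lift.
have [F [FM FE]] := @abel_lift G Z42 phi phiM (@addrC _).
pose M := abelian_zmod (@abelC G).
pose h (S T : {set 'I_10}) : M := abel (k S T).
have kc := tree_gauge_cocycle gU.
have hc S T U : [set S; T; U]%SET \in kneser -> h S T + h T U = h S U.
  by move=> STU; rewrite /h -(kc S T U STU); exact: (esym (abelM _ _)).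
have abel1 : abel (1%g : G) = 0 :> M by exact: (morph_one (@abelM G)).
have hr (S : {set 'I_10}) : #|S| = 3 -> [disjoint rootset & S] -> h rootset S = 0.
  by move=> S3 rS; rewrite /h tree_gauge_root.
have hp (S : {set 'I_10}) : #|S| = 3 -> S != rootset -> ~~ [disjoint rootset & S] ->
    h (parentset S) S = 0.
  by move=> S3 Sr rS; rewrite /h tree_gauge_parent.
have hE := cocycle_expand hc hr hp.
pose psi (x : 'rV[int]_42) : M := \sum_(i < 42) h (seed1 i) (seed2 i) *~ x 0 i.
have psiD x y : psi (x + y) = psi x + psi y.
  by rewrite /psi -big_split /=; apply: eq_bigr => i _; rewrite mxE mulrzDr.
apply: (@isomorphic_of_morph _ _ F psi) => // [a|x].
  have [x ->] := abel_surj a; rewrite FE.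
  apply: (@tree_gauge_ext G g gU (abelianization G) (fun x => psi (phi x)) (@abel G)).
  - by move=> y z; rewrite phiM psiD.
  - exact: abelM.
  - by move=> S T ST; rewrite -phiE // -[RHS]/(h S T) hE.
have F0 : F (0 : M) = 0 by exact: (morph_one FM).
have FD (a b : M) : F (a + b) = F a + F b by exact: FM.
have FN (a : M) : F (- a) = - F a by exact: (morph_inv FM).
have FMz (a : M) (n : int) : F (a *~ n) = F a *~ n.
  have Fn (b : M) m : F (b *+ m) = F b *+ m.
    by elim: m => [|m IHm]; rewrite ?mulr0n // !mulrS FD IHm.
  by case: n => m; rewrite ?NegzE ?mulrNz ?FN -?pmulrn Fn.
rewrite /psi (big_morph F FD F0) [RHS]row_sum_delta.
apply: eq_bigr => i _; rewrite FMz.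
have se : [set seed1 i; seed2 i]%SET \in kneser.
  have := seeds_edges (ltn_ord i); rewrite /seed1 /seed2; case: (nth _ _ _) => u v.
  rewrite mem_edges => /and4P[ut vt _ uv].
  by apply: kneser2; rewrite ?card_bset // -dis_bset.
rewrite /h FE -phiE // ucocycle_seed.
by rewrite -scaler_int intz.
Qed.

(** Characters of [G] extend to [P] along [r]. If [P] is free they lift to the Heisenberg group, and
    the corner entries at the edges of [kneser] exhibit the cup product as a coboundary. *)
Lemma not_free_of_retract (P : groupType) (i : G -> P) (r : P -> G) :
  {morph i : x y / (x * y)%g} -> {morph r : x y / (x * y)%g} -> cancel i r -> ~ is_free P.
Proof.
move=> iM rM ir Pfree; have [phi [phiM phiE]] := ucocycle_lift.
pose i3 : 'I_42 := inord 3; pose i2 : 'I_42 := inord 2.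
have [||F [FM Fa Fb]] := @free_heisenberg P (fun x => phi (r x) 0 i3) (fun x => phi (r x) 0 i2) Pfree.
- by move=> x y; rewrite rM phiM mxE.
- by move=> x y; rewrite rM phiM mxE.
apply: (@cup_product_nonzero i3 i2 (fun S T => (F (i (k S T))).2)); rewrite ?inordK // => S T U STU.
have sub2 (A B : {set 'I_10}) : A \in [set S; T; U]%SET -> B \in [set S; T; U]%SET ->
    [set A; B]%SET \in kneser.
  move=> As Bs; apply: (kneser_sub STU); first by apply/set0Pn; exists A; rewrite !inE eqxx.
  by rewrite finset.subUset !finset.sub1set As.
have ST : [set S; T]%SET \in kneser by apply: sub2; rewrite !inE eqxx ?orbT.
have TU : [set T; U]%SET \in kneser by apply: sub2; rewrite !inE eqxx ?orbT.
rewrite -(tree_gauge_cocycle gU STU) iM FM heis_mulE /heis_mul /=.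
by rewrite Fa Fb !ir -!phiE.
Qed.

End Abelianized.

(** * Cones attached to a poset *)

Section UniversalFacts.
Local Open Scope group_scope.
Variables (V : finType) (K : {set {set V}}).

(** Uniqueness at [v0] makes [psi] the conjugate of [phi] by [c v0]; comparison on the class [W] of
    a path from [v0] to [v1] gives c v0 = c v1 = 1. *)
Lemma universal_base (G : groupType) (g : V -> V -> G) v0 v1 :
  connect (fun u v => [set u; v]%SET \in K) v0 v1 -> universal K v0 g -> universal K v1 g.
Proof.
move=> v01 [gc gE gU]; split=> // H phi psi c phiM psiM c1 e.
have [W WE] : exists W, psi W = (c v0)^-1 * phi W * c v1.
  case/connectP: v01 => p; elim/last_ind: p v1 {c1} => [|p w IHp] v1 /=.
    by move=> _ ->; exists 1; rewrite (morph_one phiM) (morph_one psiM) mulg1 mulVg.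
  rewrite rcons_path last_rcons => /andP[pp uw] ->.
  have [W WE] := IHp _ pp erefl.
  by exists (W * g (last v0 p) w); rewrite psiM WE (e _ _ uw) phiM !mulgA mulgK.
have conj : (fun x => (c v0)^-1 * phi x * c v0) =1 psi.
  apply: (gU H _ psi (fun v => (c v0)^-1 * c v)) => //.
  - by move=> x y; rewrite phiM !mulgA mulgK.
  - by rewrite mulVg.
  - by move=> u v uv; rewrite (e u v uv) invgM invgK !mulgA !mulgK.
have c01 : c v0 = 1.
  by move: WE; rewrite -conj c1 => /mulgI.
by move=> x; rewrite -conj c01 invg1 mul1g mulg1.
Qed.

Lemma universal_iso (G G' : groupType) (g : V -> V -> G) (g' : V -> V -> G') v0 :
  universal K v0 g -> universal K v0 g' -> isomorphic G G'.
Proof.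
(* Conjugating the morphism normalizes the gauge to 1 at [v0], so that uniqueness applies to both
   composites. *)
have normal (A B : groupType) (a : V -> V -> A) (b : V -> V -> B) :
    universal K v0 a -> cocycle K b ->
    exists (phi : A -> B) (c : V -> B), [/\ {morph phi : x y / x * y}, c v0 = 1 &
      forall u v, [set u; v]%SET \in K -> b u v = (c u)^-1 * phi (a u v) * c v].
  move=> [_ aE _] bc; have [phi [c [phiM phiE]]] := aE _ _ bc.
  exists (fun x => (c v0)^-1 * phi x * c v0), (fun v => (c v0)^-1 * c v); split.
  - by move=> x y; rewrite phiM !mulgA mulgK.
  - by rewrite mulVg.
  - by move=> u v uv; rewrite (phiE u v uv) invgM invgK !mulgA !mulgK.
have inverse (A B : groupType) (a : V -> V -> A) (b : V -> V -> B) (phi : A -> B) (psi : B -> A) c d :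
    universal K v0 a ->
    {morph phi : x y / x * y} -> c v0 = 1 ->
    (forall u v, [set u; v]%SET \in K -> b u v = (c u)^-1 * phi (a u v) * c v) ->
    {morph psi : x y / x * y} -> d v0 = 1 ->
    (forall u v, [set u; v]%SET \in K -> a u v = (d u)^-1 * psi (b u v) * d v) ->
    cancel phi psi.
  move=> [_ _ aU] phiM c0 phiE psiM d0 psiE.
  suff e : id =1 (fun x => psi (phi x)) by move=> x; rewrite -e.
  apply: (aU A id (fun x => psi (phi x)) (fun v => (d v)^-1 * (psi (c v))^-1)
    (fun _ _ => erefl)).
  - by move=> y z; rewrite phiM psiM.
  - by rewrite c0 d0 (morph_one psiM) !invg1 mulg1.
  - move=> u v uv; have -> : phi (a u v) = c u * b u v * (c v)^-1.
      by rewrite (phiE u v uv) !mulgA mulgV mul1g mulgK.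
    rewrite !psiM (morph_inv psiM) invgM !invgK.
    have -> : psi (b u v) = d u * a u v * (d v)^-1.
      by rewrite (psiE u v uv) !mulgA mulgV mul1g mulgK.
    by rewrite !mulgA.
move=> gU gU'; have [gc _ _] := gU; have [gc' _ _] := gU'.
have [phi [c [phiM c0 phiE]]] := normal _ _ _ _ gU gc'.
have [psi [d [psiM d0 psiE]]] := normal _ _ _ _ gU' gc.
apply: (@isomorphic_of_morph G G' phi psi) => //.
  exact: (inverse _ _ _ _ _ _ _ _ gU phiM c0 phiE psiM d0 psiE).
exact: (inverse _ _ _ _ _ _ _ _ gU' psiM d0 psiE phiM c0 phiE).
Qed.

End UniversalFacts.

Section ConesAttached.
Local Open Scope group_scope.
Variables (d : Order.disp_t) (P : finPOrderType d).
(** The facts on subgroups in abstract form: [reg] stands for regularity, [sigma] for the triple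
    orbits, [tau] for the torus. *)
Variables (reg : pred P) (sigma : P -> {set {set 'I_10}}) (tau : {set {set 'I_10}} -> P).
Variables (X : choiceType) (base : P -> P) (index : P -> P -> X).
Hypothesis sigma_kneser : forall x, ~~ reg x -> sigma x \in kneser.
Hypothesis sigma_le : forall x y, ~~ reg y -> (x <= y)%O -> ~~ reg x /\ sigma x \subset sigma y.
Hypothesis tau_reg : forall s, s \in kneser -> ~~ reg (tau s) /\ sigma (tau s) \subset s.
Hypothesis tau_le : forall s t, t \in kneser -> s != finset.set0 -> s \subset t -> (tau s <= tau t)%O.
Hypothesis le_tau : forall x, ~~ reg x -> (x <= tau (sigma x))%O.
Hypothesis reg_max : forall x y, reg x -> (x <= y)%O -> y = x.
Hypothesis reg_chain : forall x y z, reg z -> (x <= y)%O -> (y < z)%O -> x = y.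
Hypothesis base_lt : forall z, reg z -> (base z < z)%O.
Hypothesis index_inj : forall x y z w, reg z -> (x < z)%O -> x != base z ->
  reg w -> (y < w)%O -> y != base w -> index z x = index w y -> z = w /\ x = y.
Hypothesis index_surj : forall i, exists z x, [/\ reg z, (x < z)%O, x != base z & index z x = i].

Variables (N : groupType) (g : {set 'I_10} -> {set 'I_10} -> N).
Hypothesis gU : universal kneser rootset g.
Local Notation F := (free_group X).
Local Notation FN := (free_product F N).
Local Notation K := (order_complex P).

Lemma order_complex_sub (s t : {set P}) :
  s \in K -> t != finset.set0 -> t \subset s -> t \in K.
Proof.
rewrite !inE => /andP[_ /forall_inP cs] t0 /fintype.subsetP ts; rewrite t0 /=.
apply/forall_inP => x /ts xs; apply/forall_inP => y /ts ys.
by move/forall_inP: (cs x xs); apply.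
Qed.

Lemma order_complex2 x y : ([set x; y]%SET \in K) = (x >=< y)%O.
Proof.
rewrite inE; apply/andP/idP => [[_ /forall_inP/(_ x)]|xy].
  by rewrite !inE eqxx => /(_ isT)/forall_inP; apply; rewrite !inE eqxx orbT.
split; first by apply/set0Pn; exists x; rewrite !inE eqxx.
apply/forall_inP => a; rewrite !inE => /orP[] /eqP->;
  apply/forall_inP => b; rewrite !inE => /orP[] /eqP->;
  by rewrite ?comparablexx // comparable_sym.
Qed.

Lemma order_complex3 x y z : ([set x; y; z]%SET \in K) = [&& x >=< y, y >=< z & x >=< z]%O.
Proof.
apply/idP/and3P => [Kxyz|[xy yz xz]].
  have sub a b : a \in [set x; y; z]%SET -> b \in [set x; y; z]%SET -> (a >=< b)%O.
    move=> as_ bs; rewrite -order_complex2; apply: (order_complex_sub Kxyz).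
      by apply/set0Pn; exists a; rewrite !inE eqxx.
    by rewrite finset.subUset !finset.sub1set as_.
  by split; apply: sub; rewrite !inE eqxx ?orbT.
rewrite inE; apply/andP; split; first by apply/set0Pn; exists x; rewrite !inE eqxx.
apply/forall_inP => a; rewrite !inE => /orP[/orP[]|] /eqP->;
  apply/forall_inP => b; rewrite !inE => /orP[/orP[]|] /eqP->;
  by rewrite ?comparablexx // comparable_sym.
Qed.

Lemma order_complex_le x y : (x <= y)%O -> [set x; y]%SET \in K.
Proof. by move=> xy; rewrite order_complex2 /Order.comparable xy. Qed.

Lemma order_complex_le3 x y z : (x <= y)%O -> (y <= z)%O -> [set x; y; z]%SET \in K.
Proof.
by move=> xy yz; rewrite order_complex3 /Order.comparable xy yz (le_trans xy yz).
Qed.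

Lemma order_complex1 x : [set x]%SET \in K.
Proof. by rewrite -(finset.setUid [set x]%SET); exact: order_complex_le. Qed.

Lemma comparable_reg x z : reg z -> (x >=< z)%O -> ~~ reg x -> (x < z)%O.
Proof.
move=> rz xz rx; rewrite lt_neqAle; apply/andP; split.
  by apply: contraNneq rx => ->.
by case/orP: xz => // /(reg_max rz) e; move: rx; rewrite e rz.
Qed.

Lemma comparable_regs x z : reg x -> reg z -> (x >=< z)%O -> x = z.
Proof. by move=> rx rz /orP[/(reg_max rx)|/(reg_max rz)]. Qed.

Lemma reg_comparable x y z : reg z -> (x < z)%O -> (y < z)%O -> (x >=< y)%O -> x = y.
Proof.
by move=> rz xz yz /orP[xy|yx]; [apply: reg_chain xy yz|apply/esym; apply: reg_chain yx xz].
Qed.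

Lemma lt_reg x z : reg z -> (x < z)%O -> ~~ reg x.
Proof.
move=> rz xz; apply/negP => rx; move: (xz); rewrite (reg_max rx (ltW xz)) ltxx.
by [].
Qed.

(** One orbit for each nonregular element is a simplicial map to [kneser]: a chain lands among the
    orbits of its largest member. *)
Definition nu (x : P) : {set 'I_10} := odflt rootset [pick t in sigma x].

Lemma nuP x : ~~ reg x -> nu x \in sigma x.
Proof.
move=> /sigma_kneser/mem_kneser[/set0Pn[t ts] _ _].
by rewrite /nu; case: pickP => [//|/(_ t)]; rewrite ts.
Qed.

Lemma kneser_singl t s : s \in kneser -> t \in s -> [set t]%SET \in kneser.
Proof.
move=> ks ts; apply: (kneser_sub ks); last by rewrite finset.sub1set.
by apply/set0Pn; exists t; rewrite inE.
Qed.

Lemma nu_tau1 t : [set t]%SET \in kneser -> nu (tau [set t]%SET) = t.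
Proof.
move=> kt; have [nr ss] := tau_reg kt.
by have := fintype.subsetP ss _ (nuP nr); rewrite inE => /eqP.
Qed.

Lemma nu3_kneser x y z m : ~~ reg m -> (x <= m)%O -> (y <= m)%O -> (z <= m)%O ->
  [set nu x; nu y; nu z]%SET \in kneser.
Proof.
move=> rm xm ym zm.
have nm a : (a <= m)%O -> nu a \in sigma m.
  by move=> am; have [ra sa] := sigma_le rm am; exact: fintype.subsetP sa _ (nuP ra).
apply: (kneser_sub (sigma_kneser rm)).
  by apply/set0Pn; exists (nu x); rewrite !inE eqxx.
by rewrite !finset.subUset !finset.sub1set !nm.
Qed.

Definition leg (z x : P) : F := if x == base z then 1 else free_gen (index z x).

Definition cone_cocycle (x y : P) : FN :=
  match reg x, reg y with
  | false, false => prod_inr F (g (nu x) (nu y))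
  | false, true => prod_inl N (leg y x)
  | true, false => (prod_inl N (leg x y))^-1
  | true, true => 1
  end.

Lemma comparable_max (x y z : P) : (x >=< y)%O -> (y >=< z)%O -> (x >=< z)%O ->
  exists2 m, m \in [:: x; y; z] & [/\ x <= m, y <= m & z <= m]%O.
Proof.
case/orP => xy; case/orP => yz; case/orP => xz.
- by exists z; rewrite ?inE ?eqxx ?orbT.
- by exists z; rewrite ?inE ?eqxx ?orbT //; split=> //; exact: le_trans xy yz.
- by exists y; rewrite ?inE ?eqxx ?orbT.
- by exists y; rewrite ?inE ?eqxx ?orbT.
- by exists z; rewrite ?inE ?eqxx ?orbT.
- by exists x; rewrite ?inE ?eqxx ?orbT.
- by exists x; rewrite ?inE ?eqxx ?orbT //; split=> //; exact: le_trans yz xy.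
- by exists x; rewrite ?inE ?eqxx ?orbT.
Qed.

(** A chain with a regular element has at most one other member, so its triangles are degenerate;
    the remaining ones come from [kneser]. *)
Lemma cone_cocycle_cocycle : cocycle K cone_cocycle.
Proof.
have [gc _ _] := gU; have inr1 := morph_one (@prod_inrM F N).
have xx1 x : ~~ reg x -> prod_inr F (g (nu x) (nu x)) = 1.
  by move=> rx; rewrite (cocycle11 gc) ?inr1 // (kneser_singl (sigma_kneser rx)) ?nuP.
move=> x y z; rewrite order_complex3 => /and3P[xy yz xz].
rewrite /cone_cocycle; case rx: (reg x); case ry: (reg y); case rz: (reg z).
- by rewrite mulg1.
- by rewrite mul1g (comparable_regs rx ry xy).
- have ez := comparable_regs rx rz xz; subst z.
  by rewrite mulVg.
- have yx := comparable_reg rx; rewrite comparable_sym in xy; rewrite comparable_sym in xz.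
  have ey := reg_comparable rx (yx _ xy (negbT ry)) (yx _ xz (negbT rz)) yz; subst z.
  by rewrite xx1 ?ry // mulg1.
- by rewrite mulg1 (comparable_regs ry rz yz).
- have xy' := comparable_reg ry xy (negbT rx); rewrite comparable_sym in yz.
  have e := reg_comparable ry xy' (comparable_reg ry yz (negbT rz)) xz; subst z.
  by rewrite mulgV xx1 ?rx.
- have e := reg_comparable rz (comparable_reg rz xz (negbT rx)) (comparable_reg rz yz (negbT ry)) xy.
  by subst y; rewrite xx1 ?rx // mul1g.
- have [m mxyz [xm ym zm]] := comparable_max xy yz xz.
  have rm : ~~ reg m by move: mxyz; rewrite !inE => /or3P[] /eqP->; rewrite ?rx ?ry ?rz.
  by rewrite -prod_inrM gc // (@nu3_kneser x y z m).
Qed.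

Section Lift.
Variables (H : groupType) (h : P -> P -> H).
Hypothesis hc : cocycle K h.

Lemma h_inv x y : (x <= y)%O -> h y x = (h x y)^-1.
Proof. by move=> xy; rewrite (cocycle_inv hc (order_complex1 x)) // order_complex_le. Qed.

Lemma h_top x y m : (x <= y)%O -> (y <= m)%O -> h x y = h x m * (h y m)^-1.
Proof. by move=> xy ym; rewrite -(hc (order_complex_le3 xy ym)) mulgK. Qed.

(** In the barycentric subdivision an edge is a path of length two through its barycenter. *)
Definition kneser_restriction (t u : {set 'I_10}) : H :=
  h (tau [set t]%SET) (tau [set t; u]%SET) * h (tau [set t; u]%SET) (tau [set u]%SET).

Lemma set1_neq0 (A : finType) (a : A) : [set a]%SET != finset.set0.
Proof. by apply/set0Pn; exists a; rewrite inE. Qed.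

Lemma kneser_restriction_top t u s m : s \in kneser -> t \in s -> u \in s ->
  (tau s <= m)%O ->
  kneser_restriction t u = h (tau [set t]%SET) m * (h (tau [set u]%SET) m)^-1.
Proof.
move=> ks ts us sm; have tus : [set t; u]%SET \subset s.
  by rewrite finset.subUset !finset.sub1set ts.
have n2 : [set t; u]%SET != finset.set0 by apply/set0Pn; exists t; rewrite !inE eqxx.
have k2 := kneser_sub ks n2 tus.
have l1 : (tau [set t]%SET <= tau [set t; u]%SET)%O.
  by apply: tau_le => //; [exact: set1_neq0|rewrite finset.sub1set !inE eqxx].
have l2 : (tau [set u]%SET <= tau [set t; u]%SET)%O.
  by apply: tau_le => //; [exact: set1_neq0|rewrite finset.sub1set !inE eqxx orbT].
have l3 : (tau [set t; u]%SET <= m)%O by apply: le_trans sm; exact: tau_le.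
rewrite /kneser_restriction (h_inv l2) (h_top l1 l3) (h_top l2 l3) invgM invgK !mulgA.
by rewrite mulgKV.
Qed.

Lemma kneser_restriction_cocycle : cocycle kneser kneser_restriction.
Proof.
move=> t u v ks.
have e := kneser_restriction_top ks _ _ (lexx _).
by rewrite !e ?inE ?eqxx ?orbT // !mulgA mulgKV.
Qed.

Lemma cone_cocycle_lift : exists (phi : FN -> H) (c : P -> H),
  {morph phi : x y / x * y} /\
  forall x y, [set x; y]%SET \in K -> h x y = (c x)^-1 * phi (cone_cocycle x y) * c y.
Proof.
have [gc gE _] := gU.
have [f [k [fM fE]]] := gE H _ kneser_restriction_cocycle.
(* The gauge of the vertex [nu x], transported from its torus to [x] through the torus of all orbits
   of [x]; a regular element is reached through its base. *)
pose c0 x := k (nu x) * h (tau [set nu x]%SET) (tau (sigma x)) * h (tau (sigma x)) x.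
pose c x := if reg x then c0 (base x) * h (base x) x else c0 x.
have h1 x : h x x = 1 by apply: (cocycle11 hc); exact: order_complex1.
have sig x : ~~ reg x -> (tau [set nu x]%SET <= tau (sigma x))%O.
  move=> rx; apply: tau_le; rewrite ?sigma_kneser ?set1_neq0 //.
  by rewrite finset.sub1set nuP.
have c0E x m : ~~ reg x -> (tau (sigma x) <= m)%O ->
    c0 x = k (nu x) * h (tau [set nu x]%SET) m * (h x m)^-1.
  move=> rx sm; rewrite /c0 (h_inv (le_tau rx)) (h_top (sig x rx) sm) (h_top (le_tau rx) sm).
  by rewrite invgM invgK !mulgA mulgKV.
have key_ x y : ~~ reg y -> (x <= y)%O -> h x y = (c0 x)^-1 * f (g (nu x) (nu y)) * c0 y.
  move=> ry xy; have [rx sxy] := sigma_le ry xy.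
  have kx := sigma_kneser rx; have ky := sigma_kneser ry.
  have tl : (tau (sigma x) <= tau (sigma y))%O.
    by apply: tau_le => //; case/mem_kneser: kx.
  have nuxy : [set nu x; nu y]%SET \in kneser.
    by have := nu3_kneser ry xy xy (lexx y); rewrite finset.setUid.
  rewrite (c0E x _ rx tl) (c0E y _ ry (lexx _)) !invgM invgK.
  have := fE _ _ nuxy.
  rewrite (@kneser_restriction_top _ _ (sigma y) (tau (sigma y))) ?nuP //; last first.
    exact: fintype.subsetP sxy _ (nuP rx).
  move=> e; rewrite (h_top xy (le_tau ry)).
  have {e} -> : f (g (nu x) (nu y)) = k (nu x) * (h (tau [set nu x]%SET) (tau (sigma y)) *
     (h (tau [set nu y]%SET) (tau (sigma y)))^-1) * (k (nu y))^-1.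
    by rewrite e !mulgA mulgV mul1g mulgK.
  by rewrite !mulgA mulgKV mulgKV mulgKV mulgKV.
pose pickz i := projT1 (cid (index_surj i)).
have pickzP i : exists x, [/\ reg (pickz i), (x < pickz i)%O, x != base (pickz i) & index (pickz i) x = i].
  by rewrite /pickz; case: cid.
pose pickx i := projT1 (cid (pickzP i)).
have pickxP i : [/\ reg (pickz i), (pickx i < pickz i)%O,
    pickx i != base (pickz i) & index (pickz i) (pickx i) = i].
  by rewrite /pickx; case: cid.
(* The generator of a leg goes to the value of [h] there in the gauge [c]; on the base leg this
   value is 1 by the choice of [c]. *)
have [ff [ffM ffE]] := free_group_lift
  (fun i => c (pickx i) * h (pickx i) (pickz i) * (c (pickz i))^-1).
have [phi [phiM phil phir]] := free_product_lift ffM fM.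
have legE x z : reg z -> (x < z)%O -> h x z = (c x)^-1 * ff (leg z x) * c z.
  move=> rz xz; rewrite /leg; case: eqP => [->|/eqP xb].
    rewrite (morph_one ffM) mulg1 /c rz (negbTE (lt_reg rz (base_lt rz))).
    by rewrite mulKg.
  have [r1 l1 b1 i1] := pickxP (index z x).
  have [ez ex] := index_inj r1 l1 b1 rz xz xb i1.
  by rewrite ffE ez ex !mulgA mulVg mul1g mulgKV.
exists phi, c; split=> // x y; rewrite order_complex2 => xy.
rewrite /cone_cocycle; case rx: (reg x); case ry: (reg y).
- by rewrite (comparable_regs rx ry xy) h1 (morph_one phiM) mulg1 mulVg.
- rewrite comparable_sym in xy; have yx := comparable_reg rx xy (negbT ry).
  rewrite (h_inv (ltW yx)) (legE y x rx yx) (morph_inv phiM) phil !invgM invgK.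
  by rewrite !mulgA.
- by rewrite phil -legE //; apply: comparable_reg => //; rewrite rx.
- rewrite phir /c rx ry; case/orP: xy => [xy|yx]; first by rewrite key_ ?ry.
  rewrite (h_inv yx) key_ ?rx // !invgM invgK.
  have nuyx : [set nu y; nu x]%SET \in kneser.
    by have := nu3_kneser (negbT rx) yx yx (lexx x); rewrite finset.setUid.
  have ny : [set nu y]%SET \in kneser.
    by rewrite (kneser_singl (sigma_kneser (negbT ry))) // nuP // ry.
  by rewrite (cocycle_inv gc ny nuyx) (morph_inv fM) /c0 !invgK !mulgA.
Qed.

End Lift.

(** Connectedness as an induction principle serves both for [connect] and for spreading a trivial
    gauge. *)
Lemma kneser_connected (Q : {set 'I_10} -> Prop) : Q rootset ->
  (forall t u, [set t; u]%SET \in kneser -> Q t -> Q u) ->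
  forall t, [set t]%SET \in kneser -> Q t.
Proof.
move=> Qr Qe.
have Qd (S : {set 'I_10}) : #|S| = 3 -> [disjoint rootset & S] -> Q S.
  by move=> S3 rS; apply: Qe Qr; exact: kneser2 card_rootset S3 rS.
move=> t; rewrite kneser1 => /eqP t3.
have [p3 pt rp] := parentsetP t3; apply: (Qe (parentset t)); first exact: kneser2.
exact: Qd.
Qed.

Lemma poset_connected (Q : P -> Prop) : Q (tau [set rootset]%SET) ->
  (forall x y, (x >=< y)%O -> Q x -> Q y) -> forall x, Q x.
Proof.
move=> Qr Qe.
have Qt : forall t, [set t]%SET \in kneser -> Q (tau [set t]%SET).
  apply: kneser_connected => // t u ktu Qt.
  have l v : v \in [set t; u]%SET -> (tau [set v]%SET <= tau [set t; u]%SET)%O.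
    by move=> vtu; apply: tau_le => //; [exact: set1_neq0|rewrite finset.sub1set].
  apply: (Qe (tau [set t; u]%SET)); first by rewrite comparable_sym /Order.comparable l // !inE eqxx orbT.
  by apply: Qe Qt; rewrite /Order.comparable l // !inE eqxx.
have Qn x : ~~ reg x -> Q x.
  move=> rx; have ks := sigma_kneser rx; have nx := nuP rx.
  have l : (tau [set nu x]%SET <= tau (sigma x))%O.
    by apply: tau_le; rewrite ?set1_neq0 // finset.sub1set.
  apply: (Qe (tau (sigma x))); first by rewrite /Order.comparable le_tau ?orbT.
  apply: (Qe (tau [set nu x]%SET)); first by rewrite /Order.comparable l.
  by apply: Qt; exact: kneser_singl ks nx.
move=> x; case rx: (reg x); last by apply: Qn; rewrite rx.
have bx := base_lt rx; apply: (Qe (base x)); first by rewrite /Order.comparable (ltW bx).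
exact/Qn/(lt_reg rx bx).
Qed.

(** For the uniqueness, subdivided edges bring the hypothesis back to [kneser], so the morphisms
    agree on [N]. Then the gauge is trivial everywhere by connectedness, base legs included, and the
    other legs give the agreement on the free generators. *)
Theorem cone_cocycle_universal : universal K (tau [set rootset]%SET) cone_cocycle.
Proof.
have [gc _ gUU] := gU.
split; [exact: cone_cocycle_cocycle|exact: cone_cocycle_lift|].
move=> H phi psi c phiM psiM c0 e.
have edge t u : [set t; u]%SET \in kneser ->
    psi (prod_inr F (g t u)) = (c (tau [set t]%SET))^-1 * phi (prod_inr F (g t u)) * c (tau [set u]%SET).
  move=> ktu; have [r2 s2] := tau_reg ktu.
  have kv v : v \in [set t; u]%SET -> [set v]%SET \in kneser by exact: kneser_singl ktu.
  have l v : v \in [set t; u]%SET -> (tau [set v]%SET <= tau [set t; u]%SET)%O.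
    by move=> vtu; apply: tau_le => //; [exact: set1_neq0|rewrite finset.sub1set].
  have [tt uu] : t \in [set t; u]%SET /\ u \in [set t; u]%SET by rewrite !inE !eqxx orbT.
  have gE : prod_inr F (g t u) = cone_cocycle (tau [set t]%SET) (tau [set t; u]%SET) *
      cone_cocycle (tau [set t; u]%SET) (tau [set u]%SET).
    have [r1 _] := tau_reg (kv t tt); have [r3 _] := tau_reg (kv u uu).
    rewrite /cone_cocycle (negbTE r1) (negbTE r2) (negbTE r3) -prod_inrM !nu_tau1 ?kv //.
    have ns := fintype.subsetP s2 _ (nuP r2).
    rewrite gc //; apply: (kneser_sub ktu).
      by apply/set0Pn; exists t; rewrite !inE eqxx.
    by rewrite !finset.subUset !finset.sub1set tt ns uu.
  rewrite gE psiM phiM !e ?(order_complex_le (l t tt)) //; last first.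
    by rewrite finset.setUC; exact: order_complex_le (l u uu).
  by rewrite !mulgA mulgK.
have fr y : phi (prod_inr F y) = psi (prod_inr F y).
  apply: (gUU H (fun y => phi (prod_inr F y)) (fun y => psi (prod_inr F y))
    (fun t => c (tau [set t]%SET))) => //.
  - by move=> a b; rewrite prod_inrM phiM.
  - by move=> a b; rewrite prod_inrM psiM.
(* Where the morphisms are known to agree, the gauge equation carries c = 1 across the edge. *)
have cstep x y : phi (cone_cocycle x y) = psi (cone_cocycle x y) -> (x >=< y)%O -> c x = 1 -> c y = 1.
  move=> pe xy cx; have := e x y; rewrite order_complex2 => /(_ xy); rewrite cx invg1 mul1g -pe.
  by move=> E; apply: (mulgI (phi (cone_cocycle x y))); rewrite mulg1 -E.
have cn : forall x, ~~ reg x -> c x = 1.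
  have ct : forall t, [set t]%SET \in kneser -> c (tau [set t]%SET) = 1.
    apply: kneser_connected => // t u ktu ct; have := edge t u ktu.
    by rewrite ct invg1 mul1g -fr => E; apply: (mulgI (phi (prod_inr F (g t u)))); rewrite mulg1 -E.
  move=> x rx; have ks := sigma_kneser rx; have nx := nuP rx.
  have l : (tau [set nu x]%SET <= tau (sigma x))%O.
    by apply: tau_le; rewrite ?set1_neq0 // finset.sub1set.
  have [rs _] := tau_reg ks; have [r1 _] := tau_reg (kneser_singl ks nx).
  apply: (cstep (tau (sigma x))).
  - by rewrite /cone_cocycle (negbTE rs) (negbTE rx) fr.
  - by rewrite /Order.comparable le_tau ?orbT.
  apply: (cstep (tau [set nu x]%SET)).
  - by rewrite /cone_cocycle (negbTE rs) (negbTE r1) fr.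
  - by rewrite /Order.comparable l.
  by apply: ct; exact: kneser_singl ks nx.
have cr x : reg x -> c x = 1.
  move=> rx; have bx := base_lt rx; have nb := lt_reg rx bx.
  apply: (cstep (base x)); last exact: cn.
    rewrite /cone_cocycle (negbTE nb) rx /leg eqxx (morph_one (@prod_inlM F N)).
    by rewrite (morph_one phiM) (morph_one psiM).
  by rewrite /Order.comparable (ltW bx).
apply: free_product_ext => // a.
apply: (@free_group_ext X H (fun a => phi (prod_inl N a)) (fun a => psi (prod_inl N a))).
- by move=> u v; rewrite prod_inlM phiM.
- by move=> u v; rewrite prod_inlM psiM.
move=> i; have [z [x [rz xz xb <-]]] := index_surj i.
have nx := lt_reg rz xz.
have := e x z (order_complex_le (ltW xz)).
rewrite /cone_cocycle (negbTE nx) rz /leg (negbTE xb) cn // cr // invg1 mul1g mulg1.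
by move=> ->.
Qed.

End ConesAttached.

Local Close Scope ring_scope.

Lemma kneser_universal (R : realType) :
  exists (N : groupType) (g : {set 'I_10} -> {set 'I_10} -> N), universal kneser rootset g.
Proof.
have Kr : [set rootset]%SET \in kneser by rewrite kneser1 card_rootset.
pose y : set_type (geometric_realization R kneser) := SigSub (vertex_in R Kr).
have ry : rootset \in supp y by rewrite inE /bary set_valE /= eqxx oner_eq0.
exists (fundamental_group R y); eexists.
apply: (fundamental_group_universal kneser_sub ry).
apply: kneser_connected => // t u tu rt; exact: connect_trans rt (connect1 tu).
Qed.

Theorem mainTheorem2 (R : realType)
  (x0 : set_type (geometric_realization R
                    (order_complex (Ap_poset 3 'Alt_('I_10)%G)))) :
  ~ is_free (poset_pi1 x0) /\
  exists N : groupType,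
    [/\ isomorphic (poset_pi1 x0) (free_product (free_group 'I_25200) N),
        ~ is_free N
      & isomorphic (abelianization N) (Algebra.to_multiplicative 'rV[int]_42)].
Proof.
have [N [g gU]] := kneser_universal R.
have legsE : #|legs| = 25200 by rewrite card_legs; vm_compute.
have [index [index_inj index_surj]] := legs_index legsE.
(* [x0] is an arbitrary point; a vertex of its carrier serves as base vertex, and as the default of
   [Ap_torus]. *)
pose b := svertex x0; pose K := order_complex (Ap_poset 3 'Alt_('I_10)%G).
have tU := cone_cocycle_universal Ap_orbits_kneser Ap_orbits_le
  (Ap_torus_regular b) (Ap_torus_le b) (le_Ap_torus b)
  Ap_regular_max Ap_regular_chain Ap_base_lt index_inj index_surj gU.
have conn x : connect (fun u v => [set u; v]%SET \in K) (Ap_torus b [set rootset]%SET) x.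
  move: x; apply: (poset_connected Ap_orbits_kneser (Ap_torus_le b) (le_Ap_torus b)
    Ap_regular_max Ap_base_lt) => //.
  by move=> x y xy /connect_trans; apply; apply: connect1; rewrite order_complex2.
have connC : connect_sym (fun u v => [set u; v]%SET \in K).
  by apply: sym_connect_sym => u v; rewrite finset.setUC.
have conn0 x : connect (fun u v => [set u; v]%SET \in K) b x.
  by apply: connect_trans (conn x); rewrite connC.
have pU := fundamental_group_universal (@order_complex_sub _ _) (svertexP x0) (fun v _ => conn0 v).
have iso := universal_iso pU (universal_base (conn b) tU).
split; last first.
  exists N; split=> //; last exact: abelianization_kneser gU.
  exact: (@not_free_of_retract _ _ gU N id id).
have [f [f' fK f'K]] := iso.
(* Killing the free factor retracts the free product onto [N]; through [iso], [N] is a retract of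
   the fundamental group. *)
have [e [eM _ er]] := @free_product_lift (free_group 'I_25200) N N (fun=> 1%g) id
  (fun _ _ => esym (mulg1 _)) (fun _ _ => erefl).
apply: (@not_free_of_retract _ _ gU _ (fun y => f' (prod_inr _ y)) (fun x => e (f x))).
- move=> y z; apply: (can_inj fK); rewrite gmulfM !f'K; exact: prod_inrM.
- by move=> y z; rewrite gmulfM eM.
- by move=> y; rewrite f'K er.
Qed.
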